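(* Let $T\ge 1$ and let $U_t=g_t(X^t)$, $t=0,\dots,T-1$, be any deterministic (measurable) feedback policy for the system described in the context. Then $$I(\Theta;X^T)=I(Y^T\rightarrow X^T),$$ and moreover $$\mathbb{E}[\det(\Pi_T)]\ \ge\ \det(\Pi_0)\,2^{-2I(Y^T\rightarrow X^T)}.$$
   Context: Setup (closed-loop identification of a scalar linear system). Let $W>0$. The state evolves as $X_{t+1}=AX_t+BU_t+W_t$, $X_0=0$, where $W_0,W_1,\dots$ are i.i.d. $\mathcal N(0,W)$. The unknown parameter $\Theta=[A\;B]^\intercal\in\mathbb R^2$ is random with prior $\Theta\sim\mathcal N(\hat\theta_0,\Pi_0)$, $\Pi_0\succ 0$, independent of $(W_t)_t$. The input is $U_t=g_t(X^t)$ for deterministic measurable functions $g_t$, where $X^t=(X_0,\dots,X_t)$. Let $Z_t=[X_t\;U_t]^\intercal$, so $X_{t+1}=Z_t^\intercal\Theta+W_t$. Define the ''channel input'' $Y_t:=Z_{t-1}^\intercal\Theta$ for $t\ge1$, so that $X_t=Y_t+W_{t-1}$, and $Y^t=(Y_1,\dots,Y_t)$. The matrices $\Pi_t$ are defined by $\Pi_t^{-1}=\Pi_0^{-1}+\sum_{i=1}^t Z_{i-1}W^{-1}Z_{i-1}^\intercal$ (equivalently the recursion $\Pi_t=\Pi_{t-1}-\frac{\Pi_{t-1}Z_{t-1}Z_{t-1}^\intercal\Pi_{t-1}}{W+Z_{t-1}^\intercal\Pi_{t-1}Z_{t-1}}$); $\Pi_t$ is the posterior covariance of $\Theta$ given $X^t$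 (regularized least-squares / Kalman filter error covariance). Directed information is $I(Y^T\rightarrow X^T):=\sum_{t=1}^T I(Y^t;X_t\mid X^{t-1})$. All logarithms (in entropies and mutual informations) are base 2. *)

(* Defs.v *)
From HB Require Import structures.
From mathcomp Require Import all_boot all_order all_algebra.
From mathcomp Require Import all_classical all_reals all_analysis.
Set Implicit Arguments. Unset Strict Implicit. Unset Printing Implicit Defensive.
Import Order.TTheory GRing.Theory Num.Theory.
Import numFieldNormedType.Exports.
Local Open Scope classical_set_scope.
Local Open Scope ring_scope.

Definition log2 {R : realType} (x : R) : R := ln x / ln 2.

Definition plogq {R : realType} (p q : R) : \bar R :=
  if p == 0 then 0%E else if q == 0 then +oo%E else (p * log2 (p / q))%:E.

(* 2^{-2 x} on extended reals (x >= 0 in all uses); 2^{-oo} = 0. *)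
Definition exp2m2 {R : realType} (x : \bar R) : \bar R :=
  match x with
  | r%:E => (2 `^ (- (2 * r)))%:E
  | +oo%E => 0%E
  | -oo%E => +oo%E
  end.

(* Information measures on a probability space (general, partition-based
   definitions of Dobrushin/Pinsker/Wyner), stated for sub-sigma-algebras. *)
Section Info.
Context {R : realType} {d : measure_display} {Omega : measurableType d}.
Variable P : probability Omega R.

Definition Pr (E : set Omega) : R := fine (P E).

Definition is_partition (F : set (set Omega)) (n : nat) (a : 'I_n -> set Omega) :=
  [/\ forall i, F (a i),
      forall i j, i != j -> a i `&` a j = set0
    & forall x, exists i, a i x].

Definition MI (F G : set (set Omega)) : \bar R :=
  ereal_sup [set v | exists (n m : nat) (a : 'I_n -> set Omega) (b : 'I_m -> set Omega),
    [/\ is_partition F a, is_partition G b &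
        v = (\sum_(i < n) \sum_(j < m) plogq (Pr (a i `&` b j)) (Pr (a i) * Pr (b j)))%E]].

Definition is_condprob (H : set (set Omega)) (E : set Omega) (f : Omega -> R) :=
  [/\ forall x, 0 <= f x <= 1,
      forall B : set R, measurable B -> H (f @^-1` B)
    & forall C, H C -> (\int[P]_(x in C) (f x)%:E = P (E `&` C))%E].

Definition condprob (H : set (set Omega)) (E : set Omega) : Omega -> R :=
  match pselect (exists f, is_condprob H E f) with
  | left h => proj1_sig (cid h)
  | right _ => fun _ => 0
  end.

(* conditional mutual information I(F ; G | H) = D(P || P_{.|H} x P_{.|H} x P_H),
   computed as the supremum over finite product partitions *)
Definition CMI (F G H : set (set Omega)) : \bar R :=
  ereal_sup [set v | exists (n m k : nat) (a : 'I_n -> set Omega)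
      (b : 'I_m -> set Omega) (c : 'I_k -> set Omega),
    [/\ is_partition F a, is_partition G b, is_partition H c &
        v = (\sum_(i < n) \sum_(j < m) \sum_(l < k)
              plogq (Pr (a i `&` b j `&` c l))
                    (fine (\int[P]_(x in c l)
                       (condprob H (a i) x * condprob H (b j) x)%:E)))%E]].

Definition sigmaRV (n : nat) (Xs : 'I_n -> Omega -> R) : set (set Omega) :=
  <<s [set S | exists i (B : set R), measurable B /\ S = Xs i @^-1` B] >>.

Definition Expect (f : Omega -> R) : \bar R := (\int[P]_x (f x)%:E)%E.

End Info.

Section Borel.
Context {R : realType}.
Definition rV_borel (n : nat) : set (set 'rV[R]_n) :=
  <<s [set S | exists Bs : 'I_n -> set R, (forall i, measurable (Bs i)) /\
               S = [set v : 'rV[R]_n | forall i, Bs i (v ord0 i)]] >>.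
Definition rV_measurable_fun (n : nat) (f : 'rV[R]_n -> R) :=
  forall B : set R, measurable B -> rV_borel (f @^-1` B).
End Borel.

Definition gauss2 {R : realType} (m : 'cV[R]_2) (S : 'M[R]_2) (x : 'cV[R]_2) : R :=
  (2 * pi * Num.sqrt (\det S))^-1 *
  expR (- ((((x - m)^T *m invmx S *m (x - m)) ord0 ord0) / 2)).

Definition posdef {R : realType} (S : 'M[R]_2) :=
  S^T = S /\ forall v : 'cV[R]_2, v != 0 -> 0 < ((v^T *m S *m v) ord0 ord0).

Definition col2 {R : realType} (a b : R) : 'cV[R]_2 :=
  \col_(i < 2) (if i == ord0 then a else b).

Section System.
Context {R : realType}.
Variable g : forall t : nat, 'rV[R]_t.+1 -> R.

Fixpoint traj (a b : R) (w : nat -> R) (t : nat) : seq R :=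
  match t with
  | 0 => [:: 0]
  | t'.+1 =>
      let s := traj a b w t' in
      rcons s (a * last 0 s + b * g (\row_(i < t'.+1) nth 0 s i) + w t')
  end.

Context {d : measure_display} {Omega : measurableType d}.
Variables (A B : Omega -> R) (W : nat -> Omega -> R).

Definition Xrv (t : nat) (w : Omega) : R :=
  nth 0 (traj (A w) (B w) (fun s => W s w) t) t.
Definition Xvec (t : nat) (w : Omega) : 'rV[R]_t.+1 :=
  \row_(i < t.+1) nth 0 (traj (A w) (B w) (fun s => W s w) t) i.
Definition Urv (t : nat) (w : Omega) : R := g (Xvec t w).
Definition Zrv (t : nat) (w : Omega) : 'cV[R]_2 := col2 (Xrv t w) (Urv t w).
(* channel input Y_t = Z_{t-1}^T Theta, t >= 1 *)
Definition Yrv (t : nat) (w : Omega) : R := A w * Xrv t.-1 w + B w * Urv t.-1 w.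
Definition Pirv (Wv : R) (Pi0 : 'M[R]_2) (t : nat) (w : Omega) : 'M[R]_2 :=
  invmx (invmx Pi0 + \sum_(i < t) Wv^-1 *: (Zrv i w *m (Zrv i w)^T)).
End System.

(* Main.v *)
Require Import Defs.
From HB Require Import structures.
From mathcomp Require Import all_boot all_order all_algebra.
From mathcomp Require Import all_classical all_reals all_analysis.
From mathcomp Require Import measurable_realfun ring lra.
Import Order.TTheory GRing.Theory Num.Theory.
Import numFieldNormedType.Exports.
Local Open Scope classical_set_scope.
Local Open Scope ring_scope.
Set Implicit Arguments.
Unset Strict Implicit.
Unset Printing Implicit Defensive.

(* Let h_T be the prior density of Theta divided by its posterior density given
   X^T, evaluated at the data.  The measure h_T P keeps the marginal laws of Theta
   and X^T but makes them independent, and h_T is measurable with respect to the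
   pair; by approximation on finite product partitions (Donsker-Varadhan), the
   mutual information is the relative entropy D(P || h_T P), that is
   - E [log2 h_T].  In the same way I(Y^t+1; X_t+1 | X^t) is D(P || k_t P), where
   k_t is the predictive density of X_t+1 given X^t divided by its Gaussian
   likelihood.  Bayes' rule is h_t+1 = h_t k_t; all these densities have mean 1,
   so the relative entropies add up, which is the identity.

   For the bound, 2 ln h_T = ln (det Pi_T / det Pi_0) - Q_0 + Q_T, where Q_t is the
   squared Mahalanobis distance of Theta to its mean under the law of Theta given
   X^t, so that E [Q_0] = E [Q_T] = 2.  Hence E [ln (det Pi_T / det Pi_0)] is
   - 2 ln 2 times the mutual information, and Jensen's inequality concludes. *)

(** * Densities and approximation over a generating family *)

(** The informations are suprema over finite partitions, built on conditional probabilities of which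
    only some version is chosen, and they may be infinite. Taking the density of the product law
    with respect to [P], and not the converse, makes it an explicit positive function on [Omega]:
    the reference law lives on the same space and no term of a partition sum is infinite. Where a
    value may be infinite, integrands are kept nonnegative: terms that would be subtracted are moved
    to the other side, and only finite integrals are cancelled. Conditional laws are handled through
    identities between expectations, in which Theta is redrawn from its posterior density given the
    history.

    That directed information involves [Y^(t+1)] and not Theta is harmless for two reasons. An event
    of [Y^(t+1)] is an event of the pair (Theta, [X^t]), so the posterior of Theta gives its
    conditional probability; and the likelihood of [X_(t+1)] depends on Theta only through
    [Y_(t+1)], so [k_t] is measurable for the smaller sigma-algebra. *)

Section DensityMeasure.
Context d (T : measurableType d) (R : realType) (mu : {measure set T -> \bar R}).
Variables (f : T -> R) (f0 : forall x, 0 <= f x) (mf : measurable_fun setT f).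

(** The two proofs are arguments so that the measure structure declared below can be inferred from
    the term alone. *)
Definition density_measure of (forall x, 0 <= f x) & measurable_fun setT f :=
  fun A : set T => (\int[mu]_(x in A) (f x)%:E)%E.

Local Notation nu := (density_measure f0 mf).

Let nu0 : nu set0 = 0%E. Proof. exact: integral_set0. Qed.

Let nu_ge0 A : (0 <= nu A)%E.
Proof. by apply: integral_ge0 => x _; rewrite lee_fin. Qed.

Let nu_sigma_additive : semi_sigma_additive nu.
Proof.
move=> F mF tF mUF; rewrite /density_measure ge0_integral_bigcup//; last 2 first.
- by apply: measurable_funTS; apply/measurable_EFinP.
- by move=> x _; rewrite lee_fin.
by apply: is_cvg_ereal_nneg_natsum_cond => n _ _; exact: nu_ge0.
Qed.

HB.instance Definition _ := isMeasure.Build _ _ _ nu nu0 nu_ge0 nu_sigma_additive.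

Import HBNNSimple.

Lemma ge0_integral_density (g : T -> \bar R) : measurable_fun setT g ->
  (forall x, 0 <= g x)%E ->
  (\int[nu]_x g x = \int[mu]_x (g x * (f x)%:E))%E.
Proof.
move=> mg g0; pose g_ := nnsfun_approx measurableT mg.
have gcv x : (EFin \o g_ ^~ x) @ \oo --> g x by apply: cvg_nnsfun_approx.
transitivity (limn (fun n => \int[nu]_x (g_ n x)%:E)%E).
  rewrite -monotone_convergence//.
  - by apply: eq_integral => y _; apply/esym/cvg_lim => //; exact: gcv.
  - by move=> n; exact/measurable_EFinP/measurable_funP.
  - by move=> n y _; rewrite lee_fin.
  - by move=> y _ m n mn; rewrite lee_fin; exact/lefP/nd_nnsfun_approx.
rewrite [X in limn X](_ : _ = (fun n => \int[mu]_x ((g_ n x)%:E * (f x)%:E))%E).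
  rewrite -monotone_convergence//; last 3 first.
  - by move=> n; apply/measurable_EFinP/measurable_funM => //; exact: measurable_funP.
  - by move=> n x _; rewrite -EFinM lee_fin mulr_ge0.
  - move=> x _ m n mn; rewrite -!EFinM lee_fin ler_wpM2r//.
    by exact/lefP/nd_nnsfun_approx.
  apply: eq_integral => x _; apply/cvg_lim => //.
  by apply: cvgeZr => //; exact: gcv.
apply/funext => n.
transitivity (\sum_(k \in range (g_ n))
    \int[nu]_x (k * \1_(g_ n @^-1` [set k]) x)%:E)%E.
  under eq_integral do rewrite fimfunE -fsumEFin//.
  rewrite ge0_integral_fsum//.
  - by move=> y; exact/measurable_EFinP/measurable_funM.
  - by move=> y x _; rewrite nnfun_muleindic_ge0.
transitivity (\sum_(k \in range (g_ n))
    \int[mu]_x ((k * \1_(g_ n @^-1` [set k]) x)%:E * (f x)%:E))%E; last first.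
  rewrite -ge0_integral_fsum//.
  - apply: eq_integral => x _; rewrite [in RHS]fimfunE -fsumEFin//.
    by rewrite -ge0_mule_fsuml// => k; rewrite nnfun_muleindic_ge0.
  - by move=> y; apply/measurable_EFinP/measurable_funM => //; exact/measurable_funM.
  - by move=> y x _; rewrite mule_ge0 ?nnfun_muleindic_ge0// lee_fin.
apply: eq_fsbigr => r _; rewrite integralZl_indic_nnsfun// integral_indic// setIT.
(* Pulling the value [r] out of the integral requires [0 <= r]; a negative [r] has an empty level
   set. *)
have [->|[r0 E0]] : (g_ n @^-1` [set r] = set0 \/
    (0 <= r /\ g_ n @^-1` [set r] !=set0))%classic.
  have [r0|/preimage_nnfun0 ->] := leP 0 r; last by left.
  by have [->|/set0P] := eqVneq (g_ n @^-1` [set r]) set0; [left|right].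
  rewrite measure0 mule0 integral0_eq// => x _.
  by rewrite indic0 mulr0 mul0e.
rewrite [X in (_ * X)%E]/(density_measure f0 mf _) /density_measure.
under [RHS]eq_integral do rewrite EFinM -muleA.
rewrite ge0_integralZl//.
- congr (_ * _)%E; rewrite integral_mkcond; apply: eq_integral => x _.
  by rewrite patchE indicE; case: ifP; rewrite ?mul1e ?mul0e.
- by apply/measurable_EFinP/measurable_funM => //; exact: measurable_indic.
- by move=> x _; rewrite -EFinM lee_fin mulr_ge0.
Qed.

End DensityMeasure.

Section SetIntegrals.
Context d (T : measurableType d) (R : realType) (mu : {measure set T -> \bar R}).
Context d' (S : measurableType d') (phi : T -> S) (mphi : measurable_fun setT phi).

Lemma integral_setE (A : set T) (f : T -> \bar R) : 
  (\int[mu]_(x in A) f x = \int[mu]_x ((\1_A x)%:E * f x))%E.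
Proof.
rewrite integral_mkcond; apply: eq_integral => x _.
by rewrite patchE indicE; case: ifP; rewrite ?mul1e ?mul0e.
Qed.

(* The integrals of [f] and [g] over the sigma-algebra of [phi] determine all
   their moments against functions of [phi]. *)
Lemma eq_integral_factor (f g : T -> R) :
  measurable_fun setT f -> measurable_fun setT g ->
  (forall x, 0 <= f x) -> (forall x, 0 <= g x) ->
  (forall C, measurable C -> \int[mu]_(x in phi @^-1` C) (f x)%:E =
                             \int[mu]_(x in phi @^-1` C) (g x)%:E)%E ->
  forall h : S -> \bar R, measurable_fun setT h -> (forall s, 0 <= h s)%E ->
  (\int[mu]_x (h (phi x) * (f x)%:E) = \int[mu]_x (h (phi x) * (g x)%:E))%E.
Proof.
move=> mf mg f0 g0 fg h mh h0.
have mhphi : measurable_fun setT (h \o phi) by exact: measurableT_comp.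
have hphi0 x : (0 <= (h \o phi) x)%E by exact: h0.
rewrite -(ge0_integral_density mu f0 mf mhphi hphi0).
rewrite -(ge0_integral_density mu g0 mg mhphi hphi0).
rewrite -[LHS](@ge0_integral_pushforward _ _ _ _ _ _ mphi _ setT h)//.
rewrite -[RHS](@ge0_integral_pushforward _ _ _ _ _ _ mphi _ setT h)//.
by apply: eq_measure_integral => A mA _; exact: fg.
Qed.

End SetIntegrals.

(** The membership bits of [x] name the atom containing it in the finite algebra generated by
    [K]. *)
Definition signature {T : Type} (K : seq (set T)) (x : T) : seq bool :=
  [seq `[< A x >] | A <- K].

(** The map [y] is constant on the atoms of some finite subfamily of [C]. The codomain is arbitrary
    so that a set, being a map to [Prop], and a simple function are instances of the same notion. *)
Definition finite_over {T : Type} {V : Type} (C : set (set T)) (y : T -> V) :=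
  exists2 K : seq (set T), all (fun A => `[< C A >]) K &
    forall x x', signature K x = signature K x' -> y x = y x'.

Section FiniteOver.
Context {T : Type} (C : set (set T)).

Lemma finite_over_cst {V : Type} (v : V) : finite_over C (fun _ => v).
Proof. by exists [::]. Qed.

Lemma finite_over_set (A : set T) : C A -> finite_over C A.
Proof.
move=> CA; exists [:: A]; first by rewrite /= andbT; apply/asboolP.
by move=> x x' [] e; apply/propext; exact: asbool_eq_equiv e.
Qed.

Lemma finite_over2 {U V X : Type} (op : U -> V -> X) (y : T -> U) (z : T -> V) :
  finite_over C y -> finite_over C z ->
  finite_over C (fun x => op (y x) (z x)).
Proof.
move=> [K CK yK] [K' CK' zK']; exists (K ++ K'); first by rewrite all_cat CK.
move=> x x'; rewrite /signature !map_cat => /eqP.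
rewrite eqseq_cat ?size_map// => /andP[/eqP e /eqP e'].
by rewrite (yK _ _ e) (zK' _ _ e').
Qed.

Lemma finite_over1 {U X : Type} (op : U -> X) (y : T -> U) :
  finite_over C y -> finite_over C (fun x => op (y x)).
Proof. by move=> [K CK yK]; exists K => // x x' /yK ->. Qed.

End FiniteOver.

Section Approximation.
Context d (T : measurableType d) (R : realType) (mu : {measure set T -> \bar R}).
Hypothesis muoo : (mu setT < +oo)%E.
Variable C : set (set T).
Hypothesis mC : C `<=` measurable.

(** Sets at arbitrarily small [mu]-distance, measured by the symmetric difference, from the finite
    algebras over [C]. They form a sigma-algebra containing [C], hence contain all of [<<s C >>]. *)
Let approx : set (set T) := [set E | measurable E /\
  forall e : R, 0 < e -> exists A : set T,
  [/\ finite_over C A, measurable A & (mu (E `\` A `|` A `\` E) <= e%:E)%E]].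

Let mudiff (A B : set T) : measurable A -> measurable B -> measurable (A `\` B `|` B `\` A).
Proof. by move=> mA mB; apply: measurableU; exact: measurableD. Qed.

Let approx0 : approx set0.
Proof.
split=> // e e0; exists set0; split => //; first exact: (finite_over_cst C False).
by rewrite !setD0 setU0 measure0 lee_fin ltW.
Qed.

Let approxC E : approx E -> approx (~` E).
Proof.
move=> [mE aE]; split; first exact: measurableC.
move=> e e0; have [A [CA mA EA]] := aE _ e0; exists (~` A); split.
- exact: (finite_over1 not CA).
- exact: measurableC.
- suff -> : ~` E `\` ~` A `|` ~` A `\` ~` E = E `\` A `|` A `\` E by [].
  by rewrite !setDE !setCK setUC; congr (_ `|` _); exact: setIC.
Qed.

Let approxU E F : approx E -> approx F -> approx (E `|` F).
Proof.
move=> [mE aE] [mF aF]; split; first exact: measurableU.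
move=> e e0; have e2 : 0 < e / 2 by rewrite divr_gt0.
have [A [CA mA EA]] := aE _ e2; have [B [CB mB FB]] := aF _ e2.
exists (A `|` B); split.
- exact: (finite_over2 or CA CB).
- exact: measurableU.
- have mEA := mudiff mE mA; have mFB := mudiff mF mB.
  apply: (@le_trans _ _ (mu ((E `\` A `|` A `\` E) `|` (F `\` B `|` B `\` F)))).
    apply: le_measure; rewrite ?inE.
    + by apply: mudiff; exact: measurableU.
    + exact: measurableU.
    + by move=> x /= [[[?|?] /not_orP[]]|[[?|?] /not_orP[]]]; tauto.
  apply: (le_trans (measureU2 _ _ _)) => //; try exact: measurableU.
  by rewrite [e in leRHS](splitr e) EFinD leeD.
Qed.

(** What the first [n] sets leave of the union decreases to the empty set, so by finiteness of [mu]
    some remainder weighs at most [e / 2]; the corresponding finite union is approximated within the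
    other half. *)
Let approx_bigcup (F : (set T)^nat) :
  (forall n, approx (F n)) -> approx (\bigcup_n F n).
Proof.
move=> aF; have mF n : measurable (F n) by case: (aF n).
have mUF : measurable (\bigcup_n F n) by exact: bigcupT_measurable.
split=> // e e0; have e2 : 0 < e / 2 by rewrite divr_gt0.
pose G n := \bigcup_n F n `\` \big[setU/set0]_(i < n) F i.
have mG n : measurable (G n).
  by apply: measurableD => //; exact: bigsetU_measurable.
have G0 : \bigcap_n G n = set0.
  rewrite -subset0 => x Gx; have [[k _ Fkx] _] := Gx 0%N I.
  have [_] := Gx k.+1 I; apply; rewrite big_ord_recr/=; by right.
have : mu \o G @ \oo --> mu (\bigcap_n G n).
  apply: nonincreasing_cvg_mu => //.
  - by apply: le_lt_trans muoo; rewrite le_measure ?inE.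
  - by rewrite G0.
  - move=> m n mn; rewrite subsetEset; apply: setDS.
    exact: (subset_bigsetU).
rewrite G0 measure0 => /fine_cvgP[Gfin] /cvgrPdist_lt /(_ _ e2) Glt.
have [N [GN GNfin]] : exists N, `|0 - fine (mu (G N))| < e / 2 /\
    mu (G N) \is a fin_num.
  have [N _ HN] := filterI Glt Gfin; exists N; exact: (HN N (leqnn N)).
have {}GN : (mu (G N) <= (e / 2)%:E)%E.
  rewrite -(fineK GNfin) lee_fin ltW//; move: GN; rewrite sub0r normrN.
  by rewrite ger0_norm// fine_ge0.
have [mU /(_ _ e2)[A [CA mA UA]]] : approx (\big[setU/set0]_(i < N) F i).
  elim: (N) => [|n IH]; first by rewrite big_ord0.
  by rewrite big_ord_recr/=; exact: approxU.
exists A; split=> //; have mUA := mudiff mU mA.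
apply: (@le_trans _ _ (mu (G N `|` ((\big[setU/set0]_(i < N) F i) `\` A `|`
    A `\` (\big[setU/set0]_(i < N) F i))))).
  apply: le_measure; rewrite ?inE.
  - exact: mudiff.
  - exact: measurableU.
  - move=> x /= [[Ux Ax]|[Ax Ux]].
      have [UNx|UNx] := pselect ((\big[setU/set0]_(i < N) F i) x).
        by right; left.
      by left; split.
    right; right; split => // Fx; apply: Ux.
    by apply: bigsetU_bigcup Fx.
apply: (le_trans (measureU2 _ _ _)) => //; try exact: measurableU.
by rewrite [e in leRHS](splitr e) EFinD leeD.
Qed.

Lemma finite_over_approx E : <<s C >> E -> measurable E /\
  forall e : R, 0 < e -> exists A : set T,
  [/\ finite_over C A, measurable A & (mu (E `\` A `|` A `\` E) <= e%:E)%E].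
Proof.
suff : <<s C >> `<=` approx by exact.
apply: smallest_sub.
- split; [exact: approx0|move=> A aA|exact: approx_bigcup].
  by rewrite setTD; exact: approxC.
- move=> A CA; split; first exact: mC.
  move=> e e0; exists A; split; [exact: finite_over_set|exact: mC|].
  by rewrite setDv setU0 measure0 lee_fin ltW.
Qed.

(** The induction peels off binary digits: with [E] the set where [y >= 1/2], the function
    [f (y x) = 2 * y x - \1_E x] again takes values in [0, 1], and [y] is half the sum of the
    indicator and of this remainder. *)
Lemma finite_over_approx_fun (y : T -> R) :
  (forall B, measurable B -> <<s C >> (y @^-1` B)) ->
  (forall x, 0 <= y x <= 1) ->
  forall e : R, 0 < e -> exists z : T -> R,
  [/\ finite_over C z, measurable_fun setT z, forall x, 0 <= z x <= 1 &
      (\int[mu]_x `|y x - z x|%:E <= e%:E)%E].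
Proof.
(* The added 1 keeps [c] positive even for a null measure. *)
move=> yC y01 e e0; pose c := fine (mu setT) + 1.
have cE : (mu setT <= c%:E)%E.
  rewrite -[mu setT]fineK ?ge0_fin_numE// lee_fin lerDl//.
have c0 : 0 < c by rewrite ltr_wpDl// fine_ge0.
suff H k : forall y : T -> R,
    (forall B, measurable B -> <<s C >> (y @^-1` B)) ->
    (forall x, 0 <= y x <= 1) -> exists z : T -> R,
    [/\ finite_over C z, measurable_fun setT z, forall x, 0 <= z x <= 1 &
      (\int[mu]_x `|y x - z x|%:E <= (c * (3 / 4) ^+ k)%:E)%E].
  have : c * (3 / 4) ^+ k @[k --> \oo] --> c * 0.
    apply: cvgMr; apply: cvg_expr; rewrite ger0_norm; lra.
  rewrite mulr0 => /cvgrPdist_lt /(_ _ e0)[k _ /(_ k (leqnn k))].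
  rewrite /= sub0r normrN ger0_norm; last by rewrite mulr_ge0 ?exprn_ge0//; lra.
  move=> ke; have [z [? ? ? zk]] := H k _ yC y01; exists z; split => //.
  by apply: (le_trans zk); rewrite lee_fin ltW.
elim: k => [|k IH] {}y {}yC {}y01.
  exists (cst 0); split => //; first exact: finite_over_cst.
    by move=> x /=; rewrite lexx ler01.
  rewrite expr0 mulr1; apply: le_trans cE.
  rewrite -[leRHS]mul1e -integral_cst//; apply: ge0_le_integral => //.
  - apply/measurable_EFinP; apply: measurableT_comp => //.
    apply: measurable_funB => // _ B mB; rewrite setTI.
    by have [] := finite_over_approx (yC _ mB).
  - move=> x _; rewrite lee_fin subr0 ger0_norm; by have /andP[] := y01 x.
pose E := [set x | 2^-1 <= y x].
have CE : <<s C >> E.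
  have -> : E = y @^-1` `[2^-1, +oo[.
    by apply/seteqP; split => x /=; rewrite in_itv/= andbT.
  exact: yC.
pose f (r : R) : R := 2 * r - \1_(`[2^-1, +oo[) r.
have mf : measurable_fun setT f.
  apply: measurable_funB; first exact: measurable_funM.
  exact: measurable_indic.
have fyC B : measurable B -> <<s C >> ((f \o y) @^-1` B).
  by move=> mB; apply: (yC (f @^-1` B)); rewrite -[X in measurable X]setTI; exact: mf.
have fyE x : f (y x) = 2 * y x - \1_E x.
  rewrite /f; congr (_ - _); rewrite !indicE; congr ((nat_of_bool _)%:R).
  by apply/idP/idP; rewrite !inE /E/= in_itv/= andbT.
have my : measurable_fun setT y.
  by move=> _ B mB; rewrite setTI; have [] := finite_over_approx (yC _ mB).
have fy01 x : 0 <= f (y x) <= 1.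
  have /andP[? ?] := y01 x; rewrite /f indicE.
  have [/set_mem|/negP] := boolP (y x \in _); rewrite ?inE/= in_itv/= andbT => ?.
    by lra.
  have : y x < 2^-1 by rewrite ltNge; apply/negP. 
  by move=> ?; rewrite subr0; apply/andP; split; lra.
have [z [Cz mz z01 zk]] := IH _ fyC fy01.
(* The digit set is approximated within half of the error [c * (3 / 4) ^+ k] of the remainder, so
   the new error is half of one and a half times the old one: this is the ratio 3/4. *)
have e'0 : 0 < c * (3 / 4) ^+ k / 2.
  by rewrite divr_gt0// mulr_gt0// exprn_gt0//; lra.
have [mE /(_ _ e'0)[A [CA mA EA]]] := finite_over_approx CE.
exists (fun x => 2^-1 * (\1_A x + z x)); split.
- apply: (finite_over2 (fun (p : Prop) (r : R) => 2^-1 * ((`[< p >])%:R + r)) CA Cz).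
- apply: measurable_funM => //; apply: measurable_funD => //.
- move=> x; have /andP[? ?] := z01 x; rewrite indicE.
  by case: (x \in A) => /=; lra.
- have mD := mudiff mE mA.
  have m1 : measurable_fun [set: T]
      (fun x => ((\1_(E `\` A `|` A `\` E) x)%:E + `|f (y x) - z x|%:E)%E : \bar R).
    apply/measurable_EFinP; apply: measurable_funD => //.
    apply: measurableT_comp => //; apply: measurable_funB => //.
    exact: measurableT_comp.
  apply: (@le_trans _ _ (\int[mu]_x ((2^-1)%:E *
     ((\1_(E `\` A `|` A `\` E) x)%:E + `|f (y x) - z x|%:E)))%E).
    apply: ge0_le_integral => //.
    + apply/measurable_EFinP; apply: measurableT_comp => //.
      apply: measurable_funB => //; apply: measurable_funM => //.
      exact: measurable_funD.
    + exact: measurable_funeM.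
    + move=> x _; rewrite -EFinD -EFinM lee_fin fyE.
      have -> : y x - 2^-1 * (\1_A x + z x) =
        2^-1 * ((\1_E x - \1_A x) + (2 * y x - \1_E x - z x)) by field.
      rewrite normrM ger0_norm// ler_wpM2l//.
      apply: (le_trans (ler_normD _ _)); rewrite lerD2r !indicE.
      have [xE|xE] := boolP (x \in E); have [xA|xA] := boolP (x \in A);
        rewrite ?subrr ?normr0// ?subr0 ?sub0r ?normrN ?normr1.
      * by rewrite in_setU !in_setD xE xA.
      * by rewrite in_setU !in_setD xE xA orbT.
  rewrite ge0_integralZl//; last first.
    by move=> x _; rewrite -EFinD lee_fin addr_ge0.
  rewrite ge0_integralD//; first last.
  + apply/measurable_EFinP.
    apply: measurableT_comp => //; apply: measurable_funB => //.
    exact: measurableT_comp.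
  + exact/measurable_EFinP.
  rewrite integral_indic// setIT.
  rewrite (@le_trans _ _ ((2^-1)%:E * ((c * (3 / 4) ^+ k / 2)%:E +
     (c * (3 / 4) ^+ k)%:E))%E)//.
    by rewrite lee_pmul2l// leeD.
  by rewrite -EFinD -EFinM lee_fin exprS; lra.
Qed.

End Approximation.

(** * Relative entropy and (conditional) mutual information *)

Definition measurable_partition {d} {T : measurableType d} {I : finType}
    (E : I -> set T) :=
  [/\ forall i, measurable (E i), forall i j, i != j -> E i `&` E j = set0
    & forall x, exists i, E i x].

Lemma ln_le_subr1 (R : realType) (x : R) : 0 < x -> ln x <= x - 1.
Proof. by move=> x0; have := @le_ln1Dx R (x - 1); rewrite [1 + _]addrC subrK; apply; lra. Qed.

Section RelativeEntropy.
Context d (T : measurableType d) (R : realType) (P : probability T R).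
Variable h : T -> R.
Hypothesis h_gt0 : forall x, 0 < h x.
Hypothesis mh : measurable_fun setT h.
Hypothesis int_h : (\int[P]_x (h x)%:E = 1)%E.

(* For [h] of mean 1 this is [D(P || h P)] in nats: adding [h - 1] to [- ln h] makes
   the integrand nonnegative, so that the integral always makes sense. *)
Definition relent : \bar R := (\int[P]_x (h x - 1 - ln (h x))%:E)%E.

Local Notation Q E := (\int[P]_(x in E) h x).

Lemma kl_loss_ge0 x : 0 <= h x - 1 - ln (h x).
Proof. by have := ln_le_subr1 (h_gt0 x); rewrite subr_ge0. Qed.

Lemma measurable_ln_comp : measurable_fun setT (fun x => ln (h x)).
Proof. exact: (measurableT_comp (@measurable_ln R)). Qed.

Let mloss : measurable_fun setT (fun x => h x - 1 - ln (h x)).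
Proof.
apply: measurable_funB; last exact: measurable_ln_comp.
exact: measurable_funB.
Qed.

Lemma integrable_density : P.-integrable setT (EFin \o h).
Proof.
apply/integrableP; split; first exact/measurable_EFinP.
under eq_integral => x _ do rewrite /= ger0_norm ?ltW ?h_gt0//.
by rewrite int_h ltry.
Qed.

Let ihE E : measurable E -> P.-integrable E (EFin \o h).
Proof. by move=> mE; apply: integrableS integrable_density. Qed.

Let icE E c : measurable E -> P.-integrable E (EFin \o (fun _ : T => c)).
Proof. by move=> mE; exact: finite_measure_integrable_cst. Qed.

Let ihZ E c : measurable E -> P.-integrable E (EFin \o (fun x => h x * c)).
Proof.
move=> mE; have /= := integrableZr mE c (ihE mE).
by apply: eq_integrable => // x _ /=; rewrite EFinM.
Qed.

Let Q_ge0 E : 0 <= Q E.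
Proof. by apply: Rintegral_ge0 => x _; exact: ltW. Qed.

Let QE E : measurable E -> ((Q E)%:E = \int[P]_(x in E) (h x)%:E)%E.
Proof.
by move=> mE; rewrite /Rintegral fineK//; exact: (integrable_fin_num _ (ihE mE)).
Qed.

Let Pr_fin E : measurable E -> (Pr P E)%:E = P E.
Proof. by move=> mE; rewrite /Pr fineK// fin_num_measure. Qed.

Let P1 : P setT = 1%E. Proof. exact: probability_setT. Qed.

Let Pr_ge0 E : 0 <= Pr P E.
Proof. by rewrite /Pr fine_ge0. Qed.

Let Q_eq0 E : measurable E -> Pr P E = 0 -> Q E = 0.
Proof.
move=> mE PE; have PE0 : P E = 0%E by rewrite -Pr_fin// PE.
rewrite /Rintegral null_set_integral//.
by apply: measurable_funTS; exact/measurable_EFinP.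
Qed.

(** A vanishing integral would force [h = 0] almost everywhere on [E]. Hence a cell of positive
    probability has positive reference mass, and the infinite branch of [plogq] is never taken. *)
Lemma Rintegral_density_gt0 E : measurable E -> 0 < Pr P E -> 0 < Q E.
Proof.
move=> mE PE; rewrite lt_neqAle Q_ge0 andbT; apply/eqP => /esym QE0.
have : (\int[P]_(x in E) `|(h x)%:E| = 0)%E.
  under eq_integral => x _ do rewrite gee0_abs ?lee_fin ?ltW ?h_gt0//.
  by rewrite -QE// QE0.
have mhE : measurable_fun E (EFin \o h).
  by apply: measurable_funTS; exact/measurable_EFinP.
move/(ae_eq_integral_abs P mE mhE) => [N [mN PN EN]].
have : (P E <= P N)%E.
  apply: le_measure; rewrite ?inE// => x Ex; apply: EN => /= /(_ Ex)[] /eqP.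
  by rewrite gt_eqF.
by rewrite PN -Pr_fin// lee_fin leNgt PE.
Qed.

Section Partition.
Context (I : finType) (E : I -> set T) (pE : measurable_partition E).

Lemma Rintegral_partition (f : T -> R) : P.-integrable setT (EFin \o f) ->
  \int[P]_x f x = \sum_i \int[P]_(x in E i) f x.
Proof.
case: pE => mE dE cE fi; rewrite /Rintegral sum_fine; last first.
  by move=> i _; apply: integrable_fin_num => //; apply: integrableS fi.
congr fine; rewrite -integral_bigsetU_EFin//.
- congr (integral _ _ _); apply/esym/seteqP; split=> // x _.
  have [i Eix] := cE x; rewrite -bigcup_seq.
  by exists i => //=; rewrite mem_index_enum.
- exact: index_enum_uniq.
- by apply/trivIsetP => i j _ _; exact: dE.
- by apply: measurable_funTS; case/integrableP: fi.
Qed.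

Lemma sum_Pr_partition : \sum_i Pr P (E i) = 1.
Proof.
have := Rintegral_partition (icE 1 measurableT).
rewrite Rintegral_cst// mul1r [X in fine X]P1 /= => ->.
by apply: eq_bigr => i _; case: pE => mE _ _; rewrite Rintegral_cst// mul1r.
Qed.

Lemma sum_Q_partition : \sum_i Q (E i) = 1.
Proof.
rewrite -Rintegral_partition; last exact: integrable_density.
by rewrite /Rintegral int_h.
Qed.

Definition partition_relent := \sum_i Pr P (E i) * ln (Pr P (E i) / Q (E i)).

(** The corrections sum to 1 - 1 = 0. They play on cells the part that [h - 1] plays pointwise in
    [relent], which allows a comparison cell by cell. *)
Lemma partition_relentE : partition_relent =
  \sum_i (Pr P (E i) * ln (Pr P (E i) / Q (E i)) + Q (E i) - Pr P (E i)).
Proof.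
by rewrite !big_split/= sumrN sum_Pr_partition sum_Q_partition addrK.
Qed.

Lemma partition_relent_le : (partition_relent%:E <= relent)%E.
Proof.
have [->|relfin] := eqVneq relent +oo%E; first exact: leey.
have iloss : P.-integrable setT (EFin \o (fun x => h x - 1 - ln (h x))).
  apply/integrableP; split; first exact/measurable_EFinP.
  under eq_integral => x _ do rewrite /= ger0_norm ?kl_loss_ge0//.
  by rewrite ltey.
have <- : ((\int[P]_x (h x - 1 - ln (h x)))%:E = relent)%E.
  by rewrite /Rintegral fineK//; exact: (integrable_fin_num _ iloss).
rewrite lee_fin (Rintegral_partition iloss) partition_relentE.
apply: ler_sum => i _; case: pE => /(_ i) mEi _ _.
have ilossE : P.-integrable (E i) (EFin \o (fun x => h x - 1 - ln (h x))).
  exact: integrableS iloss.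
have [PE|PE] := eqVneq (Pr P (E i)) 0.
  rewrite PE mul0r (Q_eq0 mEi PE) addr0 subrr.
  by apply: Rintegral_ge0 => x _; exact: kl_loss_ge0.
have {}PE : 0 < Pr P (E i) by rewrite lt_neqAle eq_sym PE Pr_ge0.
have qE := Rintegral_density_gt0 mEi PE.
set p := Pr P (E i) in PE *; set q := Q (E i) in qE *.
(* The mean of [h] over the cell. Integrating the tangent bound [ln x <= x / c - 1 + ln c] of the
   logarithm at [c] is Jensen's inequality on the cell. *)
pose c := q / p; have c0 : 0 < c by rewrite divr_gt0.
have -> : p * ln (p / q) + q - p = q - (q * c^-1 + ln c * p).
  rewrite /c !ln_div ?posrE// invf_div mulrCA divff ?gt_eqF// mulr1; ring.
have i1 : P.-integrable (E i) (EFin \o (fun x => h x * c^-1 + ln c)).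
  have := integrableD mEi (ihZ c^-1 mEi) (icE (ln c) mEi).
  by apply: eq_integrable => // x _ /=; rewrite EFinD.
rewrite [leLHS](_ : _ = \int[P]_(x in E i) (h x - (h x * c^-1 + ln c))).
  apply: le_Rintegral => //.
    have := integrableB mEi (ihE mEi) i1.
    by apply: eq_integrable => // x _ /=; rewrite EFinB.
  move=> x _; rewrite -addrA lerD2l.
  have : ln (h x / c) <= h x / c - 1 by apply: ln_le_subr1; rewrite divr_gt0.
  by rewrite ln_div ?posrE//; lra.
rewrite RintegralB//; last exact: ihE.
rewrite RintegralD//; last 2 first.
- exact: ihZ.
- exact: icE.
by rewrite RintegralZr ?Rintegral_cst//; exact: ihE.
Qed.

End Partition.

(* The Donsker-Varadhan functional, shifted by [h - 1] whose mean is zero; it is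
   maximised by [phi = - ln h]. *)
Definition dv (phi : T -> R) (x : T) : R := h x + phi x - h x * expR (phi x).

Section DonskerVaradhan.
Variables (C : set (set T)) (S : \bar R).
Hypothesis mC : C `<=` measurable.
Hypothesis hC : forall B, measurable B -> <<s C >> (h @^-1` B).
Hypothesis HS : forall K : seq (set T), all (fun A => `[< C A >]) K ->
  exists (I : finType) (E : I -> set T), [/\ measurable_partition E,
    forall i x x', E i x -> E i x' -> signature K x = signature K x' &
    ((partition_relent E)%:E <= S)%E].

Lemma integrable_dv (phi : T -> R) (M : R) : measurable_fun setT phi ->
  (forall x, `|phi x| <= M) -> P.-integrable setT (EFin \o dv phi).
Proof.
move=> mphi phiM.
have ig : P.-integrable setT (EFin \o (fun x => h x * (1 + expR M) + M)).
  have := integrableD measurableT (ihZ (1 + expR M) measurableT) (icE M measurableT).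
  by apply: eq_integrable => // x _ /=; rewrite EFinD.
apply: le_integrable ig => //.
- apply/measurable_EFinP; apply: measurable_funB; first exact: measurable_funD.
  apply: measurable_funM => //.
  exact: (measurableT_comp (@measurable_expR R)).
- move=> x _ /=; rewrite lee_fin.
  have := phiM x; rewrite ler_norml => /andP[pM Mp].
  have hx := h_gt0 x.
  have e1 : h x * expR (phi x) <= h x * expR M by rewrite ler_pM2l// ler_expR.
  have e0 : 0 <= h x * expR (phi x) by rewrite mulr_ge0 ?expR_ge0// ltW.
  apply: le_trans (ler_norm _); rewrite /dv ler_norml; apply/andP; split; lra.
Qed.

(** On a cell of masses [p] and [q] the function [psi] is constant, and the required inequality is
    [ln u <= u - 1] at [u = q * expR psi / p]. *)
Let step_le (psi : T -> R) (M : R) : measurable_fun setT psi ->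
  (forall x, `|psi x| <= M) -> finite_over C psi ->
  ((\int[P]_x dv psi x)%:E <= S)%E.
Proof.
move=> mpsi psiM [K CK psiK]; have [I [E [pE EK ES]]] := HS CK.
have idv := integrable_dv mpsi psiM.
apply: le_trans ES; rewrite lee_fin (Rintegral_partition pE idv).
rewrite (partition_relentE pE); apply: ler_sum => i _.
case: (pE) => /(_ i) mEi _ _.
have [E0|/set0P[x0 Ex0]] := eqVneq (E i) set0.
  by rewrite E0 Rintegral_set0 /Pr measure0 mul0r Rintegral_set0 addr0 subr0.
have -> : \int[P]_(x in E i) dv psi x =
    \int[P]_(x in E i) (h x * (1 - expR (psi x0)) + psi x0).
  apply: eq_Rintegral => x /set_mem Eix.
  by rewrite /dv (psiK _ _ (EK _ _ _ Eix Ex0)); ring.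
rewrite RintegralD//; last 2 first.
- exact: ihZ.
- exact: icE.
rewrite RintegralZr ?Rintegral_cst//; last exact: ihE.
rewrite -[fine _]/(Pr P (E i)).
have := Pr_ge0 (E i); rewrite le_eqVlt => /predU1P[PE|PE].
  by rewrite -PE (Q_eq0 mEi (esym PE)) !mul0r mulr0 !addr0 subr0.
have := Rintegral_density_gt0 mEi PE; set q := Q (E i) => q0.
set p := Pr P (E i) in PE *; have e0 := expR_gt0 (psi x0).
have lnle := ln_le_subr1 (divr_gt0 (mulr_gt0 q0 e0) PE).
rewrite !ln_div ?lnM ?posrE// ?mulr_gt0// expRK in lnle *.
have e1 : p * (q * expR (psi x0) / p - 1) = q * expR (psi x0) - p.
  by field; rewrite gt_eqF.
by rewrite -(ler_pM2l PE) e1 in lnle; nra.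
Qed.

(** A bounded [phi] is replaced by a [psi] that depends on finitely many sets of [C], for which
    [step_le] applies; the loss is controlled by an L1 distance. *)
Lemma dv_le (phi : T -> R) (M : R) : 0 < M ->
  (forall B, measurable B -> <<s C >> (phi @^-1` B)) ->
  (forall x, `|phi x| <= M) -> ((\int[P]_x dv phi x)%:E <= S)%E.
Proof.
move=> M0 phiC phiM.
have h10 x : 0 <= 1 + h x by rewrite addr_ge0// ltW.
have mh1 : measurable_fun setT (fun x => 1 + h x) by exact: measurable_funD.
(* Both [phi] and [h * expR phi] must be approximated in mean, whence the density [1 + h]. *)
pose mu := density_measure P h10 mh1.
have muoo : (mu setT < +oo)%E.
  rewrite /mu /density_measure.
  under eq_integral do rewrite EFinD.
  rewrite ge0_integralD//; last 2 first.
  - by move=> x _; rewrite lee_fin ltW.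
  - exact/measurable_EFinP.
  by rewrite integral_cst// mul1e int_h [X in (X + _)%E]P1 -EFinD ltry.
have gC (f : R -> R) : measurable_fun setT f ->
    forall B, measurable B -> <<s C >> ((f \o phi) @^-1` B).
  move=> mf B mB; apply: (phiC (f @^-1` B)).
  by rewrite -[X in measurable X]setTI; exact: mf.
have mphi : measurable_fun setT phi.
  move=> _ B mB; rewrite setTI; have := phiC _ mB.
  apply: smallest_sub => //; exact: sigma_algebra_measurable.
pose y x := (phi x + M) / (2 * M).
have yC B : measurable B -> <<s C >> (y @^-1` B).
  apply: (gC (fun r => (r + M) / (2 * M))).
  by apply: measurable_funM => //; exact: measurable_funD.
have y01 x : 0 <= y x <= 1.
  have := phiM x; rewrite ler_norml => /andP[? ?].
  rewrite /y ler_pdivrMr ?ler_pdivlMr ?mulr_gt0//; apply/andP; split; lra.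
apply/lee_addgt0Pr => e e0.
have eM := expR_gt0 M.
(* The factor [2 * M] undoes the rescaling of [[-M, M]] to the unit interval, and [expR M] is the
   Lipschitz constant, relative to the weight [1 + h], of [dv] on [[-M, M]]. *)
pose e' := e / (2 * M * expR M).
have e'0 : 0 < e' by rewrite divr_gt0// !mulr_gt0.
have [z [Cz mz z01 zy]] := finite_over_approx_fun muoo mC yC y01 e'0.
pose psi x := z x * (2 * M) - M.
have Cpsi : finite_over C psi by exact: (finite_over1 (fun r => r * (2 * M) - M)).
have mpsi : measurable_fun setT psi.
  by apply: measurable_funB => //; exact: measurable_funM.
have psiM x : `|psi x| <= M.
  have /andP[? ?] := z01 x; rewrite ler_norml /psi; apply/andP; split; nra.
have [idphi idpsi] := (integrable_dv mphi phiM, integrable_dv mpsi psiM).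
have dvE x : dv phi x - dv psi x <= 2 * M * expR M * (`|y x - z x| * (1 + h x)).
  have := phiM x; rewrite ler_norml => /andP[? pM].
  have := psiM x; rewrite ler_norml => /andP[? p'M].
  have hx := h_gt0 x.
  have expl (a b : R) : b <= M -> expR b - expR a <= expR M * `|b - a|.
    move=> bM; have : expR b - expR a <= expR b * (b - a).
      have := expR_ge1Dx (a - b); rewrite -(ler_pM2l (expR_gt0 b)).
      have -> : expR a = expR b * expR (a - b) by rewrite -expRD; congr expR; ring.
      by lra.
    move=> /le_trans; apply; apply: (@le_trans _ _ (expR b * `|b - a|)).
      by rewrite ler_pM2l ?expR_gt0// ler_norm.
    by rewrite ler_wpM2r// ler_expR.
  have phipsi : phi x - psi x = 2 * M * (y x - z x).
    rewrite /psi /y; field; exact: lt0r_neq0.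
  have nE : `|phi x - psi x| = 2 * M * `|y x - z x|.
    by rewrite phipsi normrM ger0_norm// mulr_ge0// ltW.
  have e1 : 1 <= expR M by rewrite -expR0 ler_expR ltW.
  have h1 := expl (phi x) (psi x) p'M; rewrite distrC in h1.
  have n1 := ler_norm (phi x - psi x).
  have n0 := normr_ge0 (phi x - psi x).
  apply: (@le_trans _ _ (expR M * `|phi x - psi x| * (1 + h x))); last first.
    by rewrite nE le_eqVlt; apply/orP; left; apply/eqP; ring.
  rewrite /dv; nra.
have : (\int[P]_x (dv phi x - dv psi x)%:E <= e%:E)%E.
  have mg : measurable_fun setT (fun x => `|y x - z x|%:E : \bar R).
    apply/measurable_EFinP; apply: measurableT_comp => //.
    apply: measurable_funB => //; apply: measurable_funM => //.
    exact: measurable_funD.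
  have mgh : measurable_fun setT (fun x => `|y x - z x| * (1 + h x)).
    by apply: measurable_funM => //; exact/measurable_EFinP.
  rewrite /mu ge0_integral_density// in zy.
  have ig : P.-integrable setT (EFin \o
      (fun x => 2 * M * expR M * (`|y x - z x| * (1 + h x)))).
    rewrite (_ : EFin \o _ = fun x =>
        ((2 * M * expR M)%:E * (`|y x - z x| * (1 + h x))%:E)%E)//.
    apply: integrableZl => //; apply/integrableP; split.
      exact/measurable_EFinP.
    under eq_integral => x _ do rewrite gee0_abs ?lee_fin ?mulr_ge0//.
    by apply: le_lt_trans zy _; rewrite ltry.
  apply: (@le_trans _ _ (\int[P]_x
      (2 * M * expR M * (`|y x - z x| * (1 + h x)))%:E)%E).
    apply: le_integral => //.
      have := integrableB measurableT idphi idpsi.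
      by apply: eq_integrable => // x _ /=; rewrite EFinB.
    by move=> x _; rewrite lee_fin.
  under eq_integral do rewrite EFinM.
  rewrite ge0_integralZl//; last 3 first.
  - exact/measurable_EFinP.
  - by move=> x _; rewrite lee_fin mulr_ge0.
  - by rewrite lee_fin !mulr_ge0// ltW.
  apply: (@le_trans _ _ ((2 * M * expR M)%:E * e'%:E)%E).
    by rewrite lee_pmul2l// lte_fin !mulr_gt0.
  rewrite -EFinM lee_fin /e' mulrCA divff ?mulr1//.
  by rewrite gt_eqF// !mulr_gt0.
rewrite integralB_EFin//.
have -> : (\int[P]_x (dv phi x)%:E = (\int[P]_x dv phi x)%:E)%E.
  by rewrite /Rintegral fineK//; exact: (integrable_fin_num _ idphi).
have -> : (\int[P]_x (dv psi x)%:E = (\int[P]_x dv psi x)%:E)%E.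
  by rewrite /Rintegral fineK//; exact: (integrable_fin_num _ idpsi).
rewrite leeBlDr// => /le_trans; apply; rewrite addeC leeD2r//.
exact: step_le mpsi psiM Cpsi.
Qed.

(** The maximiser [- ln h] of the functional is unbounded, so it is truncated and the truncation
    level is let go to infinity by monotone convergence. The bound [S] has to hold only for some
    partition refining each finite subfamily of [C], which a supremum over product partitions
    provides. *)
Lemma relent_le_sup : (relent <= S)%E.
Proof.
pose F n := [set x | `|ln (h x)| <= n.+1%:R].
have mF n : measurable (F n).
  rewrite (_ : F n = (fun x => `|ln (h x)|) @^-1` `]-oo, n.+1%:R]); last first.
    by apply/seteqP; split => x; rewrite /F/= in_itv.
  rewrite -[X in measurable X]setTI.
  have mabs : measurable_fun setT (fun x => `|ln (h x)|).
    by apply: measurableT_comp => //; exact: measurable_ln_comp.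
  exact: mabs.
have UF : \bigcup_n F n = setT.
  apply/seteqP; split=> // x _; exists (Num.truncn `|ln (h x)|) => //=.
  exact/ltW/truncnS_gt.
rewrite /relent -UF.
apply: cvge_le (ge0_nondecreasing_set_cvg_integral _ mF _ _).
- apply: nearW => n.
  pose phi x := Num.max (- n.+1%:R) (Num.min n.+1%:R (- ln (h x))).
  have phin x : `|phi x| <= n.+1%:R.
    rewrite ler_norml /phi le_max lexx/= ge_max ge_min lexx/= andbT.
    by rewrite (@le_trans _ _ 0)// oppr_le0.
  have phiC B : measurable B -> <<s C >> (phi @^-1` B).
    pose f (r : R) : R := Num.max (- n.+1%:R) (Num.min n.+1%:R (- ln r)).
    move=> mB; apply: (hC (B := f @^-1` B)).
    rewrite -[X in measurable X]setTI; apply: (_ : measurable_fun setT f) => //.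
    apply: measurable_maxr => //; apply: measurable_minr => //.
    by apply: measurableT_comp => //; exact: measurable_ln.
  (* As a function of the value [phi x], [dv] is concave, zero at 0 and maximal at [- ln (h x)]; the
     truncation lies between these two points. Nonnegativity then lets the integral over [F n] be
     bounded by the integral over the whole space. *)
  have dv0 x : 0 <= dv phi x.
    have hx := h_gt0 x.
    have lnK' : expR (- ln (h x)) = (h x)^-1 by rewrite expRN lnK// posrE.
    have e1 : expR (phi x) - 1 <= phi x * expR (phi x).
      have := expR_ge1Dx (- phi x); rewrite -(ler_pM2l (expR_gt0 (phi x))).
      by rewrite -expRD subrr expR0; lra.
    have : h x * (expR (phi x) - 1) <= h x * (phi x * expR (phi x)).
      by rewrite ler_pM2l.
    suff : 0 <= phi x * (1 - h x * expR (phi x)) by rewrite /dv; lra.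
    have n0 : 0 <= n.+1%:R :> R by [].
    have [ln0|ln0] := leP 0 (- ln (h x)).
      have p0 : 0 <= phi x by rewrite /phi le_max le_min n0 ln0 orbT.
      have : phi x <= - ln (h x).
        rewrite /phi ge_max ge_min lexx orbT andbT.
        by rewrite (le_trans _ ln0)// oppr_le0.
      rewrite -ler_expR lnK' -(ler_pM2l hx) divff ?gt_eqF// => ?.
      by apply: mulr_ge0 => //; lra.
    have p0 : phi x <= 0.
      by rewrite /phi ge_max oppr_le0 n0/= ge_min (ltW ln0) orbT.
    have : - ln (h x) <= phi x.
      by rewrite /phi le_max le_min lexx andbT (le_trans (ltW ln0) n0) orbT.
    rewrite -ler_expR lnK' -(ler_pM2l hx) divff ?gt_eqF// => ?.
    by apply: mulr_le0 => //; lra.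
  have mphi : measurable_fun setT phi.
    move=> _ B mB; rewrite setTI; have := phiC _ mB.
    apply: smallest_sub => //; exact: sigma_algebra_measurable.
  have idv := integrable_dv mphi phin.
  apply: (le_trans _ (dv_le _ phiC phin)) => //.
  rewrite /Rintegral fineK; last exact: (integrable_fin_num _ idv).
  apply: (@le_trans _ _ (\int[P]_(x in F n) (dv phi x)%:E)%E).
    rewrite le_eqVlt; apply/orP; left; apply/eqP; apply: eq_integral => x.
    rewrite inE /F/= ler_norml => /andP[? ?]; congr EFin; rewrite /dv.
    have -> : phi x = - ln (h x).
      by rewrite /phi min_r ?max_r//; lra.
    by rewrite expRN lnK ?posrE// divff ?gt_eqF//; lra.
  apply: ge0_subset_integral => //.
  - by case/integrableP: idv.
  - by move=> x _; rewrite lee_fin.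
- move=> m n mn; apply/subsetPset => x; rewrite /F/= => /le_trans; apply.
  by rewrite ler_nat.
- by move=> n; apply: measurable_funTS; exact/measurable_EFinP.
- by move=> n x _; rewrite lee_fin kl_loss_ge0.
Qed.

End DonskerVaradhan.

End RelativeEntropy.

(** * Mutual information as relative entropy over product partitions *)

Section SignaturePartition.
Context d (T : measurableType d) (F : set (set T)).
Hypothesis sF : sigma_algebra setT F.

Let FE A : F A = measurable (A : set (g_sigma_algebraType F)).
Proof. by rewrite /measurable/= sigma_algebra_id. Qed.

Lemma signature_in (K : seq (set T)) (s : seq bool) :
  all (fun A => `[< F A >]) K -> F [set x | signature K x = s].
Proof.
elim: K s => [|A K IH] [|b s] /=.
- by rewrite (_ : [set _ | _] = setT) ?FE//; apply/seteqP.
- by rewrite (_ : [set _ | _] = set0) ?FE//; apply/seteqP; split.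
- by rewrite (_ : [set _ | _] = set0) ?FE//; apply/seteqP; split.
- move=> /andP[/asboolP FA FK].
  rewrite (_ : [set _ | _] = (if b then A else ~` A) `&` [set x | signature K x = s]).
    rewrite FE; apply: measurableI; last by rewrite -FE; exact: IH.
    by case: b; [|apply: measurableC]; rewrite -FE.
  apply/seteqP; split => x /=.
    case=> <- <-; split=> //.
    by have [Ax|Ax] := pselect (A x); [rewrite asboolT|rewrite asboolF].
  case=> bx <-; congr cons.
  by case: b bx => bx; [rewrite asboolT|rewrite asboolF].
Qed.

(** The cells are indexed by all bit tuples of length [size K]; those that no point realises are
    empty, which [is_partition] allows. *)
Lemma signature_partition (K : seq (set T)) : all (fun A => `[< F A >]) K ->
  exists n (a : 'I_n -> set T), is_partition F a /\
    forall i x x', a i x -> a i x' -> signature K x = signature K x'.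
Proof.
move=> FK; exists #|{: (size K).-tuple bool}|.
exists (fun i => [set x | signature K x = (enum_val i : (size K).-tuple bool)]); split; last first.
  by move=> i x x' /= -> ->.
split=> [i|i j ij|x]; first exact: signature_in.
- rewrite -subset0 => x /= [-> /val_inj /enum_val_inj] ijE.
  by rewrite ijE eqxx in ij.
- have sK : size (signature K x) == size K by rewrite size_map.
  by exists (enum_rank (Tuple sK)) => /=; rewrite enum_rankK.
Qed.

End SignaturePartition.

(** Product partitions are built from one partition per sigma-algebra. A mixed list is therefore
    sorted by the sigma-algebra to which its sets belong, and agreement on the three sublists is
    recombined. With two sigma-algebras, [q] and [r] are taken equal. *)
Lemma signature_filter {T : Type} (p q r : pred (set T)) (K : seq (set T)) x x' :
  all (fun A => [|| p A, q A | r A]) K ->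
  signature [seq A <- K | p A] x = signature [seq A <- K | p A] x' ->
  signature [seq A <- K | q A] x = signature [seq A <- K | q A] x' ->
  signature [seq A <- K | r A] x = signature [seq A <- K | r A] x' ->
  signature K x = signature K x'.
Proof.
elim: K => //= A K IH /andP[Apqr AK].
have {}IH := IH AK.
case: ifP Apqr => [_ _|_] /=.
  case=> -> pK; case: ifP => [_ [_ qK]|_ qK]; case: ifP => [_ [_ rK]|_ rK];
  by rewrite (IH pK qK rK).
case: ifP => [_ _|_] /=.
  move=> pK [-> qK]; case: ifP => [_ [_ rK]|_ rK]; by rewrite (IH pK qK rK).
case: ifP => //= _ _ pK qK [-> rK]; by rewrite (IH pK qK rK).
Qed.

Section InformationDensity.
Context d (Omega : measurableType d) (R : realType) (P : probability Omega R).
Variable h : Omega -> R.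
Hypothesis h_gt0 : forall x, 0 < h x.
Hypothesis mh : measurable_fun setT h.
Hypothesis int_h : (\int[P]_x (h x)%:E = 1)%E.

Let ln2_gt0 : 0 < ln 2 :> R. Proof. by rewrite ln_gt0// ltr1n. Qed.

Lemma plogq_density E : measurable E ->
  plogq (Pr P E) (\int[P]_(x in E) h x) =
  ((ln 2)^-1 * (Pr P E * ln (Pr P E / \int[P]_(x in E) h x)))%:E.
Proof.
move=> mE; rewrite /plogq; have [->|PE] := eqVneq (Pr P E) 0.
  by rewrite mul0r mulr0.
rewrite gt_eqF; last first.
  apply: Rintegral_density_gt0 => //.
  by rewrite lt_neqAle eq_sym PE /Pr fine_ge0.
by congr EFin; rewrite /log2; ring.
Qed.

(** Coarsening to a partition can only lose relative entropy, which bounds the supremum above. For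
    the lower bound it suffices that the partitions counted in [V] refine every finite subfamily of
    [C]. The factor [(ln 2)^-1] converts nats to bits. *)
Lemma sup_relent (C : set (set Omega)) (V : set (\bar R)) :
  C `<=` measurable -> (forall B, measurable B -> <<s C >> (h @^-1` B)) ->
  (forall v, V v -> exists (I : finType) (E : I -> set Omega),
     measurable_partition E /\ v = ((ln 2)^-1 * partition_relent P h E)%:E) ->
  (forall K : seq (set Omega), all (fun A => `[< C A >]) K ->
     exists (I : finType) (E : I -> set Omega), [/\ measurable_partition E,
       forall i x x', E i x -> E i x' -> signature K x = signature K x' &
       V ((ln 2)^-1 * partition_relent P h E)%:E]) ->
  ereal_sup V = ((ln 2)^-1%:E * relent P h)%E.
Proof.
move=> mC hC VE VK; apply/eqP; rewrite eq_le; apply/andP; split.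
  apply: ge_ereal_sup => _ /VE[I [E [pE ->]]]; rewrite EFinM.
  by apply: lee_wpmul2l; [rewrite lee_fin invr_ge0 ltW|exact: partition_relent_le].
have le1 : (relent P h <= (ln 2)%:E * ereal_sup V)%E.
  apply: (relent_le_sup h_gt0 mh int_h mC hC) => K /VK[I [E [pE EK VE']]].
  exists I, E; split=> //.
  have -> : partition_relent P h E = ln 2 * ((ln 2)^-1 * partition_relent P h E).
    by rewrite mulrA divff ?mul1r// gt_eqF.
  rewrite EFinM lee_pmul2l//; exact: ereal_sup_ubound.
have : ((ln 2)^-1%:E * relent P h <= (ln 2)^-1%:E * ((ln 2)%:E * ereal_sup V))%E.
  by apply: lee_wpmul2l => //; rewrite lee_fin invr_ge0 ltW.
by rewrite muleA -EFinM mulVf ?mul1e// gt_eqF.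
Qed.

Section Conditional.
Variables F G H : set (set Omega).
Hypotheses (sF : sigma_algebra setT F) (sG : sigma_algebra setT G)
  (sH : sigma_algebra setT H).
Hypotheses (mF : F `<=` measurable) (mG : G `<=` measurable)
  (mH : H `<=` measurable).
Hypothesis hFGH :
  forall B, measurable B -> <<s F `|` G `|` H >> (h @^-1` B).

Let mFGH : F `|` G `|` H `<=` measurable.
Proof. by rewrite !subUset. Qed.

Let FGH_partition (K : seq (set Omega)) :
  all (fun A => `[< (F `|` G `|` H) A >]) K ->
  exists n m k (a : 'I_n -> set Omega) (b : 'I_m -> set Omega)
    (c : 'I_k -> set Omega), [/\ is_partition F a, is_partition G b,
      is_partition H c & forall i j l x x', (a i `&` b j `&` c l) x ->
        (a i `&` b j `&` c l) x' -> signature K x = signature K x'].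
Proof.
move=> CK.
have [n [a [pa aK]]] := signature_partition sF (filter_all (fun A => `[< F A >]) K).
have [m [b [pb bK]]] := signature_partition sG (filter_all (fun A => `[< G A >]) K).
have [k [c [pc cK]]] := signature_partition sH (filter_all (fun A => `[< H A >]) K).
exists n, m, k, a, b, c; split=> // i j l x x' [[ax bx] cx] [[ax' bx'] cx'].
apply: (signature_filter _ (aK _ _ _ ax ax') (bK _ _ _ bx bx') (cK _ _ _ cx cx')).
apply: sub_all CK => A /asboolP[[FA|GA]|HA]; apply/or3P.
- by constructor 1; apply/asboolP.
- by constructor 2; apply/asboolP.
- by constructor 3; apply/asboolP.
Qed.

Let cell n m k (a : 'I_n -> set Omega) (b : 'I_m -> set Omega)
  (c : 'I_k -> set Omega) (q : 'I_n * 'I_m * 'I_k) := a q.1.1 `&` b q.1.2 `&` c q.2.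

Let cell_partition n m k (a : 'I_n -> set Omega) (b : 'I_m -> set Omega)
    (c : 'I_k -> set Omega) : is_partition F a -> is_partition G b ->
  is_partition H c -> measurable_partition (cell a b c).
Proof.
move=> [Fa da ca] [Gb db cb] [Hc dc cc]; split.
- move=> q; apply: measurableI; last exact: mH.
  by apply: measurableI; [exact: mF|exact: mG].
- move=> [[i j] l] [[i' j'] l'] qq'; rewrite -subset0 => x [[[ai bj] cl] [[ai' bj'] cl']].
  have [ii'|/da E] := eqVneq i i'; last by rewrite -E.
  have [jj'|/db E] := eqVneq j j'; last by rewrite -E.
  have [ll'|/dc E] := eqVneq l l'; last by rewrite -E.
  by move: qq'; rewrite ii' jj' ll' eqxx.
- move=> x; have [i ai] := ca x; have [j bj] := cb x; have [l cl] := cc x.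
  by exists (i, j, l).
Qed.

(** Under the hypothesis, the reference masses in [CMI] are the masses that [h P] gives to the
    cells, so all admissible sums are partition entropies of the single density [h]. *)
Lemma CMI_relent :
  (forall a b c, F a -> G b -> H c -> \int[P]_(x in a `&` b `&` c) h x =
    fine (\int[P]_(x in c) (condprob P H a x * condprob P H b x)%:E)%E) ->
  CMI P F G H = ((ln 2)^-1%:E * relent P h)%E.
Proof.
move=> hQ.
have vE n m k (a : 'I_n -> set Omega) (b : 'I_m -> set Omega)
    (c : 'I_k -> set Omega) : is_partition F a -> is_partition G b ->
    is_partition H c ->
  (\sum_(i < n) \sum_(j < m) \sum_(l < k)
      plogq (Pr P (a i `&` b j `&` c l))
        (fine (\int[P]_(x in c l)
           (condprob P H (a i) x * condprob P H (b j) x)%:E)))%E =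
  ((ln 2)^-1 * partition_relent P h (cell a b c))%:E.
  move=> pa pb pc; have [mE _ _] := cell_partition pa pb pc.
  case: pa => Fa _ _; case: pb => Gb _ _; case: pc => Hc _ _.
  rewrite /partition_relent mulr_sumr -sumEFin.
  under [RHS]eq_bigr => q _ do rewrite -plogq_density//.
  rewrite -(pair_bigA _ (fun p l => plogq (Pr P (a p.1 `&` b p.2 `&` c l))
     (\int[P]_(x in a p.1 `&` b p.2 `&` c l) h x)))/=.
  rewrite -(pair_bigA _ (fun i j => (\sum_(l < k) plogq (Pr P (a i `&` b j `&` c l))
     (\int[P]_(x in a i `&` b j `&` c l) h x))%E))/=.
  by do 3 apply: eq_bigr => ? _; rewrite hQ.
apply: (sup_relent mFGH hFGH).
- move=> v [n [m [k [a [b [c [pa pb pc ->]]]]]]].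
  by exists _, (cell a b c); split; [exact: cell_partition|exact: vE].
- move=> K /FGH_partition[n [m [k [a [b [c [pa pb pc abcK]]]]]]].
  exists _, (cell a b c); split; first exact: cell_partition.
    by move=> [[i j] l] x x'; exact: abcK.
  by exists n, m, k, a, b, c; split=> //; rewrite vE.
Qed.

End Conditional.

Section Unconditional.
Variables F G : set (set Omega).
Hypotheses (sF : sigma_algebra setT F) (sG : sigma_algebra setT G).
Hypotheses (mF : F `<=` measurable) (mG : G `<=` measurable).
Hypothesis hFG : forall B, measurable B -> <<s F `|` G >> (h @^-1` B).

Let mFG : F `|` G `<=` measurable.
Proof. by rewrite !subUset. Qed.

Let cell n m (a : 'I_n -> set Omega) (b : 'I_m -> set Omega)
  (q : 'I_n * 'I_m) := a q.1 `&` b q.2.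

Let cell_partition n m (a : 'I_n -> set Omega) (b : 'I_m -> set Omega) :
  is_partition F a -> is_partition G b -> measurable_partition (cell a b).
Proof.
move=> [Fa da ca] [Gb db cb]; split.
- by move=> q; apply: measurableI; [exact: mF|exact: mG].
- move=> [i j] [i' j'] qq'; rewrite -subset0 => x [[ai bj] [ai' bj']].
  have [ii'|/da E] := eqVneq i i'; last by rewrite -E.
  have [jj'|/db E] := eqVneq j j'; last by rewrite -E.
  by move: qq'; rewrite ii' jj' eqxx.
- move=> x; have [i ai] := ca x; have [j bj] := cb x.
  by exists (i, j).
Qed.

Lemma MI_relent :
  (forall a b, F a -> G b -> \int[P]_(x in a `&` b) h x = Pr P a * Pr P b) ->
  MI P F G = ((ln 2)^-1%:E * relent P h)%E.
Proof.
move=> hQ.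
have vE n m (a : 'I_n -> set Omega) (b : 'I_m -> set Omega) :
    is_partition F a -> is_partition G b ->
  (\sum_(i < n) \sum_(j < m)
      plogq (Pr P (a i `&` b j)) (Pr P (a i) * Pr P (b j)))%E =
  ((ln 2)^-1 * partition_relent P h (cell a b))%:E.
  move=> pa pb; have [mE _ _] := cell_partition pa pb.
  case: pa => Fa _ _; case: pb => Gb _ _.
  rewrite /partition_relent mulr_sumr -sumEFin.
  under [RHS]eq_bigr => q _ do rewrite -plogq_density//.
  rewrite -(pair_bigA _ (fun i j => plogq (Pr P (a i `&` b j))
     (\int[P]_(x in a i `&` b j) h x)))/=.
  by do 2 apply: eq_bigr => ? _; rewrite hQ.
apply: (sup_relent mFG hFG).
- move=> v [n [m [a [b [pa pb ->]]]]].
  by exists _, (cell a b); split; [exact: cell_partition|exact: vE].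
- move=> K CK.
  have [n [a [pa aK]]] := signature_partition sF (filter_all (fun A => `[< F A >]) K).
  have [m [b [pb bK]]] := signature_partition sG (filter_all (fun A => `[< G A >]) K).
  exists _, (cell a b); split; first exact: cell_partition.
    move=> [i j] x x' [ax bx] [ax' bx'].
    have eG := bK _ _ _ bx bx'.
    apply: (signature_filter _ (aK _ _ _ ax ax') eG eG).
    apply: sub_all CK => A /asboolP[FA|GA]; apply/or3P.
      by constructor 1; apply/asboolP.
    by constructor 2; apply/asboolP.
  by exists n, m, a, b; split=> //; rewrite vE.
Qed.

End Unconditional.

End InformationDensity.

(** * Gaussian densities on the line and on the plane *)

Lemma ge0_integral_translate (R : realType) (c : R) (f : R -> \bar R) :
  measurable_fun setT f -> (forall x, 0 <= f x)%E ->
  (\int[lebesgue_measure]_x f (c + x)%R = \int[lebesgue_measure]_x f x)%E.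
Proof.
move=> mf f0.
have mc : measurable_fun setT (fun x : measurableTypeR R => c + x : measurableTypeR R).
  exact: measurable_funD.
have pE (A : set R) : measurable A ->
    pushforward lebesgue_measure (fun x : measurableTypeR R => c + x : measurableTypeR R) A =
    lebesgue_measure A.
  move=> mA; apply/esym/lebesgue_measure_unique => //= _ [[a b]] _ <-.
  rewrite /pushforward /=.
  rewrite (_ : _ @^-1` _ = `]a - c, b - c]%classic); last first.
    by apply/seteqP; split=> x /=; rewrite !in_itv/= ltrBlDl lerBrDl.
  rewrite !lebesgue_measure_itv/= !lte_fin ltrD2r.
  by case: ifP => // _; rewrite -!EFinB; congr EFin; ring.
pose tr (x : measurableTypeR R) : measurableTypeR R := c + x.
transitivity (\int[pushforward lebesgue_measure tr]_x f x)%E.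
  by rewrite (ge0_integral_pushforward mc).
by apply: eq_measure_integral => A mA _; exact: pE.
Qed.

Section NormalMoments.
Context {R : realType}.
Local Notation mu := (@lebesgue_measure R).

Lemma normal_pdf_gt0 (m s x : R) : s != 0 -> 0 < normal_pdf m s x.
Proof.
by move=> s0; rewrite normal_pdfE// mulr_gt0 ?expR_gt0// normal_peak_gt0.
Qed.

Lemma normal_pdf_shift (c s x : R) :
  s != 0 -> normal_pdf c s (c + x) = normal_pdf 0 s x.
Proof.
move=> s0; rewrite (normal_pdfE c s0) (normal_pdfE 0 s0) /normal_fun.
by rewrite subr0 [c + x]addrC addrK.
Qed.

Lemma measurable_normal_pdf_comp d (T : measurableType d) (m y : T -> R) (s : R) :
  s != 0 -> measurable_fun setT m -> measurable_fun setT y ->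
  measurable_fun setT (fun x => normal_pdf (m x) s (y x)).
Proof.
move=> s0 mm my; rewrite (_ : (fun x => _) = (fun x => normal_peak s *
    expR (- ((y x - m x) ^+ 2) / (s ^+ 2 *+ 2)))); last first.
  by apply/funext => x; rewrite normal_pdfE.
apply: measurable_funM => //; apply: (measurableT_comp (@measurable_expR R)).
apply: measurable_funM => //; apply: (measurableT_comp (@oppr_measurable R setT)).
by apply: measurable_funX; exact: measurable_funB.
Qed.

(* Comparing the densities of standard deviations [s] and [s / r]: since
   [exp ((1 - r^2) v) >= 1 + (1 - r^2) v], integration bounds the moment [I] of
   [v = ((x - m) / s)^2 / 2] by [(1 - r^2) I <= 1 / r - 1] for all [r > 0]. *)
Let normal_pdf_scale (m s r x : R) : 0 < s -> 0 < r ->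
  normal_pdf m s x * (1 + (1 - r ^+ 2) * (((x - m) / s) ^+ 2 / 2)) <=
  r^-1 * normal_pdf m (s / r) x.
Proof.
move=> s0 r0; have sr0 : 0 < s / r by rewrite divr_gt0.
rewrite !normal_pdfE ?gt_eqF// /normal_peak /normal_fun.
have -> : (s / r) ^+ 2 * pi *+ 2 = (r^-1) ^+ 2 * (s ^+ 2 * pi *+ 2).
  by ring.
rewrite sqrtrM ?sqr_ge0// sqrtr_sqr (ger0_norm (ltW _)) ?invr_gt0//.
rewrite invfM invrK -(mulrA r) mulKf ?gt_eqF// -mulrA.
apply: ler_wpM2l; first by rewrite invr_ge0 sqrtr_ge0.
set v := ((x - m) / s) ^+ 2 / 2.
have -> : - (x - m) ^+ 2 / (s ^+ 2 *+ 2) = - v.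
  by rewrite /v; field; rewrite gt_eqF.
have -> : - (x - m) ^+ 2 / ((s / r) ^+ 2 *+ 2) = - v + (1 - r ^+ 2) * v.
  by rewrite /v; field; rewrite !gt_eqF.
by rewrite expRD ler_wpM2l ?expR_ge0// expR_ge1Dx.
Qed.

Lemma measurable_normal_moment (m s : R) : measurable_fun setT
  (fun x : R => ((x - m) / s) ^+ 2 * normal_pdf m s x).
Proof.
apply: measurable_funM; last exact: measurable_normal_pdf.
by apply: measurable_funX; apply: measurable_funM => //; exact: measurable_funB.
Qed.

Lemma integral_normal_moment (m s : R) : 0 < s ->
  (\int[mu]_x (((x - m) / s) ^+ 2 * normal_pdf m s x)%:E = 1)%E.
Proof.
move=> s0.
pose w x := ((x - m) / s) ^+ 2 * normal_pdf m s x.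
have w0 x : 0 <= w x by rewrite mulr_ge0 ?sqr_ge0// normal_pdf_ge0.
have mw : measurable_fun setT w by exact: measurable_normal_moment.
have sN0 : s != 0 by rewrite gt_eqF.
have ip := integrable_normal_pdf.
(* A first pass in the extended reals, with [r < 1] so that all terms are nonnegative. It only
   serves to show that the moment is finite; [key] then allows every positive [r]. *)
have wle (r : R) : 0 < r < 1 ->
    (\int[mu]_x (w x)%:E <= (2 / (r * (1 + r)))%:E)%E.
  move=> /andP[r0 r1]; have r20 : 0 < 1 - r ^+ 2 by nra.
  pose c := (1 - r ^+ 2) / 2; have c0 : 0 < c by rewrite divr_gt0.
  have : (\int[mu]_x (normal_pdf m s x)%:E + \int[mu]_x (c%:E * (w x)%:E) <=
      \int[mu]_x (r^-1%:E * (normal_pdf m (s / r) x)%:E))%E.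
    rewrite -ge0_integralD//; last 4 first.
    - by move=> x _; rewrite lee_fin normal_pdf_ge0.
    - by apply/measurable_EFinP; exact: measurable_normal_pdf.
    - by move=> x _; rewrite -EFinM lee_fin mulr_ge0// ltW.
    - by apply: measurable_funeM; apply/measurable_EFinP.
    apply: ge0_le_integral => //.
    - move=> x _; rewrite -EFinM -EFinD lee_fin addr_ge0 ?normal_pdf_ge0//.
      by rewrite mulr_ge0// ltW.
    - apply: emeasurable_funD; first by apply/measurable_EFinP; exact: measurable_normal_pdf.
      by apply: measurable_funeM; apply/measurable_EFinP.
    - apply: measurable_funeM; apply/measurable_EFinP; exact: measurable_normal_pdf.
    - move=> x _; rewrite -!EFinM -EFinD lee_fin.
      apply: le_trans (normal_pdf_scale m x s0 r0).
      by rewrite le_eqVlt; apply/orP; left; apply/eqP; rewrite /w /c; field.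
  rewrite integral_normal_pdf ge0_integralZl//; last 3 first.
  - exact/measurable_EFinP.
  - by move=> x _; rewrite lee_fin.
  - by rewrite lee_fin ltW.
  rewrite ge0_integralZl//; last 3 first.
  - by apply/measurable_EFinP; exact: measurable_normal_pdf.
  - by move=> x _; rewrite lee_fin normal_pdf_ge0.
  - by rewrite lee_fin invr_ge0 ltW.
  rewrite integral_normal_pdf mule1 -leeBrDl// -EFinB => H.
  have := lee_pmul2l (x := (c^-1)%:E) isT; rewrite lte_fin invr_gt0 => /(_ c0) E.
  rewrite -E in H; apply: le_trans (le_trans _ H) _.
    by rewrite muleA -EFinM mulVf ?gt_eqF// mul1e.
  rewrite -EFinM lee_fin le_eqVlt; apply/orP; left; apply/eqP.
  rewrite /c; field; apply/and3P; split; rewrite gt_eqF//; lra.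
have wfin : (\int[mu]_x (w x)%:E < +oo)%E.
  apply: le_lt_trans (wle 2^-1 _) _; last exact: ltry.
  by apply/andP; split; lra.
have iw : mu.-integrable setT (EFin \o w).
  apply/integrableP; split; first exact/measurable_EFinP.
  by under eq_integral => x _ do rewrite /= ger0_norm//.
pose I := \int[mu]_x w x.
have IE : (\int[mu]_x (w x)%:E = I%:E)%E.
  by rewrite /I /Rintegral fineK//; exact: (integrable_fin_num _ iw).
have I0 : 0 <= I by apply: Rintegral_ge0.
have key (r : R) : 0 < r -> 1 + (1 - r ^+ 2) / 2 * I <= r^-1.
  move=> r0; pose c := (1 - r ^+ 2) / 2.
  have icw : mu.-integrable setT (EFin \o (fun x => c * w x)).
    have := integrableZl measurableT c iw.
    by apply: eq_integrable => // x _ /=; rewrite EFinM.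
  have ic : mu.-integrable setT (EFin \o (fun x => normal_pdf m s x + c * w x)).
    have := integrableD measurableT (integrable_normal_pdf m s) icw.
    by apply: eq_integrable => // x _ /=; rewrite EFinD.
  have ir : mu.-integrable setT (EFin \o (fun x => r^-1 * normal_pdf m (s / r) x)).
    have := integrableZl measurableT r^-1 (integrable_normal_pdf m (s / r)).
    by apply: eq_integrable => // x _ /=; rewrite EFinM.
  have : \int[mu]_x (normal_pdf m s x + c * w x) <=
      \int[mu]_x (r^-1 * normal_pdf m (s / r) x).
    apply: le_Rintegral => // x _.
    apply: le_trans (normal_pdf_scale m x s0 r0).
    by rewrite le_eqVlt; apply/orP; left; apply/eqP; rewrite /w /c; field.
  rewrite RintegralD//; last exact: integrable_normal_pdf.
  rewrite !RintegralZl//; last exact: integrable_normal_pdf.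
  by rewrite /Rintegral !integral_normal_pdf/= mulr1.
rewrite -[LHS]/(\int[mu]_x (w x)%:E)%E IE; congr EFin.
(* Dividing [key] by [1 - r] gives [r * (1 + r) * I <= 2] for [r < 1] and the reverse inequality for
   [r > 1], whence [I = 1] as [r] tends to 1. Instead of a limit, each case uses a value of [r]
   close enough to 1, depending on [I], to contradict the corresponding bound. *)
apply/eqP; rewrite eq_le; apply/andP; split; rewrite leNgt; apply/negP => I1.
  pose r := (1 + I^-1) / 2.
  have Iv : I * I^-1 = 1 by rewrite divff// gt_eqF//; lra.
  have Iv0 : 0 < I^-1 by rewrite invr_gt0; lra.
  have r0 : 0 < r by rewrite /r; lra.
  have r1 : r < 1 by rewrite /r; nra.
  have := key r r0; rewrite -(ler_pM2l r0) divff ?gt_eqF// => H.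
  have : r * (1 + r) * I <= 2 by nra.
  rewrite /r; nra.
pose r := 1 + (1 - I) / 3.
have r1 : 1 < r by rewrite /r; lra.
have r0 : 0 < r by lra.
have := key r r0; rewrite -(ler_pM2l r0) divff ?gt_eqF// => H.
have : 2 <= r * (1 + r) * I by nra.
rewrite /r; nra.
Qed.

End NormalMoments.

(** The formula [x * expR (- ln (x ^+ 2))] also takes the value 0 at 0, in agreement with the
    convention for the inverse of 0. *)
Lemma measurable_inv (R : realType) : measurable_fun setT (@GRing.inv R).
Proof.
rewrite (_ : GRing.inv = fun x : R => x * expR (- ln (x ^+ 2))).
  apply: measurable_funM => //; apply: (measurableT_comp (@measurable_expR R)).
  apply: (measurableT_comp (@oppr_measurable R setT)).
  apply: (measurableT_comp (@measurable_ln R)); exact: exprn_measurable.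
apply/funext => x; have [->|x0] := eqVneq x 0; first by rewrite invr0 mul0r.
rewrite expRN lnK ?posrE ?exprn_even_gt0//; field; exact: x0.
Qed.

Ltac measurable_poly := repeat first [assumption | exact: measurable_cst |
  apply: measurable_funX | apply: measurable_funB | apply: measurable_funD |
  apply: measurable_funM].

(* The density of the Gaussian law on the plane with precision matrix
   [[j11, j12], [j12, j22]] and mean the solution of [J m = (e1, e2)]. *)
Section PlanarGaussian.
Context {R : realType}.

Definition gdet (j11 j12 j22 : R) := j11 * j22 - j12 ^+ 2.

(** The form [(x - m)^T J (x - m)] expanded with [J m = e]; the fraction is its constant term
    [e^T J^-1 e]. In the parameters [J] and [e], conditioning on an observation is addition. *)
Definition gquad (j11 j12 j22 e1 e2 a b : R) :=
  j11 * a ^+ 2 + 2 * j12 * a * b + j22 * b ^+ 2 - 2 * e1 * a - 2 * e2 * b +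
  (j22 * e1 ^+ 2 - 2 * j12 * e1 * e2 + j11 * e2 ^+ 2) / gdet j11 j12 j22.

Definition gdens (j11 j12 j22 e1 e2 a b : R) :=
  Num.sqrt (gdet j11 j12 j22) / (2 * pi) *
  expR (- (gquad j11 j12 j22 e1 e2 a b / 2)).

Lemma measurable_gdet d (T : measurableType d) (j11 j12 j22 : T -> R) :
  measurable_fun setT j11 -> measurable_fun setT j12 -> measurable_fun setT j22 ->
  measurable_fun setT (fun x => gdet (j11 x) (j12 x) (j22 x)).
Proof.
move=> m11 m12 m22; apply: measurable_funB; first exact: measurable_funM.
exact: measurable_funX.
Qed.

Lemma measurable_gquad d (T : measurableType d) (j11 j12 j22 e1 e2 a b : T -> R) :
  measurable_fun setT j11 -> measurable_fun setT j12 -> measurable_fun setT j22 ->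
  measurable_fun setT e1 -> measurable_fun setT e2 ->
  measurable_fun setT a -> measurable_fun setT b ->
  measurable_fun setT (fun x =>
    gquad (j11 x) (j12 x) (j22 x) (e1 x) (e2 x) (a x) (b x)).
Proof.
move=> m11 m12 m22 m1 m2 ma mb; have mD := measurable_gdet m11 m12 m22.
rewrite /gquad; apply: measurable_funD.
  by measurable_poly.
apply: measurable_funM; last exact: (measurableT_comp (@measurable_inv R)).
by measurable_poly.
Qed.

Lemma measurable_gdens d (T : measurableType d) (j11 j12 j22 e1 e2 a b : T -> R) :
  measurable_fun setT j11 -> measurable_fun setT j12 -> measurable_fun setT j22 ->
  measurable_fun setT e1 -> measurable_fun setT e2 ->
  measurable_fun setT a -> measurable_fun setT b ->
  measurable_fun setT (fun x =>
    gdens (j11 x) (j12 x) (j22 x) (e1 x) (e2 x) (a x) (b x)).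
Proof.
move=> m11 m12 m22 m1 m2 ma mb; have mD := measurable_gdet m11 m12 m22.
have mQ := measurable_gquad m11 m12 m22 m1 m2 ma mb.
apply: measurable_funM.
  apply: measurable_funM => //.
  apply: (@measurableT_comp _ _ _ _ _ _ (@Num.sqrt R)) => //.
  exact: (continuous_measurable_fun (@sqrt_continuous R)).
apply: (@measurableT_comp _ _ _ _ _ _ (@expR R)) => //.
apply: (@measurableT_comp _ _ _ _ _ _ (@GRing.opp R)) => //.
exact: measurable_funM.
Qed.

Section Moments.
Variables (j11 j12 j22 e1 e2 : R).
Hypotheses (j22_gt0 : 0 < j22) (D_gt0 : 0 < gdet j11 j12 j22).
Local Notation D := (gdet j11 j12 j22).

Lemma gdens_gt0 a b : 0 < gdens j11 j12 j22 e1 e2 a b.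
Proof. by rewrite mulr_gt0 ?expR_gt0// divr_gt0 ?sqrtr_gt0// mulr_gt0 ?pi_gt0. Qed.

(** Mean and deviation of the first coordinate, then those of the second coordinate given the first:
    the density factors into one-dimensional normal densities, integrated one after the other. *)
Let mu1 := (j22 * e1 - j12 * e2) / D.
Let s1 := Num.sqrt (j22 / D).
Let mu2 a := (e2 - j12 * a) / j22.
Let s2 := Num.sqrt (j22^-1).

Let s1_gt0 : 0 < s1. Proof. by rewrite sqrtr_gt0 divr_gt0. Qed.
Let s2_gt0 : 0 < s2. Proof. by rewrite sqrtr_gt0 invr_gt0. Qed.
Let s1E : s1 ^+ 2 = j22 / D. Proof. by rewrite sqr_sqrtr// divr_ge0// ltW. Qed.
Let s2E : s2 ^+ 2 = j22^-1. Proof. by rewrite sqr_sqrtr// invr_ge0 ltW. Qed.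

Lemma gquadE a b : gquad j11 j12 j22 e1 e2 a b =
  ((a - mu1) / s1) ^+ 2 + ((b - mu2 a) / s2) ^+ 2.
Proof.
rewrite !expr_div_n s1E s2E /gquad /mu1 /mu2 /gdet; field.
by rewrite !gt_eqF.
Qed.

Lemma gdensE a b : gdens j11 j12 j22 e1 e2 a b =
  normal_pdf mu1 s1 a * normal_pdf (mu2 a) s2 b.
Proof.
rewrite !normal_pdfE ?gt_eqF// /normal_peak /normal_fun mulrACA -expRD.
congr (_ * expR _); last first.
  by rewrite gquadE; field; rewrite !gt_eqF.
rewrite s1E s2E -invfM -sqrtrM; last first.
  by rewrite mulrn_wge0// mulr_ge0 ?pi_ge0// divr_ge0// ltW.
have -> : (j22 / D * pi *+ 2) * (j22^-1 * pi *+ 2) = (2 * pi) ^+ 2 * D^-1.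
  by field; rewrite !gt_eqF.
rewrite sqrtrM ?sqr_ge0// sqrtr_sqr ger0_norm; last by rewrite mulr_ge0// pi_ge0.
rewrite (sqrtrV (ltW D_gt0)).
have sD0 : Num.sqrt D != 0 by rewrite gt_eqF// sqrtr_gt0.
have := pi_gt0 R; move: pi => p p0; field.
by rewrite sD0 gt_eqF.
Qed.

Lemma integral_gdens : (\int[lebesgue_measure]_a \int[lebesgue_measure]_b
  (gdens j11 j12 j22 e1 e2 a b)%:E = 1)%E.
Proof.
have inner a : (\int[lebesgue_measure]_b (gdens j11 j12 j22 e1 e2 a b)%:E =
    (normal_pdf mu1 s1 a)%:E)%E.
  under eq_integral => b _ do rewrite gdensE EFinM.
  rewrite ge0_integralZl//; last 3 first.
  - by apply/measurable_EFinP; exact: measurable_normal_pdf.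
  - by move=> b _; rewrite lee_fin normal_pdf_ge0.
  - by rewrite lee_fin normal_pdf_ge0.
  by rewrite integral_normal_pdf mule1.
under eq_integral do rewrite inner.
exact: integral_normal_pdf.
Qed.

(** The form is a sum of two squared standardised coordinates, each of mean 1: this is the mean of a
    chi-square law with two degrees of freedom. *)
Lemma integral_gquad_gdens : (\int[lebesgue_measure]_a \int[lebesgue_measure]_b
  (gquad j11 j12 j22 e1 e2 a b * gdens j11 j12 j22 e1 e2 a b)%:E = 2%:E)%E.
Proof.
have mn := @measurable_normal_pdf R.
have n0 := @normal_pdf_ge0 R.
have inner a : (\int[lebesgue_measure]_b
    (gquad j11 j12 j22 e1 e2 a b * gdens j11 j12 j22 e1 e2 a b)%:E =
    (((a - mu1) / s1) ^+ 2 * normal_pdf mu1 s1 a + normal_pdf mu1 s1 a)%:E)%E.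
  transitivity (\int[lebesgue_measure]_b
    ((((a - mu1) / s1) ^+ 2 * normal_pdf mu1 s1 a)%:E * (normal_pdf (mu2 a) s2 b)%:E +
    (normal_pdf mu1 s1 a)%:E *
      (((b - mu2 a) / s2) ^+ 2 * normal_pdf (mu2 a) s2 b)%:E))%E.
    apply: eq_integral => b _; rewrite -!EFinM -EFinD gquadE gdensE.
    by congr EFin; ring.
  have mb : measurable_fun setT (fun b : R =>
      ((b - mu2 a) / s2) ^+ 2 * normal_pdf (mu2 a) s2 b).
    exact: measurable_normal_moment.
  rewrite ge0_integralD//; last 4 first.
  - by move=> b _; rewrite -EFinM lee_fin mulr_ge0// mulr_ge0// sqr_ge0.
  - by apply: measurable_funeM; apply/measurable_EFinP; exact: measurable_normal_pdf.
  - by move=> b _; rewrite -!EFinM lee_fin mulr_ge0// mulr_ge0// sqr_ge0.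
  - by apply: measurable_funeM; apply/measurable_EFinP.
  rewrite ge0_integralZl//; last 3 first.
  - by apply/measurable_EFinP; exact: measurable_normal_pdf.
  - by move=> b _; rewrite lee_fin.
  - by rewrite lee_fin mulr_ge0// sqr_ge0.
  rewrite ge0_integralZl//; last 3 first.
  - by apply/measurable_EFinP.
  - by move=> b _; rewrite lee_fin mulr_ge0// sqr_ge0.
  - by rewrite lee_fin.
  by rewrite integral_normal_pdf integral_normal_moment// !mule1.
under eq_integral do rewrite inner EFinD.
rewrite ge0_integralD//; last 4 first.
- by move=> a _; rewrite lee_fin mulr_ge0// sqr_ge0.
- by apply/measurable_EFinP; exact: measurable_normal_moment.
- by move=> a _; rewrite lee_fin.
- by apply/measurable_EFinP; exact: measurable_normal_pdf.
by rewrite integral_normal_pdf integral_normal_moment// -EFinD.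
Qed.

End Moments.

(* Bayes' rule for the observation of [z . theta] in Gaussian noise. *)
Lemma gdens_update (j11 j12 j22 e1 e2 z1 z2 w x a b : R) : 0 < w ->
  0 < gdet (j11 + z1 ^+ 2 / w) (j12 + z1 * z2 / w) (j22 + z2 ^+ 2 / w) ->
  normal_pdf (a * z1 + b * z2) (Num.sqrt w) x * gdens j11 j12 j22 e1 e2 a b =
  normal_pdf 0 (Num.sqrt w) x * gdens j11 j12 j22 e1 e2 0 0 /
  gdens (j11 + z1 ^+ 2 / w) (j12 + z1 * z2 / w) (j22 + z2 ^+ 2 / w)
    (e1 + z1 * x / w) (e2 + z2 * x / w) 0 0 *
  gdens (j11 + z1 ^+ 2 / w) (j12 + z1 * z2 / w) (j22 + z2 ^+ 2 / w)
    (e1 + z1 * x / w) (e2 + z2 * x / w) a b.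
Proof.
move=> w0 D'0; have sw0 : Num.sqrt w != 0 by rewrite gt_eqF// sqrtr_gt0.
rewrite !normal_pdfE// /normal_fun sqr_sqrtr ?ltW// /gdens.
set k' := Num.sqrt (gdet (_ + _) _ _) / (2 * pi).
have k'0 : k' != 0 by rewrite gt_eqF// divr_gt0 ?sqrtr_gt0// mulr_gt0// pi_gt0.
set k := Num.sqrt _ / (2 * pi); set p := normal_peak _.
rewrite [RHS](_ : _ = p * k * (expR (- (x - 0) ^+ 2 / (w *+ 2)) *
  expR (- (gquad j11 j12 j22 e1 e2 0 0 / 2)) /
  expR (- (gquad (j11 + z1 ^+ 2 / w) (j12 + z1 * z2 / w) (j22 + z2 ^+ 2 / w)
    (e1 + z1 * x / w) (e2 + z2 * x / w) 0 0 / 2)) *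
  expR (- (gquad (j11 + z1 ^+ 2 / w) (j12 + z1 * z2 / w) (j22 + z2 ^+ 2 / w)
    (e1 + z1 * x / w) (e2 + z2 * x / w) a b / 2)))); last first.
  by field; rewrite k'0/= gt_eqF// expR_gt0.
rewrite -expRN -!expRD mulrACA -expRD; congr (_ * expR _).
(* The constant terms of the two forms cancel between their values at [(a, b)] and at 0, so they are
   made opaque and only a polynomial identity over [w] remains. *)
by rewrite /gquad; set c := _ / gdet _ _ _; set c' := _ / gdet _ _ _;
  field; rewrite gt_eqF.
Qed.

(** The matrix determinant lemma: the determinant is multiplied by [1 + z^T J^-1 z / w], and the
    increment is written as a sum of squares to show its sign. *)
Lemma gdet_update (j11 j12 j22 z1 z2 w : R) : 0 < w -> 0 < j22 ->
  0 < gdet j11 j12 j22 ->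
  0 < gdet (j11 + z1 ^+ 2 / w) (j12 + z1 * z2 / w) (j22 + z2 ^+ 2 / w).
Proof.
move=> w0 j220 D0.
rewrite (_ : gdet (_ + _) _ _ = gdet j11 j12 j22 +
  ((j22 * z1 - j12 * z2) ^+ 2 + gdet j11 j12 j22 * z2 ^+ 2) / (j22 * w)).
  rewrite ltr_wpDr//; apply: divr_ge0; last by rewrite ltW// mulr_gt0.
  by rewrite addr_ge0 ?sqr_ge0// mulr_ge0 ?sqr_ge0// ltW.
by rewrite /gdet; field; rewrite !gt_eqF.
Qed.

End PlanarGaussian.

Section PlaneMeasure.
Variable R : realType.
Local Notation leb := (@lebesgue_measure R).
Local Notation TR := (measurableTypeR R).

(** Named so that a sigma-finite instance can be attached to it: Fubini is applied between the plane
    of Theta and the line of the next observation. *)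
Definition lebesgue2 : set (TR * TR) -> \bar R := (leb \x leb)%E.

HB.instance Definition _ := Measure.on lebesgue2.

Lemma lebesgue2_sigma_finite : sigma_finite setT lebesgue2.
Proof.
have /sigma_finiteP[F [FT ndF Foo]] := sigma_finiteT leb.
exists (fun n => F n `*` F n) => [|n].
  apply/seteqP; split => // -[x y] _.
  have [n _ Fx] : (\bigcup_n F n) x by rewrite -FT.
  have [m _ Fy] : (\bigcup_n F n) y by rewrite -FT.
  exists (maxn n m) => //; split => /=.
    by move: x Fx; exact/subsetPset/ndF/leq_maxl.
  by move: y Fy; exact/subsetPset/ndF/leq_maxr.
have [mF Fn] := Foo n; split; first exact: measurableX.
by rewrite /lebesgue2 product_measure1E// lte_mul_pinfty// ge0_fin_numE.
Qed.

HB.instance Definition _ := Measure_isSigmaFinite.Build _ _ _ lebesgue2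
  lebesgue2_sigma_finite.

Lemma integral_lebesgue2 (f : TR * TR -> \bar R) : measurable_fun setT f ->
  (forall x, 0 <= f x)%E ->
  (\int[lebesgue2]_x f x = \int[leb]_a \int[leb]_b f (a, b))%E.
Proof. exact: fubini_tonelli1. Qed.

End PlaneMeasure.

(** * Paths, filtering and the law of the closed loop *)

(* A path up to time [t] is encoded as an infinite sequence padded with zeros, so
   that histories of all lengths live in one measurable space. *)
Definition coord_sets (R : realType) : set (set (nat -> R)) :=
  [set E | exists i (B : set R), measurable B /\ E = (fun x => x i) @^-1` B].

Arguments coord_sets : clear implicits.

Notation trace R := (g_sigma_algebraType (coord_sets R)).

Section Traces.
Context {R : realType}.
Local Notation TR := (measurableTypeR R).

Lemma measurable_coord i : measurable_fun setT (fun x : trace R => x i).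
Proof.
by move=> _ B mB; rewrite setTI; apply: sub_sigma_algebra; exists i, B.
Qed.

Lemma measurable_trace d (T : measurableType d) (f : T -> trace R) :
  (forall i, measurable_fun setT (fun t => f t i)) -> measurable_fun setT f.
Proof.
move=> mf; apply: (@measurability _ _ _ (trace R) setT f (coord_sets R)) => //.
move=> _ [_ [i [B [mB ->]]] <-].
by have := mf i measurableT B mB; rewrite !setTI.
Qed.

Definition upd (x : trace R) (n : nat) (r : R) : trace R :=
  fun i => if i == n then r else x i.

Lemma upd_same x n r : upd x n r n = r.
Proof. by rewrite /upd eqxx. Qed.

Lemma upd_lt x n r i : (i < n)%N -> upd x n r i = x i.
Proof. by move=> i_n; rewrite /upd ltn_eqF. Qed.

Lemma measurable_upd n :
  measurable_fun setT (fun p : trace R * TR => upd p.1 n p.2).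
Proof.
apply: measurable_trace => i; rewrite /upd; case: eqP => _; first exact: measurable_snd.
exact: (measurableT_comp (measurable_coord i) measurable_fst).
Qed.

End Traces.

Section Filter.
Context {R : realType}.
Local Notation TR := (measurableTypeR R).
Variable g : forall t : nat, 'rV[R]_t.+1 -> R.

Definition input t (x : trace R) : R := g (\row_(i < t.+1) x i).

Lemma measurable_input t : rV_measurable_fun (g (t := t)) ->
  measurable_fun setT (input t).
Proof.
move=> mg _ B mB; rewrite setTI.
have : rV_borel (g (t := t) @^-1` B) by exact: mg.
rewrite (_ : input t @^-1` B =
  (fun x : trace R => \row_(i < t.+1) x i) @^-1` (g (t := t) @^-1` B))//.
move: (_ @^-1` B) => E; pose row_of (x : trace R) : 'rV[R]_t.+1 := \row_(i < t.+1) x i.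
suff : rV_borel (n := t.+1) `<=` [set E | measurable (row_of @^-1` E)] by exact.
apply: smallest_sub.
  split=> [|C mC|C mC]; rewrite /mkset.
  - by rewrite preimage_set0.
  - by rewrite setTD preimage_setC; exact: measurableC.
  - by rewrite preimage_bigcup; exact: bigcupT_measurable.
move=> _ [Bs [mBs ->]] /=.
rewrite (_ : _ @^-1` _ = \bigcap_(i in [set: 'I_t.+1]) ((fun x : trace R => x i) @^-1` Bs i)).
  apply: fin_bigcap_measurable => // i _.
  by rewrite -[X in measurable X]setTI; exact: measurable_coord.
apply/seteqP; split => [x /= H i _|x H i] /=.
  by have := H i; rewrite /row_of mxE.
by rewrite /row_of mxE; exact: (H i I).
Qed.

Variables (Wv : R) (p11 p12 p22 q1 q2 : R).
Hypothesis W_gt0 : 0 < Wv.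
Hypotheses (p22_gt0 : 0 < p22) (det_gt0 : 0 < gdet p11 p12 p22).

(** The entries of the precision matrix [Pi_t^-1] and of the vector precision times mean for the law
    of Theta given the path. *)
Definition J11 t (x : trace R) : R := p11 + \sum_(i < t) x i ^+ 2 / Wv.
Definition J12 t (x : trace R) : R := p12 + \sum_(i < t) x i * input i x / Wv.
Definition J22 t (x : trace R) : R := p22 + \sum_(i < t) input i x ^+ 2 / Wv.
Definition E1 t (x : trace R) : R := q1 + \sum_(i < t) x i * x i.+1 / Wv.
Definition E2 t (x : trace R) : R := q2 + \sum_(i < t) input i x * x i.+1 / Wv.

Definition post t (x : trace R) (a b : R) : R :=
  gdens (J11 t x) (J12 t x) (J22 t x) (E1 t x) (E2 t x) a b.
Definition postquad t (x : trace R) (a b : R) : R :=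
  gquad (J11 t x) (J12 t x) (J22 t x) (E1 t x) (E2 t x) a b.

(* The predictive density of the state at time [t.+1]: the normalising constant of
   Bayes' rule, read off at [Theta = 0]. *)
Definition predens t (x : trace R) (y : R) : R :=
  normal_pdf 0 (Num.sqrt Wv) y * post t x 0 0 / post t.+1 (upd x t.+1 y) 0 0.

Definition likelihood t (q : ((TR * TR) * trace R) * TR) : R :=
  normal_pdf (q.1.1.1 * q.1.2 t + q.1.1.2 * input t q.1.2) (Num.sqrt Wv) q.2.

Lemma J_gt0 t x : 0 < J22 t x /\ 0 < gdet (J11 t x) (J12 t x) (J22 t x).
Proof.
elim: t => [|t [J220 D0]].
  by rewrite /J11 /J12 /J22 !big_ord0 !addr0.
rewrite /J11 /J12 /J22 !big_ord_recr/= !addrA; split.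
  by rewrite ltr_wpDr// divr_ge0 ?sqr_ge0// ltW.
exact: gdet_update.
Qed.

Lemma post_gt0 t x a b : 0 < post t x a b.
Proof. by have [? ?] := J_gt0 t x; exact: gdens_gt0. Qed.

Lemma predens_gt0 t x y : 0 < predens t x y.
Proof.
rewrite divr_gt0 ?post_gt0// mulr_gt0 ?post_gt0// normal_pdf_gt0// gt_eqF//.
by rewrite sqrtr_gt0.
Qed.

Lemma likelihood_gt0 t q : 0 < likelihood t q.
Proof. by rewrite normal_pdf_gt0// gt_eqF// sqrtr_gt0. Qed.

(** By causality the inputs up to time [t] do not read the entry [t.+1], so that overwriting this
    entry adds exactly one term to each of the five sums, as [gdens_update] requires. *)
Lemma post_upd t x y a b :
  normal_pdf (a * x t + b * input t x) (Num.sqrt Wv) y * post t x a b =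
  predens t x y * post t.+1 (upd x t.+1 y) a b.
Proof.
have iu i : (i < t.+1)%N -> input i (upd x t.+1 y) = input i x.
  move=> it; congr g; apply/rowP => k; rewrite !mxE upd_lt//.
  exact: leq_trans (ltn_ord k) it.
have xu (i : 'I_t) : upd x t.+1 y i = x i by rewrite upd_lt// ltnS ltnW.
have xu' (i : 'I_t) : upd x t.+1 y i.+1 = x i.+1.
  by rewrite upd_lt// ltnS ltn_ord.
have iu' (i : 'I_t) : input i (upd x t.+1 y) = input i x by rewrite iu// ltnS ltnW.
have [_] := J_gt0 t.+1 (upd x t.+1 y); rewrite /predens /post.
have -> : J11 t.+1 (upd x t.+1 y) = J11 t x + x t ^+ 2 / Wv.
  rewrite /J11 big_ord_recr/= upd_lt// addrA; congr (_ + _ + _).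
  by apply: eq_bigr => i _; rewrite xu.
have -> : J12 t.+1 (upd x t.+1 y) = J12 t x + x t * input t x / Wv.
  rewrite /J12 big_ord_recr/= upd_lt// iu// addrA; congr (_ + _ + _).
  by apply: eq_bigr => i _; rewrite xu iu'.
have -> : J22 t.+1 (upd x t.+1 y) = J22 t x + input t x ^+ 2 / Wv.
  rewrite /J22 big_ord_recr/= iu// addrA; congr (_ + _ + _).
  by apply: eq_bigr => i _; rewrite iu'.
have -> : E1 t.+1 (upd x t.+1 y) = E1 t x + x t * y / Wv.
  rewrite /E1 big_ord_recr/= upd_lt// upd_same addrA; congr (_ + _ + _).
  by apply: eq_bigr => i _; rewrite xu xu'.
have -> : E2 t.+1 (upd x t.+1 y) = E2 t x + input t x * y / Wv.
  rewrite /E2 big_ord_recr/= iu// upd_same addrA; congr (_ + _ + _).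
  by apply: eq_bigr => i _; rewrite iu' xu'.
exact: gdens_update.
Qed.

Lemma integral_post t x : (\int[lebesgue_measure]_a \int[lebesgue_measure]_b
  (post t x a b)%:E = 1)%E.
Proof. by have [? ?] := J_gt0 t x; exact: integral_gdens. Qed.

Lemma integral_postquad t x : (\int[lebesgue_measure]_a \int[lebesgue_measure]_b
  (postquad t x a b * post t x a b)%:E = 2%:E)%E.
Proof. by have [? ?] := J_gt0 t x; exact: integral_gquad_gdens. Qed.

Lemma postquad_ge0 t x a b : 0 <= postquad t x a b.
Proof.
have [? ?] := J_gt0 t x; rewrite /postquad gquadE//.
by rewrite addr_ge0// sqr_ge0.
Qed.

Variable T : nat.
Hypothesis hg : forall t : nat, (t < T)%N -> rV_measurable_fun (g (t := t)).

Let mi t : (t < T)%N -> measurable_fun setT (input t).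
Proof. by move=> tT; apply: measurable_input; exact: hg. Qed.

Lemma measurable_params t : (t <= T)%N -> [/\ measurable_fun setT (J11 t),
  measurable_fun setT (J12 t), measurable_fun setT (J22 t),
  measurable_fun setT (E1 t) & measurable_fun setT (E2 t)].
Proof.
move=> tT; have mc := @measurable_coord R.
have mit (i : 'I_t) : measurable_fun setT (input i).
  by apply: mi; exact: leq_trans (ltn_ord i) tT.
split; apply: measurable_funD => //; apply: measurable_sum => i;
  apply: measurable_funM => //; (exact: measurable_funX || exact: measurable_funM).
Qed.

Lemma measurable_gdetJ t : (t <= T)%N ->
  measurable_fun setT (fun x => gdet (J11 t x) (J12 t x) (J22 t x)).
Proof. by move=> /measurable_params[? ? ? _ _]; exact: measurable_gdet. Qed.

Lemma measurable_post t : (t <= T)%N -> measurable_fun setT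
  (fun p : (TR * TR) * trace R => post t p.2 p.1.1 p.1.2).
Proof.
move=> /measurable_params[m11 m12 m22 m1 m2].
by apply: measurable_gdens; do ?[exact: (measurableT_comp _ measurable_snd)|
  exact: (measurableT_comp measurable_fst measurable_fst)|
  exact: (measurableT_comp measurable_snd measurable_fst)].
Qed.

Lemma measurable_postquad t : (t <= T)%N -> measurable_fun setT
  (fun p : (TR * TR) * trace R => postquad t p.2 p.1.1 p.1.2).
Proof.
move=> /measurable_params[m11 m12 m22 m1 m2].
by apply: measurable_gquad; do ?[exact: (measurableT_comp _ measurable_snd)|
  exact: (measurableT_comp measurable_fst measurable_fst)|
  exact: (measurableT_comp measurable_snd measurable_fst)].
Qed.

Lemma measurable_predens t : (t < T)%N -> measurable_fun setT
  (fun p : trace R * TR => predens t p.1 p.2).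
Proof.
move=> tT; apply: measurable_funM; first apply: measurable_funM.
- by apply: (measurableT_comp _ measurable_snd); exact: measurable_normal_pdf.
- have mg : measurable_fun setT (fun p : trace R * TR => ((0 : TR, 0 : TR), p.1)).
    by apply: measurable_fun_pair => //; exact: measurable_fst.
  exact: (measurableT_comp (measurable_post (ltnW tT)) mg).
- apply: (measurableT_comp (@measurable_inv R)).
  have mg : measurable_fun setT
      (fun p : trace R * TR => ((0 : TR, 0 : TR), upd p.1 t.+1 p.2)).
    by apply: measurable_fun_pair => //; exact: measurable_upd.
  exact: (measurableT_comp (measurable_post tT) mg).
Qed.

Lemma measurable_likelihood t : (t < T)%N -> measurable_fun setT (likelihood t).
Proof.
move=> tT; have s0 : Num.sqrt Wv != 0 by rewrite gt_eqF// sqrtr_gt0.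
apply: (@measurable_normal_pdf_comp R _ _ (fun p : ((TR * TR) * trace R) * TR =>
  p.1.1.1 * p.1.2 t + p.1.1.2 * input t p.1.2) (fun p => p.2) _ s0 _ measurable_snd).
have m1 : measurable_fun setT (fun p : ((TR * TR) * trace R) * TR => p.1.2).
  exact: (measurableT_comp measurable_snd measurable_fst).
have m2 : measurable_fun setT (fun p : ((TR * TR) * trace R) * TR => p.1.1).
  exact: (measurableT_comp measurable_fst measurable_fst).
apply: measurable_funD; apply: measurable_funM.
- exact: (measurableT_comp measurable_fst m2).
- exact: (measurableT_comp (measurable_coord t) m1).
- exact: (measurableT_comp measurable_snd m2).
- exact: (measurableT_comp (mi tT) m1).
Qed.

End Filter.

Section Trajectories.
Context {R : realType} (g : forall t : nat, 'rV[R]_t.+1 -> R).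
Context {d : measure_display} {Omega : measurableType d}.
Variables (A B : Omega -> R) (W : nat -> Omega -> R).

Local Notation X := (Xrv g A B W).

Lemma size_traj a b (w : nat -> R) t : size (traj g a b w t) = t.+1.
Proof. by elim: t => //= t IH; rewrite size_rcons IH. Qed.

Lemma nth_traj a b (w : nat -> R) s t i : (i <= s)%N -> (s <= t)%N ->
  nth 0 (traj g a b w t) i = nth 0 (traj g a b w s) i.
Proof.
move=> is_; elim: t => [|t IH].
  by rewrite leqn0 => /eqP ->.
rewrite leq_eqVlt => /predU1P[->//|]; rewrite ltnS => st.
by rewrite /= nth_rcons size_traj ltnS (leq_trans is_ st) IH.
Qed.

Lemma nth_traj_Xrv w s t : (s <= t)%N ->
  nth 0 (traj g (A w) (B w) (fun s => W s w) t) s = X s w.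
Proof. by move=> st; rewrite /Xrv (nth_traj _ _ _ (leqnn s) st). Qed.

Lemma XvecE t w : Xvec g A B W t w = \row_(i < t.+1) X i w.
Proof. by apply/rowP => i; rewrite !mxE nth_traj_Xrv// -ltnS. Qed.

Definition history (t : nat) (w : Omega) : trace R :=
  fun i => if (i <= t)%N then X i w else 0.

Lemma history_le t i w : (i <= t)%N -> history t w i = X i w.
Proof. by rewrite /history => ->. Qed.

Lemma historyS t w : history t.+1 w = upd (history t w) t.+1 (X t.+1 w).
Proof.
apply/funext => i; rewrite /history /upd; have [->|it] := eqVneq i t.+1.
  by rewrite leqnn.
by rewrite leq_eqVlt (negbTE it) ltnS.
Qed.

Lemma input_history s t w : (s <= t)%N -> input g s (history t w) = Urv g A B W s w.
Proof.
move=> st; rewrite /input /Urv XvecE; congr g; apply/rowP => i.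
by rewrite !mxE history_le// (leq_trans _ st)// -ltnS.
Qed.

Lemma YrvE t w : Yrv g A B W t.+1 w =
  A w * history t w t + B w * input g t (history t w).
Proof. by rewrite input_history// history_le. Qed.

Lemma XrvS t w : X t.+1 w =
  A w * history t w t + B w * input g t (history t w) + W t w.
Proof.
rewrite input_history// history_le// /Xrv /= nth_rcons size_traj ltnn eqxx.
have lE : last 0 (traj g (A w) (B w) (fun s => W s w) t) =
    nth 0 (traj g (A w) (B w) (fun s => W s w) t) t.
  by rewrite -nth_last size_traj.
by rewrite lE.
Qed.

Variable T : nat.
Hypothesis hg : forall t : nat, (t < T)%N -> rV_measurable_fun (g (t := t)).
Hypotheses (mA : measurable_fun setT A) (mB : measurable_fun setT B).

(** Only the noises before [t] enter, and the sigma-algebra on [Omega] is arbitrary. Applied to the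
    one generated by Theta and these noises, the lemma says that the history is adapted. *)
Lemma measurable_history t : (t <= T)%N ->
  (forall s, (s < t)%N -> measurable_fun setT (W s)) ->
  measurable_fun setT (history t).
Proof.
elim: t => [_ _|t IH tT mW].
  apply: measurable_trace => i; rewrite /history; case i0 : (i <= 0)%N => //.
  rewrite (_ : (fun _ => _) = cst 0)//; apply/funext => w.
  by move: i0; rewrite leqn0 => /eqP ->.
have mh : measurable_fun setT (history t).
  by apply: IH => [|s st]; [exact: ltnW|apply: mW; exact: ltnW].
rewrite (_ : history t.+1 = fun w => upd (history t w) t.+1
    (A w * history t w t + B w * input g t (history t w) + W t w)); last first.
  by apply/funext => w; rewrite historyS XrvS.
have mg : measurable_fun setT (fun w => (history t w,
    A w * history t w t + B w * input g t (history t w) + W t w)).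
  apply: measurable_fun_pair => //; apply: measurable_funD; last exact: mW.
  apply: measurable_funD; apply: measurable_funM => //.
    exact: (measurableT_comp (measurable_coord t) mh).
  exact: (measurableT_comp (measurable_input (hg tT)) mh).
exact: (measurableT_comp (measurable_upd t.+1) mg).
Qed.

End Trajectories.

Section Law.
Context (R : realType) (d : measure_display) (Omega : measurableType d).
Variables (P : probability Omega R) (T : nat) (Wv : R).
Variables (p11 p12 p22 q1 q2 : R).
Hypotheses (W_gt0 : 0 < Wv) (p22_gt0 : 0 < p22) (det_gt0 : 0 < gdet p11 p12 p22).
Variables (A B : Omega -> R) (W : nat -> Omega -> R).
Hypotheses (mA : measurable_fun setT A) (mB : measurable_fun setT B).
Hypothesis mW : forall t, measurable_fun setT (W t).
Hypothesis hlaw : forall (C1 C2 : set R) (D : 'I_T -> set R),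
  measurable C1 -> measurable C2 -> (forall t, measurable (D t)) ->
  P [set w | C1 (A w) /\ C2 (B w) /\ forall t : 'I_T, D t (W t w)] =
  ((\int[lebesgue_measure]_(a in C1) \int[lebesgue_measure]_(b in C2)
       (gdens p11 p12 p22 q1 q2 a b)%:E) *
   \prod_(t < T) \int[lebesgue_measure]_(x in D t)
       (normal_pdf 0 (Num.sqrt Wv) x)%:E)%E.

Local Notation s := (Num.sqrt Wv).
Local Notation nu := (normal_prob 0 s).
Local Notation leb := (@lebesgue_measure R).
Local Notation TR := (measurableTypeR R).

(** A pi-system that generates the sigma-algebra of Theta and [W_0, ..., W_(t-1)]; independence of
    [W_t] is checked on it from the rectangles of [hlaw]. *)
Definition noise_rect (t : nat) : set (set Omega) :=
  [set E | exists (C1 C2 : set R) (D : nat -> set R),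
    [/\ measurable C1, measurable C2, forall i, measurable (D i) &
    E = [set w | C1 (A w) /\ C2 (B w) /\ forall i, (i < t)%N -> D i (W i w)]]].

Local Notation past t := (g_sigma_algebraType (noise_rect t)).

Let measurable_preim (f : Omega -> R) (C : set R) : measurable_fun setT f ->
  measurable C -> measurable (f @^-1` C).
Proof. by move=> mf mC; rewrite -[X in measurable X]setTI; exact: mf. Qed.

Let measurable_forall_lt (D : nat -> set R) n : (forall i, measurable (D i)) ->
  measurable [set w | forall i, (i < n)%N -> D i (W i w)].
Proof.
move=> mD; rewrite (_ : mkset _ = \bigcap_i
    (if (i < n)%N then W i @^-1` D i else setT)).
  apply: bigcapT_measurable => i; case: ifP => // _; exact: measurable_preim.
apply/seteqP; split => w /= H i => [_|i_n].
  by case: ifP => // /H.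
by have := H i I; rewrite i_n.
Qed.

Lemma noise_rect_measurable t : noise_rect t `<=` measurable.
Proof.
move=> _ [C1 [C2 [D [m1 m2 mD ->]]]].
rewrite (_ : mkset _ = A @^-1` C1 `&` (B @^-1` C2 `&`
  [set w | forall i, (i < t)%N -> D i (W i w)]))//.
by apply: measurableI; [|apply: measurableI]; first exact: measurable_preim;
  [exact: measurable_preim|exact: measurable_forall_lt].
Qed.

Lemma past_measurable t E : <<s noise_rect t >> E -> measurable E.
Proof.
apply: smallest_sub; first exact: sigma_algebra_measurable.
exact: noise_rect_measurable.
Qed.

Lemma setI_closed_noise_rect t : setI_closed (noise_rect t).
Proof.
move=> _ _ [C1 [C2 [D [m1 m2 mD ->]]]] [C1' [C2' [D' [m1' m2' mD' ->]]]].
exists (C1 `&` C1'), (C2 `&` C2'), (fun i => D i `&` D' i); split.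
- exact: measurableI.
- exact: measurableI.
- by move=> i; exact: measurableI.
- apply/seteqP; split => w /=.
    by move=> [[? [? H]] [? [? H']]]; do ![split] => //; [exact: H|exact: H'].
  by move=> [[? ?] [[? ?] H]]; do ![split] => //; move=> i it; case: (H i it).
Qed.

Lemma measurable_past t : [/\ measurable_fun (setT : set (past t)) A,
  measurable_fun (setT : set (past t)) B &
  forall i, (i < t)%N -> measurable_fun (setT : set (past t)) (W i)].
Proof.
split=> [_ C mC|_ C mC|i it _ C mC]; rewrite setTI; apply: sub_sigma_algebra.
- exists C, setT, (fun _ => setT); split=> //.
  by apply/seteqP; split => w /=; tauto.
- exists setT, C, (fun _ => setT); split=> //.
  by apply/seteqP; split => w /=; tauto.
- exists setT, setT, (fun j => if j == i then C else setT); split=> //.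
    by move=> j; case: ifP.
  apply/seteqP; split => w /=.
    by move=> Cw; do ![split] => // j jt; case: eqP => // ->.
  by move=> [_ [_ /(_ i it)]]; rewrite eqxx.
Qed.

Lemma past_noise_indep t E D : (t < T)%N -> <<s noise_rect t >> E ->
  measurable D -> P (E `&` W t @^-1` D) = (P E * nu D)%E.
Proof.
move=> tT sE mD; have mWD := measurable_preim (mW t) mD.
have nuD0 : (0 <= fine (nu D)) by rewrite fine_ge0.
have nuDE : (fine (nu D))%:E = nu D by rewrite fineK// fin_num_measure.
have mscE F : mscale (NngNum nuD0) P F = (nu D * P F)%E by rewrite /mscale /= -[in RHS]nuDE.
rewrite muleC -mscE.
apply: (@g_sigma_algebra_measure_unique _ _ _ (noise_rect t)
  (@noise_rect_measurable t) (fun _ => setT) _ _ (mrestr P mWD)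
  (mscale (NngNum nuD0) P)) => //.
- move=> _; exists setT, setT, (fun _ => setT); split=> //.
  by apply/seteqP; split=> w.
- by apply/seteqP; split => // w _; exists 0%N.
- exact: setI_closed_noise_rect.
- move=> _ [C1 [C2 [D' [m1 m2 mD' ->]]]].
  transitivity (P ([set w | C1 (A w) /\ C2 (B w) /\
    forall i, (i < t)%N -> D' i (W i w)] `&` W t @^-1` D)) => //.
  apply/esym; apply: (eq_trans (mscE _)); apply/esym.
  (* The law is prescribed for all [T] noises at once: coordinate [t] receives [D], or the whole
     line for the past alone, and later coordinates are left free. *)
  pose F (Dt : set R) (i : 'I_T) : set R :=
    if (i < t)%N then D' i else if (i == t :> nat) then Dt else setT.
  have mF Dt : measurable Dt -> forall i, measurable (F Dt i).
    by move=> mDt i; rewrite /F; case: ifP => // _; case: ifP.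
  have e1 : [set w | C1 (A w) /\ C2 (B w) /\
      forall i, (i < t)%N -> D' i (W i w)] `&` W t @^-1` D =
      [set w | C1 (A w) /\ C2 (B w) /\ forall i : 'I_T, F D i (W i w)].
    apply/seteqP; split => w /=.
      move=> [[? [? H]] Dw]; do ![split] => // i; rewrite /F.
      by case: ifP => [/H//|_]; case: eqP => // ->.
    move=> [? [? H]]; split; last first.
      by have := H (Ordinal tT); rewrite /F/= ltnn eqxx.
    do ![split] => // i it; have := H (Ordinal (ltn_trans it tT)).
    by rewrite /F/= it.
  have e2 : [set w | C1 (A w) /\ C2 (B w) /\
      forall i, (i < t)%N -> D' i (W i w)] =
      [set w | C1 (A w) /\ C2 (B w) /\ forall i : 'I_T, F setT i (W i w)].
    apply/seteqP; split => w /=.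
      move=> [? [? H]]; do ![split] => // i; rewrite /F.
      by case: ifP => [/H//|_]; case: eqP => // ->.
    move=> [? [? H]]; do ![split] => // i it.
    by have := H (Ordinal (ltn_trans it tT)); rewrite /F/= it.
  rewrite e1 e2 !hlaw//; [|exact: mF|exact: mF].
  rewrite (bigD1 (Ordinal tT))//= [in RHS](bigD1 (Ordinal tT))//=.
  rewrite /F/= ltnn eqxx integral_normal_pdf mul1e.
  rewrite muleCA; congr (_ * (_ * _))%E.
  apply: eq_bigr => i /negP it; rewrite (_ : (i == t :> nat) = false)//.
  by apply/negP => /eqP ie; apply: it; apply/eqP/val_inj.
- move=> k /=; rewrite /mrestr setTI.
  by rewrite (le_lt_trans (probability_le1 P mWD))// ltry.
Qed.

(** The identity map from [Omega] to its past sigma-algebra has with [W t] a product joint law, by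
    independence; Tonelli's theorem on this product isolates the noise. *)
Lemma noise_integral t (F : past t * TR -> \bar R) : (t < T)%N ->
  measurable_fun setT F -> (forall x, 0 <= F x)%E ->
  (\int[P]_w F (w, W t w) =
   \int[P]_w \int[leb]_y (F (w, y) * (normal_pdf 0 s y)%:E))%E.
Proof.
move=> tT mF F0.
pose toPast (w : Omega) : past t := w.
have mtoPast : measurable_fun setT toPast.
  by move=> _ E mE; rewrite setTI; exact: past_measurable mE.
pose X : {mfun Omega >-> past t} :=
  HB.pack toPast (isMeasurableFun.Build _ _ _ _ _ mtoPast).
pose joint (w : Omega) : past t * TR := (toPast w, W t w).
have mjoint : measurable_fun setT joint.
  by apply: (measurable_fun_pair mtoPast); exact: mW.
transitivity (\int[pushforward P joint]_x F x)%E.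
  by rewrite (ge0_integral_pushforward mjoint).
transitivity (\int[(distribution P X \x nu)%E]_x F x)%E.
  have uniq E : measurable E -> (distribution P X \x nu)%E E = pushforward P joint E.
  apply: (@product_measure_unique _ _ _ _ _ (distribution P X) nu
    (pushforward P joint)) => //.
  by move=> C D mC mD; exact: past_noise_indep.
  by apply: eq_measure_integral => E mE _; exact/esym/uniq.
rewrite fubini_tonelli1//.
rewrite (ge0_integral_pushforward mtoPast)//; last 2 first.
- exact: measurable_fun_fubini_tonelli_F.
- by move=> x _; apply: integral_ge0.
apply: eq_integral => w _ /=.
have F0w y : (0 <= (F \o pair w) y)%E by exact: F0.
rewrite -(ge0_integral_density leb (normal_pdf_ge0 0 s) (measurable_normal_pdf 0 s)
  (measurableT_comp mF (pair1_measurable _)) F0w).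
exact: eq_measure_integral.
Qed.

Lemma prior_integral (F : TR * TR -> \bar R) :
  measurable_fun setT F -> (forall x, 0 <= F x)%E ->
  (\int[P]_w F (A w, B w) =
   \int[leb \x leb]_x (F x * (gdens p11 p12 p22 q1 q2 x.1 x.2)%:E))%E.
Proof.
move=> mF F0.
have g0 (x : TR * TR) : 0 <= gdens p11 p12 p22 q1 q2 x.1 x.2.
  by apply/ltW/gdens_gt0.
have mgd : measurable_fun setT (fun x : TR * TR => gdens p11 p12 p22 q1 q2 x.1 x.2).
  by apply: measurable_gdens.
rewrite -(ge0_integral_density (leb \x leb)%E g0 mgd)//.
have mAB : measurable_fun setT (fun w => (A w, B w) : TR * TR) by exact: measurable_fun_pair.
rewrite -[LHS](ge0_integral_pushforward mAB P measurableT mF)//.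
apply: eq_measure_integral => E mE _.
apply: (@measure_unique _ _ _ [set C1 `*` C2 | C1 in measurable & C2 in measurable]
  (fun _ => setT)) => //.
- exact: measurable_prod_measurableType.
- move=> _ _ [C1 m1] [C2 m2] <- [C1' m1'] [C2' m2'] <-.
  exists (C1 `&` C1'); first exact: measurableI.
  by exists (C2 `&` C2'); [exact: measurableI|rewrite setXI].
- by move=> _; exists setT => //; exists setT => //; rewrite setXTT.
- by apply/seteqP; split => // w _; exists 0%N.
- move=> _ [C1 m1] [C2 m2] <-.
  have := hlaw m1 m2 (fun _ => measurableT : measurable (setT : set R)).
  rewrite big1 ?mule1; last by move=> i _; rewrite integral_normal_pdf.
  rewrite /pushforward (_ : mkset _ = (fun w => (A w, B w)) @^-1` (C1 `*` C2)).
    move=> e; apply: (eq_trans e).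
    rewrite [RHS]/(density_measure (leb \x leb)%E g0 mgd _) /density_measure.
    rewrite [RHS]integral_setE fubini_tonelli1; last 2 first.
    - apply: emeasurable_funM; last exact/measurable_EFinP.
      by apply/measurable_EFinP; apply: measurable_indic; exact: measurableX.
    - by move=> x; rewrite -EFinM lee_fin mulr_ge0.
    rewrite integral_setE; apply: eq_integral => a _.
    rewrite integral_setE -ge0_integralZl//; last 2 first.
    - apply: emeasurable_funM.
        by apply/measurable_EFinP; exact: measurable_indic.
      by apply/measurable_EFinP; apply: measurable_gdens.
    - move=> b _; rewrite -EFinM lee_fin mulr_ge0//.
      exact: (g0 (a, b)).
    apply: eq_integral => b _; rewrite -!EFinM; congr EFin; rewrite mulrA.
    congr (_ * _).
    by rewrite !indicE -natrM mulnb in_setX.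
  by apply/seteqP; split => w /=; tauto.
- move=> _; exact: (le_lt_trans (probability_le1 P measurableT) (ltry _)).
Qed.

Variable g : forall t : nat, 'rV[R]_t.+1 -> R.
Hypothesis hg : forall t : nat, (t < T)%N -> rV_measurable_fun (g (t := t)).

Local Notation X := (Xrv g A B W).
Local Notation Hist := (history g A B W).
Local Notation state := ((TR * TR) * trace R)%type.
Local Notation po := (post g Wv p11 p12 p22 q1 q2).
Local Notation pr := (predens g Wv p11 p12 p22 q1 q2).
Local Notation leb2 := (@lebesgue2 R).
Local Notation lik := (likelihood g Wv).

Definition full_state t (w : Omega) : state := ((A w, B w), Hist t w).

Let s_neq0 : s != 0. Proof. by rewrite gt_eqF// sqrtr_gt0. Qed.

Lemma measurable_full_state t : (t <= T)%N -> measurable_fun setT (full_state t).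
Proof.
move=> tT; apply: measurable_fun_pair; first exact: measurable_fun_pair.
by apply: (measurable_history hg) => // i _; exact: mW.
Qed.

Let lik_ge0 t q : 0 <= lik t q. Proof. exact: normal_pdf_ge0. Qed.

Let mlik t : (t < T)%N -> measurable_fun setT (lik t).
Proof. by move=> tT; exact: (measurable_likelihood W_gt0 hg tT). Qed.

(** The next state is the channel input, a function of the past, plus independent noise; translating
    Lebesgue measure by the channel input turns the noise density into the likelihood. *)
Lemma noise_step t (F : state * TR -> \bar R) : (t < T)%N ->
  measurable_fun setT F -> (forall x, 0 <= F x)%E ->
  (\int[P]_w F (full_state t w, X t.+1 w) =
   \int[P]_w \int[leb]_y
     (F (full_state t w, y) * (lik t (full_state t w, y))%:E))%E.
Proof.
move=> tT mF F0; have [mA' mB' mW'] := measurable_past t.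
have mH' : measurable_fun (setT : set (past t)) (Hist t).
  exact: (measurable_history hg mA' mB' (ltnW tT) mW').
have mV' : measurable_fun (setT : set (past t)) (full_state t).
  by apply: measurable_fun_pair => //; exact: measurable_fun_pair.
pose Y (w : past t) : R := A w * Hist t w t + B w * input g t (Hist t w).
have mY : measurable_fun setT Y.
  apply: measurable_funD; apply: measurable_funM => //.
    exact: (measurableT_comp (measurable_coord t) mH').
  exact: (measurableT_comp (measurable_input (hg tT)) mH').
pose F' (q : past t * TR) := F (full_state t q.1, Y q.1 + q.2).
have mF' : measurable_fun setT F'.
  have mg : measurable_fun setT
      (fun q : past t * TR => (full_state t q.1, Y q.1 + q.2) : state * TR).
    apply: measurable_fun_pair.
      exact: (measurableT_comp mV' measurable_fst).
    apply: measurable_funD; last exact: measurable_snd.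
    exact: (measurableT_comp mY measurable_fst).
  exact: (measurableT_comp mF mg).
transitivity (\int[P]_w F' (w, W t w))%E.
  by apply: eq_integral => w _; rewrite /F' /= XrvS.
rewrite (noise_integral tT mF'); last by move=> x; exact: F0.
apply: eq_integral => w _.
rewrite -[RHS](ge0_integral_translate (Y w)); last 2 first.
- apply: emeasurable_funM.
    exact: (measurableT_comp mF (pair1_measurable _)).
  apply/measurable_EFinP.
  exact: (measurableT_comp (mlik tT) (pair1_measurable _)).
- by move=> y; rewrite mule_ge0// lee_fin.
apply: eq_integral => y _; rewrite /F' /=; congr (_ * _%:E)%E.
exact/esym/normal_pdf_shift.
Qed.

(** Redrawing Theta from the density [po] given the history changes no expectation. This integral
    form says that [po] is a conditional density without constructing a conditional law. *)
Definition bayes t := forall F : state -> \bar R,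
  measurable_fun setT F -> (forall x, 0 <= F x)%E ->
  (\int[P]_w F (full_state t w) =
   \int[P]_w \int[leb2]_x (F (x, Hist t w) * (po t (Hist t w) x.1 x.2)%:E))%E.

Let po_ge0 t h a b : 0 <= po t h a b.
Proof. exact/ltW/post_gt0. Qed.

Let mpo t h : (t <= T)%N -> measurable_fun setT (fun x : TR * TR => po t h x.1 x.2).
Proof.
move=> tT; have mg : measurable_fun setT (fun x : TR * TR => (x, h) : state).
  by apply: measurable_fun_pair.
exact: (measurableT_comp (measurable_post Wv p11 p12 p22 q1 q2 hg tT) mg).
Qed.

(** Tonelli's theorem with [post_upd] under the integral: drawing Theta and then the next state
    amounts to drawing the next state from its predictive density and then Theta from the updated
    posterior. *)
Lemma predictive_fubini t (h : trace R) (F : (TR * TR) * TR -> \bar R) :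
  (t < T)%N -> measurable_fun setT F -> (forall x, 0 <= F x)%E ->
  (\int[leb2]_x ((\int[leb]_y (F (x, y) * (lik t ((x, h), y))%:E)) *
     (po t h x.1 x.2)%:E) =
   \int[leb]_y ((pr t h y)%:E *
     \int[leb2]_x (F (x, y) * (po t.+1 (upd h t.+1 y) x.1 x.2)%:E)))%E.
Proof.
move=> tT mF F0.
pose K (q : (TR * TR) * TR) : \bar R :=
  (F q * (lik t ((q.1, h), q.2) * po t h q.1.1 q.1.2)%:E)%E.
have mh : measurable_fun setT
    (fun q : (TR * TR) * TR => ((q.1, h), q.2) : state * TR).
  apply: measurable_fun_pair; last exact: measurable_snd.
  by apply: measurable_fun_pair => //; exact: measurable_fst.
have mlh := measurableT_comp (mlik tT) mh.
have mK : measurable_fun setT K.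
  apply: emeasurable_funM => //; apply/measurable_EFinP.
  apply: measurable_funM => //.
  exact: (measurableT_comp (mpo h (ltnW tT)) measurable_fst).
have K0 q : (0 <= K q)%E by rewrite mule_ge0// lee_fin mulr_ge0.
transitivity (\int[leb2]_x \int[leb]_y K (x, y))%E.
  apply: eq_integral => x _; rewrite -ge0_integralZr//; last 3 first.
  - apply: emeasurable_funM; first exact: (measurableT_comp mF (pair1_measurable _)).
    apply/measurable_EFinP; exact: (measurableT_comp mlh (pair1_measurable _)).
  - by move=> y _; rewrite mule_ge0// lee_fin.
  - by rewrite lee_fin.
  by apply: eq_integral => y _; rewrite -muleA -EFinM.
rewrite (fubini_tonelli (m1 := leb2) (m2 := leb) K mK K0).
apply: eq_integral => y _; rewrite -ge0_integralZl//; last 3 first.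
- apply: emeasurable_funM; first exact: (measurableT_comp mF (pair2_measurable _)).
  by apply/measurable_EFinP; exact: mpo.
- by move=> x _; rewrite mule_ge0// lee_fin.
- by rewrite lee_fin; exact/ltW/predens_gt0.
apply: eq_integral => x _; rewrite /K /likelihood /= post_upd//.
by rewrite muleCA EFinM.
Qed.

Lemma predictive_step t : (t < T)%N -> bayes t ->
  forall F : state * TR -> \bar R,
  measurable_fun setT F -> (forall x, 0 <= F x)%E ->
  (\int[P]_w F (full_state t w, X t.+1 w) =
   \int[P]_w \int[leb]_y ((pr t (Hist t w) y)%:E *
     \int[leb2]_x (F ((x, Hist t w), y) *
       (po t.+1 (upd (Hist t w) t.+1 y) x.1 x.2)%:E)))%E.
Proof.
move=> tT Ht F mF F0; rewrite noise_step//.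
have mFl : measurable_fun setT (fun q => F q * (lik t q)%:E)%E.
  by apply: emeasurable_funM => //; apply/measurable_EFinP; exact: mlik.
have Fl0 q : (0 <= F q * (lik t q)%:E)%E by rewrite mule_ge0// lee_fin.
pose F1 (p : state) := (\int[leb]_y (F (p, y) * (lik t (p, y))%:E))%E.
have mF1 : measurable_fun setT F1.
  exact: (measurable_fun_fubini_tonelli_F (m2 := leb) _ mFl Fl0).
have F10 p : (0 <= F1 p)%E by apply: integral_ge0 => y _; exact: Fl0.
rewrite (Ht F1 mF1 F10); apply: eq_integral => w _; move: (Hist t w) => h {w}.
pose Fh (q : (TR * TR) * TR) := F ((q.1, h), q.2).
have mh : measurable_fun setT
    (fun q : (TR * TR) * TR => ((q.1, h), q.2) : state * TR).
  apply: measurable_fun_pair; last exact: measurable_snd.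
  by apply: measurable_fun_pair => //; exact: measurable_fst.
have mFh : measurable_fun setT Fh by exact: (measurableT_comp mF mh).
have Fh0 q : (0 <= Fh q)%E by exact: F0.
exact: (predictive_fubini h tT mFh Fh0).
Qed.

Lemma integral_post2 t h : (t <= T)%N ->
  (\int[leb2]_x (po t h x.1 x.2)%:E = 1)%E.
Proof.
move=> tT; rewrite integral_lebesgue2; last 2 first.
- by apply/measurable_EFinP; exact: mpo.
- by move=> x; rewrite lee_fin.
exact: integral_post.
Qed.

(** Normalisation comes from [predictive_fubini] at the constant 1, the posteriors and the
    likelihood having integral 1; no closed form of the predictive density is computed. *)
Lemma integral_predens t h : (t < T)%N ->
  (\int[leb]_y (pr t h y)%:E = 1)%E.
Proof.
move=> tT; have := @predictive_fubini t h (cst 1%E) tT (measurable_cst _) _.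
move=> /(_ (fun _ => lee01)) e.
transitivity (\int[leb]_y ((pr t h y)%:E *
     \int[leb2]_x (1 * (po t.+1 (upd h t.+1 y) x.1 x.2)%:E)))%E.
  apply: eq_integral => y _; under eq_integral do rewrite mul1e.
  by rewrite integral_post2// mule1.
rewrite -[LHS]e; transitivity (\int[leb2]_x (po t h x.1 x.2)%:E)%E; last first.
  exact: (integral_post2 h (ltnW tT)).
apply: eq_integral => x _; rewrite -[RHS]mul1e; congr (_ * _)%E.
under eq_integral do rewrite mul1e.
exact (integral_normal_pdf (x.1 * h t + x.2 * input g t h) s).
Qed.

(** In the inductive step [F] and its posterior average [G F] are both expressed through the history
    at [t] by [step]. The results agree because [G F] does not depend on Theta and the posterior has
    mass 1. *)
Lemma bayesP t : (t <= T)%N -> bayes t.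
Proof.
elim: t => [_ F mF F0|t IH tT F mF F0].
  pose z : trace R := fun _ => 0.
  have h0 w : Hist 0 w = z.
    by apply/funext => i; rewrite /history; case: i.
  have mh : measurable_fun setT (fun x : TR * TR => (x, z) : state).
    by apply: measurable_fun_pair.
  pose Fz (x : TR * TR) := F (x, z).
  transitivity (\int[P]_w Fz (A w, B w))%E.
    by apply: eq_integral => w _; rewrite /full_state h0.
  have mFz : measurable_fun setT Fz by exact: (measurableT_comp mF mh).
  have Fz0 x : (0 <= Fz x)%E by exact: F0.
  rewrite (prior_integral mFz Fz0).
  under [RHS]eq_integral do rewrite h0.
  rewrite integral_cst// [X in (_ * X)%E]probability_setT mule1.
  by apply: eq_integral => x _; rewrite /post /J11 /J12 /J22 /E1 /E2 !big_ord0 !addr0.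
have mupd : measurable_fun setT
    (fun q : state * TR => (q.1.1, upd q.1.2 t.+1 q.2) : state).
  apply: measurable_fun_pair; first exact: (measurableT_comp measurable_fst measurable_fst).
  have mq : measurable_fun setT (fun q : state * TR => (q.1.2, q.2) : trace R * TR).
    apply: measurable_fun_pair; last exact: measurable_snd.
    exact: (measurableT_comp measurable_snd measurable_fst).
  exact: (measurableT_comp (measurable_upd t.+1) mq).
pose G (F : state -> \bar R) (h : trace R) :=
  (\int[leb2]_x (F (x, h) * (po t.+1 h x.1 x.2)%:E))%E.
have step (F' : state -> \bar R) : measurable_fun setT F' -> (forall x, 0 <= F' x)%E ->
    (\int[P]_w F' (full_state t.+1 w) =
     \int[P]_w \int[leb]_y ((pr t (Hist t w) y)%:E * G F' (upd (Hist t w) t.+1 y)))%E.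
  move=> mF' F'0.
  rewrite -(predictive_step tT (IH (ltnW tT)) (measurableT_comp mF' mupd)); last first.
    by move=> q; exact: F'0.
  by apply: eq_integral => w _; rewrite /full_state historyS.
have mG : measurable_fun setT (G F).
  pose K (q : trace R * (TR * TR)) := (F (q.2, q.1) * (po t.+1 q.1 q.2.1 q.2.2)%:E)%E.
  have ms : measurable_fun setT (fun q : trace R * (TR * TR) => (q.2, q.1) : state).
    exact: measurable_swap.
  have mK : measurable_fun setT K.
    apply: emeasurable_funM; first exact: (measurableT_comp mF ms).
    apply/measurable_EFinP.
    exact: (measurableT_comp (measurable_post Wv p11 p12 p22 q1 q2 hg tT) ms).
  have K0 q : (0 <= K q)%E by rewrite mule_ge0// lee_fin.
  exact: (measurable_fun_fubini_tonelli_F (m2 := leb2) _ mK K0).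
have G0 h : (0 <= G F h)%E.
  by apply: integral_ge0 => x _; rewrite mule_ge0// lee_fin.
transitivity (\int[P]_w G F (Hist t.+1 w))%E; last by [].
rewrite step// -[RHS]/(\int[P]_w (G F \o snd) (full_state t.+1 w))%E.
have mGs : measurable_fun setT (G F \o snd : state -> \bar R).
  exact: (measurableT_comp mG measurable_snd).
have G0s (x : state) : (0 <= (G F \o snd) x)%E by exact: G0.
rewrite [RHS](step _ mGs G0s).
apply: eq_integral => w _; apply: eq_integral => y _; congr (_ * _)%E.
rewrite [RHS]/G /= ge0_integralZl//; last 2 first.
- by apply/measurable_EFinP; exact: mpo.
- by move=> x _; rewrite lee_fin.
by rewrite integral_post2// mule1.
Qed.

End Law.

Section SigmaRV.
Context {R : realType} {d : measure_display} {Omega : measurableType d}.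

Lemma sigmaRV_measurable n (Xs : 'I_n -> Omega -> R) :
  (forall i, measurable_fun setT (Xs i)) -> sigmaRV Xs `<=` measurable.
Proof.
move=> mX; apply: smallest_sub; first exact: sigma_algebra_measurable.
by move=> _ [i [C [mC ->]]]; rewrite -[X in measurable X]setTI; exact: mX.
Qed.

Lemma sigmaRV_factor d' (S : measurableType d') (phi : Omega -> S) n
    (Xs : 'I_n -> Omega -> R) (fs : 'I_n -> S -> R) :
  (forall i, measurable_fun setT (fs i)) ->
  (forall i w, Xs i w = fs i (phi w)) ->
  forall E, sigmaRV Xs E -> exists2 E', measurable E' & E = phi @^-1` E'.
Proof.
move=> mf Xf; apply: smallest_sub.
- split.
  + by exists set0 => //; rewrite preimage_set0.
  + move=> _ [E' mE' ->]; exists (~` E'); first exact: measurableC.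
    by rewrite setTD preimage_setC.
  + move=> F HF; pose F' n := projT1 (cid2 (HF n)).
    exists (\bigcup_n F' n).
      by apply: bigcupT_measurable => k; rewrite /F'; case: cid2.
    rewrite preimage_bigcup; apply: eq_bigcup => // k _.
    by rewrite /F'; case: cid2.
- move=> _ [i [C [mC ->]]]; exists (fs i @^-1` C).
    by rewrite -[X in measurable X]setTI; exact: mf.
  by apply/seteqP; split => w /=; rewrite Xf.
Qed.

Lemma measurable_gen_sigmaRV (C : set (set Omega)) n (Xs : 'I_n -> Omega -> R) :
  sigmaRV Xs `<=` C ->
  forall i, measurable_fun (setT : set (g_sigma_algebraType C)) (Xs i).
Proof.
move=> XC i _ B mB; rewrite setTI; apply: sub_sigma_algebra; apply: XC.
by apply: sub_sigma_algebra; exists i, B.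
Qed.

End SigmaRV.

(** The relative entropies may be infinite, so the identity of logarithms is arranged with
    nonnegative terms on both sides; after integration only means equal to 1 are cancelled. *)
Lemma relentM d (T : measurableType d) (R : realType) (P : probability T R)
    (h k : T -> R) :
  (forall x, 0 < h x) -> (forall x, 0 < k x) ->
  measurable_fun setT h -> measurable_fun setT k ->
  (\int[P]_x (h x)%:E = 1)%E -> (\int[P]_x (k x)%:E = 1)%E ->
  (\int[P]_x (h x * k x)%:E = 1)%E ->
  relent P (fun x => h x * k x) = (relent P h + relent P k)%E.
Proof.
move=> h0 k0 mh mk ih ik ihk; have hk0 x : 0 < h x * k x by rewrite mulr_gt0.
have mhk : measurable_fun setT (fun x => h x * k x) by exact: measurable_funM.
have mloss (f : T -> R) : measurable_fun setT f ->
    measurable_fun setT (fun x => (f x - 1 - ln (f x))%:E).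
  move=> mf; apply/measurable_EFinP; apply: measurable_funB.
    exact: measurable_funB.
  exact: (measurableT_comp (@measurable_ln R)).
have l0 (f : T -> R) (f0 : forall x, 0 < f x) x : (0 <= (f x - 1 - ln (f x))%:E)%E.
  by rewrite lee_fin; exact: kl_loss_ge0.
have E0 (f : T -> R) (f0 : forall x, 0 < f x) x : (0 <= (f x)%:E)%E.
  by rewrite lee_fin ltW.
have D2 (f : T -> R) : (forall x, 0 < f x) -> measurable_fun setT f ->
    (\int[P]_x (f x)%:E = 1)%E -> forall a b : T -> \bar R,
    (forall x, 0 <= a x)%E -> (forall x, 0 <= b x)%E ->
    measurable_fun setT a -> measurable_fun setT b ->
    (\int[P]_x (a x + b x + (f x)%:E) = \int[P]_x a x + \int[P]_x b x + 1)%E.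
  move=> f0 mf if1 a b a0 b0 ma mb; rewrite ge0_integralD//.
  - by rewrite if1 ge0_integralD.
  - by move=> x _; rewrite adde_ge0.
  - exact: emeasurable_funD.
  - by move=> x _; exact: E0.
  - exact/measurable_EFinP.
have : (\int[P]_x ((h x * k x - 1 - ln (h x * k x))%:E + (h x)%:E + (k x)%:E) =
  \int[P]_x ((h x - 1 - ln (h x))%:E + ((k x - 1 - ln (k x))%:E + 1%:E) +
    (h x * k x)%:E))%E.
  apply: eq_integral => x _; rewrite -!EFinD; congr EFin.
  by rewrite lnM ?posrE//; ring.
rewrite D2//; last 4 first.
- exact: (l0 (fun x => h x * k x) hk0).
- exact: (E0 h h0).
- exact: (mloss (fun x => h x * k x) mhk).
- exact/measurable_EFinP.
rewrite D2//; last 4 first.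
- exact: (l0 h h0).
- by move=> x; rewrite adde_ge0//; exact: (l0 k k0).
- exact: (mloss h mh).
- by apply: emeasurable_funD => //; exact: (mloss k mk).
rewrite ge0_integralD//; last 2 first.
- by move=> x _; exact: (l0 k k0).
- exact: (mloss k mk).
rewrite integral_cst// [X in (_ * X)%E]probability_setT mule1 ih.
move/(congr1 (fun z => z - 1))%E; rewrite !addeK//.
by move/(congr1 (fun z => z - 1))%E; rewrite addeA !addeK.
Qed.

(** * Versions of conditional probabilities *)

Section ConditionalProbability.
Context (R : realType) (d : measure_display) (Omega : measurableType d).
Variables (P : probability Omega R) (G : set (set Omega)).
Local Notation H := (<<s G>>).
Local Notation OmegaH := (g_sigma_algebraType G).
Hypothesis mH : H `<=` measurable.

Lemma is_condprob_measurable E f : is_condprob P H E f ->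
  measurable_fun (setT : set OmegaH) f.
Proof. by move=> [_ mf _] _ B mB; rewrite setTI; exact: mf. Qed.

Lemma condprobP E f : is_condprob P H E f -> is_condprob P H E (condprob P H E).
Proof.
move=> fE; rewrite /condprob; case: pselect => [h|[]]; last by exists f.
exact: (proj2_sig (cid h)).
Qed.

Lemma is_condprob_eq_integral E (f f' : Omega -> R) :
  (forall x, 0 <= f x) -> (forall x, 0 <= f' x) ->
  measurable_fun setT f -> measurable_fun setT f' ->
  (forall C, H C -> \int[P]_(x in C) (f x)%:E = P (E `&` C))%E ->
  (forall C, H C -> \int[P]_(x in C) (f' x)%:E = P (E `&` C))%E ->
  forall k : OmegaH -> R, measurable_fun setT k -> (forall x, 0 <= k x) ->
  (\int[P]_x (k x * f x)%:E = \int[P]_x (k x * f' x)%:E)%E.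
Proof.
move=> f0 f'0 mf mf' fE f'E k mk k0.
have mid : measurable_fun setT (idfun : Omega -> OmegaH).
  by move=> _ B mB; rewrite setTI; exact: mH.
have := eq_integral_factor (mu := P) mid mf mf' f0 f'0.
move=> /(_ _ (EFin \o k)); apply; last by move=> x; rewrite lee_fin.
  by move=> C HC; rewrite !preimage_id fE// f'E.
exact/measurable_EFinP.
Qed.

(** The versions inside [condprob] are picked by choice and known only through moments against
    functions measurable for [H]. The one of [b] is exchanged for [psib] against [\1_c] times the
    one of [a]; then the one of [a] is exchanged for [\1_a] against [\1_c * psib]. *)
Lemma integral_condprob_mul a b c psia psib :
  measurable a -> H c -> is_condprob P H a psia -> is_condprob P H b psib ->
  (\int[P]_(x in c) (condprob P H a x * condprob P H b x)%:E =
   \int[P]_(x in a `&` c) (psib x)%:E)%E.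
Proof.
move=> ma Hc ha hb.
have [pa01 pam paE] := condprobP ha; have [pb01 pbm pbE] := condprobP hb.
have [q01 qm qE] := hb.
have mHf (f : OmegaH -> R) : measurable_fun setT f ->
    measurable_fun (setT : set Omega) f.
  by move=> mf _ B mB; rewrite setTI; apply: mH; have := mf measurableT B mB; rewrite setTI.
have Mpa := is_condprob_measurable (condprobP ha).
have Mpb := is_condprob_measurable (condprobP hb).
have Mq := is_condprob_measurable hb.
have ge0 (f : Omega -> R) : (forall x, 0 <= f x <= 1) -> forall x, 0 <= f x.
  by move=> f01 x; have /andP[] := f01 x.
have mc : measurable_fun (setT : set OmegaH) (\1_c : Omega -> R).
  exact: (@measurable_indic _ OmegaH R setT c).
transitivity (\int[P]_x ((\1_c x * condprob P H a x) * condprob P H b x)%:E)%E.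
  by rewrite integral_setE; apply: eq_integral => x _; rewrite -EFinM mulrA.
rewrite (is_condprob_eq_integral (ge0 _ pb01) (ge0 _ q01) (mHf _ Mpb) (mHf _ Mq) pbE qE
  (k := fun x => \1_c x * condprob P H a x)); last 2 first.
- exact: measurable_funM.
- by move=> x; rewrite mulr_ge0//; exact: ge0.
transitivity (\int[P]_x ((\1_c x * psib x) * condprob P H a x)%:E)%E.
  by apply: eq_integral => x _; rewrite mulrAC.
rewrite (is_condprob_eq_integral (f' := \1_a) (ge0 _ pa01) _ (mHf _ Mpa) _ paE _
  (k := fun x => \1_c x * psib x)) => [|x||C HC||x].
- rewrite [RHS]integral_setE; apply: eq_integral => x _.
  rewrite -EFinM; congr EFin; rewrite mulrAC; congr (_ * _).
  by rewrite !indicE -natrM mulnb in_setI andbC.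
- by rewrite indicE.
- exact: measurable_indic.
- by rewrite integral_indic//; exact: mH.
- exact: measurable_funM.
- by rewrite mulr_ge0//; exact: ge0.
Qed.

End ConditionalProbability.

(** * Information densities of the closed loop *)

Section Identification.
Context (R : realType) (d : measure_display) (Omega : measurableType d).
Variables (P : probability Omega R) (T : nat) (Wv : R).
Variables (p11 p12 p22 q1 q2 : R).
Hypotheses (W_gt0 : 0 < Wv) (p22_gt0 : 0 < p22) (det_gt0 : 0 < gdet p11 p12 p22).
Variables (A B : Omega -> R) (W : nat -> Omega -> R).
Hypotheses (mA : measurable_fun setT A) (mB : measurable_fun setT B).
Hypothesis mW : forall t, measurable_fun setT (W t).
Hypothesis hlaw : forall (C1 C2 : set R) (D : 'I_T -> set R),
  measurable C1 -> measurable C2 -> (forall t, measurable (D t)) ->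
  P [set w | C1 (A w) /\ C2 (B w) /\ forall t : 'I_T, D t (W t w)] =
  ((\int[lebesgue_measure]_(a in C1) \int[lebesgue_measure]_(b in C2)
       (gdens p11 p12 p22 q1 q2 a b)%:E) *
   \prod_(t < T) \int[lebesgue_measure]_(x in D t)
       (normal_pdf 0 (Num.sqrt Wv) x)%:E)%E.
Variable g : forall t : nat, 'rV[R]_t.+1 -> R.
Hypothesis hg : forall t : nat, (t < T)%N -> rV_measurable_fun (g (t := t)).

Local Notation s := (Num.sqrt Wv).
Local Notation leb := (@lebesgue_measure R).
Local Notation leb2 := (@lebesgue2 R).
Local Notation TR := (measurableTypeR R).
Local Notation X := (Xrv g A B W).
Local Notation Hist := (history g A B W).
Local Notation full := (full_state A B W g).
Local Notation state := ((TR * TR) * trace R)%type.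
Local Notation po := (post g Wv p11 p12 p22 q1 q2).
Local Notation pr := (predens g Wv p11 p12 p22 q1 q2).
Local Notation lik := (likelihood g Wv).
Local Notation gd := (gdens p11 p12 p22 q1 q2).

Let bayesT t : (t <= T)%N -> bayes P Wv p11 p12 p22 q1 q2 A B W g t.
Proof. exact: (bayesP W_gt0 p22_gt0 det_gt0 mA mB mW hlaw hg). Qed.

Let po_gt0 t h a b : 0 < po t h a b. Proof. exact: post_gt0. Qed.
Let pr_gt0 t h y : 0 < pr t h y. Proof. exact: predens_gt0. Qed.
Let lik_gt0 t q : 0 < lik t q. Proof. exact: likelihood_gt0. Qed.
Let gd_gt0 a b : 0 < gd a b. Proof. exact: gdens_gt0. Qed.

Let mpo t : (t <= T)%N -> measurable_fun setT (fun q : state => po t q.2 q.1.1 q.1.2).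
Proof. exact: measurable_post. Qed.

Let mpr t : (t < T)%N -> measurable_fun setT (fun p : trace R * TR => pr t p.1 p.2).
Proof. exact: measurable_predens. Qed.

Let mlik t : (t < T)%N -> measurable_fun setT (lik t).
Proof. exact: measurable_likelihood. Qed.

Let mgd : measurable_fun setT (fun x : TR * TR => gd x.1 x.2).
Proof. by apply: measurable_gdens. Qed.

Let mHist t : (t <= T)%N -> measurable_fun setT (Hist t).
Proof. by move=> tT; apply: (measurable_history hg) => // i _; exact: mW. Qed.

Let mfull t : (t <= T)%N -> measurable_fun setT (full t).
Proof. exact: measurable_full_state. Qed.

Let mX t : (t <= T)%N -> measurable_fun setT (X t).
Proof.
move=> tT; rewrite (_ : X t = (fun h : trace R => h t) \o Hist t).
  exact: (measurableT_comp (measurable_coord t) (mHist tT)).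
by apply/funext => w; rewrite /= history_le.
Qed.

Let mAB : measurable_fun setT (fun w => (A w, B w) : TR * TR).
Proof. exact: measurable_fun_pair. Qed.

Let integral_indicT (E : set Omega) : measurable E ->
  (\int[P]_w (\1_E w)%:E = P E)%E.
Proof. by move=> mE; rewrite -[in RHS](setIT E) -integral_indic. Qed.

Let mpreim d' (T' : measurableType d') (f : Omega -> T') (E : set T') :
  measurable_fun setT f -> measurable E -> measurable (f @^-1` E).
Proof. by move=> mf mE; rewrite -[X in measurable X]setTI; exact: mf. Qed.

(* [P_Theta / P_{Theta | X^t}] evaluated at the data; its reciprocal is the
   density of the joint law of [Theta] and [X^t] with respect to the product of
   the marginals. *)
Definition prior_post t (w : Omega) : R := gd (A w) (B w) / po t (Hist t w) (A w) (B w).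

Definition pred_lik t (w : Omega) : R :=
  pr t (Hist t w) (X t.+1 w) / lik t (full t w, X t.+1 w).

Lemma prior_postS t w : prior_post t.+1 w = prior_post t w * pred_lik t w.
Proof.
rewrite /prior_post /pred_lik historyS.
have : lik t (full t w, X t.+1 w) * po t (Hist t w) (A w) (B w) =
    pr t (Hist t w) (X t.+1 w) *
    po t.+1 (upd (Hist t w) t.+1 (X t.+1 w)) (A w) (B w).
  exact (post_upd g q1 q2 W_gt0 p22_gt0 det_gt0 t (Hist t w) (X t.+1 w) (A w) (B w)).
have := po_gt0 t (Hist t w) (A w) (B w).
have := po_gt0 t.+1 (upd (Hist t w) t.+1 (X t.+1 w)) (A w) (B w).
have := lik_gt0 t (full t w, X t.+1 w).
move: (po t _ _ _) (po t.+1 _ _ _) (lik _ _) (pr _ _ _) (gd _ _) => u v l p z l0 v0 u0 e.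
have -> : p = l * u / v by rewrite e mulfK// gt_eqF.
by field; rewrite !gt_eqF.
Qed.

Lemma prior_post0 w : prior_post 0 w = 1.
Proof.
rewrite /prior_post /post /J11 /J12 /J22 /E1 /E2 !big_ord0 !addr0 divff//.
by rewrite gt_eqF.
Qed.

Lemma prior_post_gt0 t w : 0 < prior_post t w.
Proof. by rewrite divr_gt0. Qed.

Lemma pred_lik_gt0 t w : 0 < pred_lik t w.
Proof. by rewrite divr_gt0. Qed.

Lemma measurable_prior_post t : (t <= T)%N -> measurable_fun setT (prior_post t).
Proof.
move=> tT; apply: measurable_funM; first exact: (measurableT_comp mgd mAB).
apply: (measurableT_comp (@measurable_inv R)).
exact: (measurableT_comp (mpo tT) (mfull tT)).
Qed.

Lemma measurable_pred_lik t : (t < T)%N -> measurable_fun setT (pred_lik t).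
Proof.
move=> tT; apply: measurable_funM.
  have m2 : measurable_fun setT (fun w => (Hist t w, X t.+1 w) : trace R * TR).
    by apply: measurable_fun_pair; [exact: mHist (ltnW tT)|exact: mX].
  exact: (measurableT_comp (mpr tT) m2).
apply: (measurableT_comp (@measurable_inv R)).
have m2 : measurable_fun setT (fun w => (full t w, X t.+1 w) : state * TR).
  by apply: measurable_fun_pair; [exact: mfull (ltnW tT)|exact: mX].
exact: (measurableT_comp (mlik tT) m2).
Qed.

(** Redrawing Theta from the posterior cancels the denominator of [prior_post], which leaves the
    prior mass of [a] whatever the history: under the new measure Theta and the path are
    independent. *)
Lemma integral_prior_post t (a : set (TR * TR)) (b : set (trace R)) :
  (t <= T)%N -> measurable a -> measurable b ->
  (\int[P]_(w in (fun w => (A w, B w)) @^-1` a `&` Hist t @^-1` b)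
     (prior_post t w)%:E =
   P ((fun w => (A w, B w)) @^-1` a) * P (Hist t @^-1` b))%E.
Proof.
move=> tT ma mb.
have mia : measurable_fun setT (\1_a : TR * TR -> R) by exact: measurable_indic.
have mib : measurable_fun setT (\1_b : trace R -> R) by exact: measurable_indic.
pose F (q : state) : \bar R :=
  (\1_a q.1 * \1_b q.2 * (gd q.1.1 q.1.2 / po t q.2 q.1.1 q.1.2))%:E.
have mF : measurable_fun setT F.
  apply/measurable_EFinP; apply: measurable_funM.
    apply: measurable_funM; first exact: (measurableT_comp mia measurable_fst).
    exact: (measurableT_comp mib measurable_snd).
  apply: measurable_funM; first exact: (measurableT_comp mgd measurable_fst).
  by apply: (measurableT_comp (@measurable_inv R)); exact: mpo.
have F0 q : (0 <= F q)%E.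
  by rewrite lee_fin; apply: mulr_ge0; [exact: mulr_ge0|exact/ltW/divr_gt0].
transitivity (\int[P]_w F (full t w))%E.
  rewrite integral_setE; apply: eq_integral => w _; rewrite -EFinM; congr EFin.
  by congr (_ * _); rewrite !indicE -natrM mulnb in_setI.
rewrite (bayesT tT mF F0).
have mprod : measurable_fun setT (fun x : TR * TR => (\1_a x * gd x.1 x.2)%:E : \bar R).
  by apply/measurable_EFinP; exact: measurable_funM.
have prod0 (x : TR * TR) : (0 <= (\1_a x * gd x.1 x.2)%:E)%E.
  by rewrite lee_fin mulr_ge0// ltW.
pose K := (\int[leb2]_x (\1_a x * gd x.1 x.2)%:E)%E.
have KE : K = P ((fun w => (A w, B w)) @^-1` a).
  have := prior_integral det_gt0 mA mB hlaw (F := fun x => (\1_a x)%:E).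
  move=> /(_ _ (fun x => _)) e.
  transitivity (\int[P]_w (\1_a (A w, B w))%:E)%E.
    rewrite e; [|exact/measurable_EFinP|by []].
    by apply: eq_integral => x _; rewrite EFinM.
  by rewrite -(integral_indicT (mpreim mAB ma)).
transitivity (\int[P]_w ((\1_b (Hist t w))%:E * K))%E.
  apply: eq_integral => w _; rewrite -ge0_integralZl//.
  apply: eq_integral => x _; rewrite /F -!EFinM; congr EFin => /=.
  by field; rewrite gt_eqF.
have K0 : (0 <= K)%E by exact: integral_ge0.
rewrite ge0_integralZr//; last first.
  by apply/measurable_EFinP; exact: (measurableT_comp mib (mHist tT)).
by rewrite KE muleC -(integral_indicT (mpreim (mHist tT) mb)).
Qed.

Lemma integral_prior_post1 t : (t <= T)%N -> (\int[P]_w (prior_post t w)%:E = 1)%E.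
Proof.
move=> tT; have := integral_prior_post tT measurableT measurableT.
by rewrite !preimage_setT setIT [X in (X * _)%E]probability_setT
  [X in (_ * X)%E]probability_setT mule1.
Qed.

Definition predprob t (C : set R) (h : trace R) : R :=
  fine (\int[leb]_y (\1_C y * pr t h y)%:E)%E.

Lemma predprobE t C h : (t < T)%N -> measurable C ->
  ((predprob t C h)%:E = \int[leb]_y (\1_C y * pr t h y)%:E)%E /\
  0 <= predprob t C h <= 1.
Proof.
move=> tT mC.
have i0 : (0 <= \int[leb]_y (\1_C y * pr t h y)%:E)%E.
  by apply: integral_ge0 => y _; rewrite lee_fin mulr_ge0// ltW.
have mprh : measurable_fun setT (fun y : TR => pr t h y).
  have m2 : measurable_fun setT (fun y : TR => (h, y)) by exact: measurable_fun_pair.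
  exact: (measurableT_comp (mpr tT) m2).
have i1 : (\int[leb]_y (\1_C y * pr t h y)%:E <= 1)%E.
  rewrite -(integral_predens q1 q2 W_gt0 p22_gt0 det_gt0 hg h tT).
  apply: ge0_le_integral => //.
  - by move=> y _; rewrite lee_fin mulr_ge0// ltW.
  - apply/measurable_EFinP; apply: measurable_funM => //; exact: measurable_indic.
  - exact/measurable_EFinP.
  - move=> y _; rewrite lee_fin; apply: ler_piMl; first exact/ltW.
    by rewrite indicE; case: (_ \in _).
have ifin : (\int[leb]_y (\1_C y * pr t h y)%:E)%E \is a fin_num.
  by rewrite ge0_fin_numE// (le_lt_trans i1)// ltry.
have pE : ((predprob t C h)%:E = \int[leb]_y (\1_C y * pr t h y)%:E)%E by rewrite fineK.
by split=> //; rewrite -!lee_fin pE i0 i1.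
Qed.

Lemma measurable_predprob t C : (t < T)%N -> measurable C ->
  measurable_fun setT (predprob t C).
Proof.
move=> tT mC; apply: (measurableT_comp (fine_measurable measurableT)).
have mK : measurable_fun setT (fun p : trace R * TR => (\1_C p.2 * pr t p.1 p.2)%:E : \bar R).
  apply/measurable_EFinP; apply: measurable_funM; last exact: mpr.
  have mi : measurable_fun setT (\1_C : TR -> R) by exact: measurable_indic.
  exact: (measurableT_comp mi measurable_snd).
apply: (measurable_fun_fubini_tonelli_F (m2 := leb) _ mK) => p.
by rewrite lee_fin mulr_ge0// ltW.
Qed.

(** Integrating the next state against its likelihood cancels the denominator of [pred_lik]: under
    the new measure it is drawn from the predictive density, independently of Theta given the
    history. *)
Lemma integral_pred_lik t (E : set state) (C : set R) :
  (t < T)%N -> measurable E -> measurable C ->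
  (\int[P]_(w in full t @^-1` E `&` X t.+1 @^-1` C) (pred_lik t w)%:E =
   \int[P]_(w in full t @^-1` E) (predprob t C (Hist t w))%:E)%E.
Proof.
move=> tT mE mC.
have miE : measurable_fun setT (\1_E : state -> R) by exact: measurable_indic.
have miC : measurable_fun setT (\1_C : TR -> R) by exact: measurable_indic.
have mpr' : measurable_fun setT (fun q : state * TR => pr t q.1.2 q.2).
  have m2 : measurable_fun setT (fun q : state * TR => (q.1.2, q.2) : trace R * TR).
    apply: measurable_fun_pair; last exact: measurable_snd.
    exact: (measurableT_comp measurable_snd measurable_fst).
  exact: (measurableT_comp (mpr tT) m2).
pose F (q : state * TR) : \bar R := (\1_E q.1 * \1_C q.2 * (pr t q.1.2 q.2 / lik t q))%:E.
have mF : measurable_fun setT F.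
  apply/measurable_EFinP; apply: measurable_funM.
    apply: measurable_funM; first exact: (measurableT_comp miE measurable_fst).
    exact: (measurableT_comp miC measurable_snd).
  apply: measurable_funM => //.
  by apply: (measurableT_comp (@measurable_inv R)); exact: mlik.
have F0 q : (0 <= F q)%E.
  by rewrite lee_fin; apply: mulr_ge0; [exact: mulr_ge0|exact/ltW/divr_gt0].
transitivity (\int[P]_w F (full t w, X t.+1 w))%E.
  rewrite integral_setE; apply: eq_integral => w _; rewrite -EFinM; congr EFin.
  by congr (_ * _); rewrite !indicE -natrM mulnb in_setI.
rewrite (noise_step W_gt0 mA mB mW hlaw hg tT mF F0).
rewrite [RHS]integral_setE; apply: eq_integral => w _.
have [-> _] := predprobE (Hist t w) tT mC.
rewrite -ge0_integralZl//; last 2 first.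
- have m2 : measurable_fun setT (fun y : TR => (full t w, y)) by exact: measurable_fun_pair.
  apply/measurable_EFinP; apply: measurable_funM => //.
  exact: (measurableT_comp mpr' m2).
- by move=> y _; rewrite lee_fin mulr_ge0// ltW.
apply: eq_integral => y _; rewrite /F -!EFinM; congr EFin => /=.
by field; rewrite gt_eqF.
Qed.

Lemma integral_pred_lik1 t : (t < T)%N -> (\int[P]_w (pred_lik t w)%:E = 1)%E.
Proof.
move=> tT; have := integral_pred_lik tT measurableT measurableT.
rewrite !preimage_setT setIT => ->.
rewrite (eq_integral (cst 1%E)); last first.
  move=> w _; rewrite (proj1 (predprobE (Hist t w) tT measurableT)).
  rewrite -[RHS](integral_predens q1 q2 W_gt0 p22_gt0 det_gt0 hg (Hist t w) tT).
  by apply: eq_integral => y _; rewrite indicT mul1r.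
by rewrite integral_cst// mul1e [LHS]probability_setT.
Qed.

Definition postprob t (E : set state) (h : trace R) : R :=
  fine (\int[leb2]_x (\1_E (x, h) * po t h x.1 x.2)%:E)%E.

Let mpoh t h : (t <= T)%N -> measurable_fun setT (fun x : TR * TR => po t h x.1 x.2).
Proof.
move=> tT; have m2 : measurable_fun setT (fun x : TR * TR => (x, h) : state).
  by apply: measurable_fun_pair.
exact: (measurableT_comp (mpo tT) m2).
Qed.

Let mindich (E : set state) h : measurable E ->
  measurable_fun setT (fun x : TR * TR => \1_E (x, h) : R).
Proof.
move=> mE; have m2 : measurable_fun setT (fun x : TR * TR => (x, h) : state).
  by apply: measurable_fun_pair.
have mi : measurable_fun setT (\1_E : state -> R) by exact: measurable_indic.
exact: (measurableT_comp mi m2).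
Qed.

Lemma postprobE t E h : (t <= T)%N -> measurable E ->
  ((postprob t E h)%:E = \int[leb2]_x (\1_E (x, h) * po t h x.1 x.2)%:E)%E /\
  0 <= postprob t E h <= 1.
Proof.
move=> tT mE.
have i0 : (0 <= \int[leb2]_x (\1_E (x, h) * po t h x.1 x.2)%:E)%E.
  by apply: integral_ge0 => y _; rewrite lee_fin mulr_ge0// ltW.
have i1 : (\int[leb2]_x (\1_E (x, h) * po t h x.1 x.2)%:E <= 1)%E.
  rewrite -(integral_post2 q1 q2 W_gt0 p22_gt0 det_gt0 hg h tT).
  apply: ge0_le_integral => //.
  - by move=> y _; rewrite lee_fin mulr_ge0// ltW.
  - by apply/measurable_EFinP; apply: measurable_funM; [exact: mindich|exact: mpoh].
  - by apply/measurable_EFinP; exact: mpoh.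
  - move=> y _; rewrite lee_fin; apply: ler_piMl; first exact/ltW.
    by rewrite indicE; case: (_ \in _).
have ifin : (\int[leb2]_x (\1_E (x, h) * po t h x.1 x.2)%:E)%E \is a fin_num.
  by rewrite ge0_fin_numE// (le_lt_trans i1)// ltry.
have pE : ((postprob t E h)%:E = \int[leb2]_x (\1_E (x, h) * po t h x.1 x.2)%:E)%E.
  by rewrite fineK.
by split=> //; rewrite -!lee_fin pE i0 i1.
Qed.

Lemma measurable_postprob t E : (t <= T)%N -> measurable E ->
  measurable_fun setT (postprob t E).
Proof.
move=> tT mE; apply: (measurableT_comp (fine_measurable measurableT)).
have ms : measurable_fun setT (fun q : trace R * (TR * TR) => (q.2, q.1) : state).
  exact: measurable_swap.
have mi : measurable_fun setT (\1_E : state -> R) by exact: measurable_indic.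
have mK : measurable_fun setT (fun q : trace R * (TR * TR) =>
    (\1_E (q.2, q.1) * po t q.1 q.2.1 q.2.2)%:E : \bar R).
  apply/measurable_EFinP; apply: measurable_funM; first exact: (measurableT_comp mi ms).
  exact: (measurableT_comp (mpo tT) ms).
apply: (measurable_fun_fubini_tonelli_F (m2 := leb2) _ mK) => p.
by rewrite lee_fin mulr_ge0// ltW.
Qed.

Local Notation sigX t := (sigmaRV (fun i : 'I_t.+1 => X i)).

Lemma sigX_factor t E : sigX t E -> exists2 E', measurable E' & E = Hist t @^-1` E'.
Proof.
apply: (sigmaRV_factor (fs := fun (i : 'I_t.+1) (h : trace R) => h i)).
  by move=> i; exact: measurable_coord.
by move=> i w; rewrite history_le// -ltnS.
Qed.

Lemma sigX_preimage t E' : measurable E' -> sigX t (Hist t @^-1` E').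
Proof.
pose G := [set S | exists (i : 'I_t.+1) (C : set R), measurable C /\ S = X i @^-1` C].
have mH : measurable_fun (setT : set (g_sigma_algebraType G)) (Hist t).
  apply: measurable_trace => i; rewrite /history; case it : (i <= t)%N => //.
  move=> _ C mC; rewrite setTI; apply: sub_sigma_algebra.
  by exists (Ordinal (it : (i < t.+1)%N)), C.
by move=> mE; have := mH measurableT _ mE; rewrite setTI.
Qed.

Lemma sigX_measurable t : (t <= T)%N -> sigX t `<=` measurable.
Proof.
move=> tT; apply: sigmaRV_measurable => i; apply: mX.
by apply: leq_trans tT; rewrite -ltnS.
Qed.

Lemma is_condprob_next t C : (t < T)%N -> measurable C ->
  is_condprob P (sigX t) (X t.+1 @^-1` C) (fun w => predprob t C (Hist t w)).
Proof.
move=> tT mC; split.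
- by move=> w; have [_] := predprobE (Hist t w) tT mC.
- move=> D mD; apply: (sigX_preimage (E' := predprob t C @^-1` D)).
  by rewrite -[X in measurable X]setTI; exact: measurable_predprob.
- move=> _ /sigX_factor[E' mE' ->].
  have miE : measurable_fun setT (\1_E' : trace R -> R) by exact: measurable_indic.
  have miC : measurable_fun setT (\1_C : TR -> R) by exact: measurable_indic.
  pose F (q : state * TR) : \bar R := (\1_C q.2 * \1_E' q.1.2)%:E.
  have mF : measurable_fun setT F.
    apply/measurable_EFinP; apply: measurable_funM.
      exact: (measurableT_comp miC measurable_snd).
    apply: (measurableT_comp miE).
    exact: (measurableT_comp measurable_snd measurable_fst).
  have F0 q : (0 <= F q)%E by rewrite lee_fin mulr_ge0.
  transitivity (\int[P]_w F (full t w, X t.+1 w))%E; last first.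
    rewrite -(integral_indicT (measurableI _ _ (mpreim (mX tT) mC) (mpreim (mHist (ltnW tT)) mE'))).
    by apply: eq_integral => w _; rewrite /F; congr EFin;
      rewrite !indicE -natrM mulnb in_setI.
  rewrite (predictive_step W_gt0 p22_gt0 det_gt0 mA mB mW hlaw hg tT (bayesT (ltnW tT)) mF F0).
  rewrite integral_setE; apply: eq_integral => w _.
  have [-> _] := predprobE (Hist t w) tT mC.
  have m2 : measurable_fun setT (fun y : TR => pr t (Hist t w) y).
    have m3 : measurable_fun setT (fun y : TR => (Hist t w, y)) by exact: measurable_fun_pair.
    exact: (measurableT_comp (mpr tT) m3).
  rewrite -ge0_integralZl//; last 2 first.
  - by apply/measurable_EFinP; exact: measurable_funM.
  - by move=> y _; rewrite lee_fin mulr_ge0// ltW.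
  apply: eq_integral => y _; rewrite /F /=.
  rewrite ge0_integralZl//; last 2 first.
  - by apply/measurable_EFinP; exact: mpoh.
  - by move=> x _; rewrite lee_fin ltW.
  rewrite (integral_post2 q1 q2 W_gt0 p22_gt0 det_gt0 hg _ tT) mule1 -!EFinM.
  by congr EFin; ring.
Qed.

Lemma is_condprob_past t E : (t <= T)%N -> measurable E ->
  is_condprob P (sigX t) (full t @^-1` E) (fun w => postprob t E (Hist t w)).
Proof.
move=> tT mE; split.
- by move=> w; have [_] := postprobE (Hist t w) tT mE.
- move=> D mD; apply: (sigX_preimage (E' := postprob t E @^-1` D)).
  by rewrite -[X in measurable X]setTI; exact: measurable_postprob.
- move=> _ /sigX_factor[E' mE' ->].
  have miE : measurable_fun setT (\1_E : state -> R) by exact: measurable_indic.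
  have miE' : measurable_fun setT (\1_E' : trace R -> R) by exact: measurable_indic.
  pose F (q : state) : \bar R := (\1_E q * \1_E' q.2)%:E.
  have mF : measurable_fun setT F.
    apply/measurable_EFinP; apply: measurable_funM => //.
    exact: (measurableT_comp miE' measurable_snd).
  have F0 q : (0 <= F q)%E by rewrite lee_fin mulr_ge0.
  transitivity (\int[P]_w F (full t w))%E; last first.
    rewrite -(integral_indicT (measurableI _ _ (mpreim (mfull tT) mE) (mpreim (mHist tT) mE'))).
    by apply: eq_integral => w _; rewrite /F; congr EFin;
      rewrite !indicE -natrM mulnb in_setI.
  rewrite (bayesT tT mF F0) integral_setE; apply: eq_integral => w _.
  have [-> _] := postprobE (Hist t w) tT mE.
  rewrite -ge0_integralZl//; last 2 first.
  - by apply/measurable_EFinP; apply: measurable_funM; [exact: mindich|exact: mpoh].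
  - by move=> y _; rewrite lee_fin mulr_ge0// ltW.
  apply: eq_integral => x _; rewrite /F /= -!EFinM.
  by congr EFin; ring.
Qed.


Local Notation sigTheta := (sigmaRV (fun i : 'I_2 => if i == ord0 then A else B)).

Let measurable_gen_Hist (C : set (set Omega)) t : sigX t `<=` C ->
  measurable_fun (setT : set (g_sigma_algebraType C)) (Hist t).
Proof.
move=> HC; apply: measurable_trace => i; rewrite /history; case it : (i <= t)%N => //.
exact: (measurable_gen_sigmaRV HC (Ordinal (it : (i < t.+1)%N))).
Qed.

Lemma MI_prior_post t : (t <= T)%N ->
  MI P sigTheta (sigX t) = ((ln 2)^-1%:E * relent P (prior_post t))%E.
Proof.
move=> tT.
have mS : sigTheta `<=` measurable by apply: sigmaRV_measurable => i; case: ifP.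
apply: MI_relent => //.
- exact: prior_post_gt0.
- exact: measurable_prior_post.
- exact: integral_prior_post1.
- exact: smallest_sigma_algebra.
- exact: smallest_sigma_algebra.
- exact: sigX_measurable.
- pose C := sigTheta `|` sigX t; move=> D mD.
  have mAB' i := measurable_gen_sigmaRV (@subsetUl _ sigTheta (sigX t) : sigTheta `<=` C) i.
  have mA' : measurable_fun (setT : set (g_sigma_algebraType C)) A by exact: (mAB' ord0).
  have mB' : measurable_fun (setT : set (g_sigma_algebraType C)) B.
    exact: (mAB' (Ordinal (isT : 1 < 2)%N)).
  have mH' := measurable_gen_Hist (@subsetUr _ sigTheta (sigX t) : sigX t `<=` C).
  have mAB2 : measurable_fun (setT : set (g_sigma_algebraType C))
      (fun w => (A w, B w) : TR * TR) by exact: measurable_fun_pair.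
  have mf : measurable_fun (setT : set (g_sigma_algebraType C)) (full t).
    exact: measurable_fun_pair.
  have mp : measurable_fun (setT : set (g_sigma_algebraType C)) (prior_post t).
    apply: measurable_funM; first exact: (measurableT_comp mgd mAB2).
    apply: (measurableT_comp (@measurable_inv R)).
    exact: (measurableT_comp (mpo tT) mf).
  by have := mp measurableT D mD; rewrite setTI.
- move=> a b Fa /sigX_factor[b' mb' ->].
  have [a' ma' ->] : exists2 a', measurable a' & a = (fun w => (A w, B w) : TR * TR) @^-1` a'.
    apply: (sigmaRV_factor (fs := fun (i : 'I_2) (x : TR * TR) =>
      if i == ord0 then x.1 else x.2)) Fa => i.
      by case: (i == ord0); [exact: measurable_fst|exact: measurable_snd].
    by move=> w; case: (i == ord0).
  rewrite /Rintegral integral_prior_post// /Pr fineM//; apply: fin_num_measure.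
    exact: (mpreim mAB ma').
  exact: (mpreim (mHist tT) mb').
Qed.

Local Notation sigY t := (sigmaRV (fun i : 'I_t.+1 => Yrv g A B W i.+1)).
Local Notation sigX1 t := (sigmaRV (fun _ : 'I_1 => X t.+1)).

Let mchannel t (i : 'I_t.+1) : (t < T)%N -> measurable_fun setT
  (fun q : state => q.1.1 * q.2 i + q.1.2 * input g i q.2).
Proof.
move=> tT; have iT : (i < T)%N by exact: leq_trans (ltn_ord i) tT.
apply: measurable_funD; apply: measurable_funM.
- exact: (measurableT_comp measurable_fst measurable_fst).
- exact: (measurableT_comp (measurable_coord i) measurable_snd).
- exact: (measurableT_comp measurable_snd measurable_fst).
- exact: (measurableT_comp (measurable_input (hg iT)) measurable_snd).
Qed.

Let channelE t (i : 'I_t.+1) w : Yrv g A B W i.+1 w =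
  (full t w).1.1 * (full t w).2 i + (full t w).1.2 * input g i (full t w).2.
Proof.
have it : (i <= t)%N by rewrite -ltnS.
by rewrite /full_state /Yrv /= (input_history g A B W w it) (history_le g A B W w it).
Qed.

(** [Y i.+1] is formed from [X_i] and [U_i], so these channel inputs are functions of Theta and the
    path up to [t]. Given the path they range over a linear image of the plane, hence have no joint
    density from [t = 2] on; pulling events back to Theta avoids the need of one. *)
Lemma sigY_factor t E : (t < T)%N -> sigY t E ->
  exists2 E', measurable E' & E = full t @^-1` E'.
Proof.
move=> tT; apply: (sigmaRV_factor (fs := fun (i : 'I_t.+1) (q : state) =>
  q.1.1 * q.2 i + q.1.2 * input g i q.2)).
  by move=> i; exact: mchannel.
by move=> i w; exact: channelE.
Qed.

Lemma sigX1_factor t E : sigX1 t E ->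
  exists2 E', measurable E' & E = X t.+1 @^-1` E'.
Proof.
by apply: (sigmaRV_factor (S := TR) (fs := fun (_ : 'I_1) (x : TR) => x)).
Qed.

Lemma CMI_pred_lik t : (t < T)%N ->
  CMI P (sigY t) (sigX1 t) (sigX t) = ((ln 2)^-1%:E * relent P (pred_lik t))%E.
Proof.
move=> tT.
have mY i : measurable_fun setT (Yrv g A B W (i : 'I_t.+1).+1).
  rewrite (_ : Yrv _ _ _ _ _ = (fun q : state =>
    q.1.1 * q.2 i + q.1.2 * input g i q.2) \o full t).
    exact: (measurableT_comp (mchannel i tT) (mfull (ltnW tT))).
  by apply/funext => w; exact: channelE.
apply: CMI_relent => //.
- exact: pred_lik_gt0.
- exact: measurable_pred_lik.
- exact: integral_pred_lik1.
- exact: smallest_sigma_algebra.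
- exact: smallest_sigma_algebra.
- exact: smallest_sigma_algebra.
- exact: sigmaRV_measurable.
- by apply: sigmaRV_measurable => _; exact: mX.
- exact: sigX_measurable (ltnW tT).
- pose C := sigY t `|` sigX1 t `|` sigX t; move=> D mD.
  have sY : sigY t `<=` C by move=> E FE; left; left.
  have sX1 : sigX1 t `<=` C by move=> E FE; left; right.
  have sX : sigX t `<=` C by move=> E FE; right.
  have mY' := measurable_gen_sigmaRV sY ord_max.
  have mX' := measurable_gen_sigmaRV sX1 ord0.
  have mH' := measurable_gen_Hist sX.
  have mHX : measurable_fun (setT : set (g_sigma_algebraType C))
      (fun w => (Hist t w, X t.+1 w) : trace R * TR) by exact: measurable_fun_pair.
  have s0 : s != 0 by rewrite gt_eqF// sqrtr_gt0.
  have mp : measurable_fun (setT : set (g_sigma_algebraType C)) (pred_lik t).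
    apply: measurable_funM; first exact: (measurableT_comp (mpr tT) mHX).
    apply: (measurableT_comp (@measurable_inv R)).
    (* Theta need not be recoverable from the channel inputs, but the likelihood depends on it only
       through the last of them, which makes [pred_lik] measurable for the three sigma-algebras. *)
    rewrite (_ : (fun w => lik t (full t w, X t.+1 w)) =
      fun w => normal_pdf (Yrv g A B W t.+1 w) s (X t.+1 w)).
      exact: (measurable_normal_pdf_comp s0 mY' mX').
    by apply/funext => w; rewrite YrvE.
  by have := mp measurableT D mD; rewrite setTI.
- move=> a b c /(sigY_factor tT)[a' ma' ->] /sigX1_factor[b' mb' ->] Hc.
  have [c' mc' cE] := sigX_factor Hc.
  have ma'' := mpreim (mfull (ltnW tT)) ma'.
  have mac : measurable (a' `&` (snd : state -> trace R) @^-1` c').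
    by apply: measurableI => //; rewrite -[X in measurable X]setTI; exact: measurable_snd.
  have HXm := sigX_measurable (ltnW tT).
  rewrite (integral_condprob_mul HXm ma'' Hc (is_condprob_past (ltnW tT) ma')
    (is_condprob_next tT mb')).
  rewrite /Rintegral; congr fine; rewrite cE.
  rewrite setIAC -[X in (\int[_]_(_ in X `&` _) _)%E]/(full t @^-1` (a' `&` snd @^-1` c')).
  exact: integral_pred_lik.
Qed.

Lemma relent_prior_post t : (t <= T)%N ->
  ((ln 2)^-1%:E * relent P (prior_post t) =
   \sum_(i < t) (ln 2)^-1%:E * relent P (pred_lik i))%E.
Proof.
elim: t => [_|t IH tT].
  rewrite big_ord0 /relent integral0_eq ?mule0// => w _.
  by rewrite prior_post0 ln1 subrr subr0.
rewrite big_ord_recr/= -IH ?(ltnW tT)//.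
rewrite (_ : prior_post t.+1 = fun w => prior_post t w * pred_lik t w); last first.
  by apply/funext => w; exact: prior_postS.
rewrite relentM.
- rewrite ge0_muleDr//; apply: integral_ge0 => w _; rewrite lee_fin kl_loss_ge0//.
    exact: prior_post_gt0.
  exact: pred_lik_gt0.
- exact: prior_post_gt0.
- exact: pred_lik_gt0.
- exact: measurable_prior_post (ltnW tT).
- exact: measurable_pred_lik.
- exact: integral_prior_post1 (ltnW tT).
- exact: integral_pred_lik1.
- rewrite -[RHS](integral_prior_post1 tT).
  by apply: eq_integral => w _; rewrite prior_postS.
Qed.

Theorem MI_directed_information : MI P sigTheta (sigX T) =
  (\sum_(t < T) CMI P (sigY t) (sigX1 t) (sigX t))%E.
Proof.
rewrite MI_prior_post// relent_prior_post//.
by apply: eq_bigr => t _; rewrite CMI_pred_lik.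
Qed.


(** * The determinant bound *)

Local Notation detJ t h := (gdet (J11 Wv p11 t h) (J12 g Wv p12 t h) (J22 g Wv p22 t h)).
Local Notation quad := (postquad g Wv p11 p12 p22 q1 q2).

Let quad_ge0 t h a b : 0 <= quad t h a b. Proof. exact: postquad_ge0. Qed.

Let detJ_gt0 t h : 0 < detJ t h.
Proof. by have [] := J_gt0 g W_gt0 p22_gt0 det_gt0 t h. Qed.

Let mquad t : (t <= T)%N -> measurable_fun setT (fun w => quad t (Hist t w) (A w) (B w)).
Proof.
by move=> tT; exact: (measurableT_comp (measurable_postquad Wv p11 p12 p22 q1 q2 hg tT) (mfull tT)).
Qed.

Lemma expect_postquad t : (t <= T)%N ->
  (\int[P]_w (quad t (Hist t w) (A w) (B w))%:E = 2%:E)%E.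
Proof.
move=> tT; have mq := measurable_postquad Wv p11 p12 p22 q1 q2 hg tT.
pose F (q : state) : \bar R := (quad t q.2 q.1.1 q.1.2)%:E.
have mF : measurable_fun setT F by exact/measurable_EFinP.
have F0 q : (0 <= F q)%E by rewrite lee_fin.
rewrite [LHS](bayesT tT mF F0) (eq_integral (cst 2%:E)).
  by rewrite integral_cst// [X in (_ * X)%E]probability_setT mule1.
move=> w _; rewrite -[RHS](integral_postquad g q1 q2 W_gt0 p22_gt0 det_gt0 t (Hist t w)).
have m2 : measurable_fun setT (fun x : TR * TR => (x, Hist t w) : state).
  by apply: measurable_fun_pair.
rewrite integral_lebesgue2.
- by apply: eq_integral => a _; apply: eq_integral => b _; rewrite EFinM.
- apply: emeasurable_funM; first exact: (measurableT_comp mF m2).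
  by apply/measurable_EFinP; exact: mpoh.
- by move=> x; rewrite mule_ge0// lee_fin ltW.
Qed.

Lemma ln_gdens (j11 j12 j22 e1 e2 a b : R) : 0 < gdet j11 j12 j22 ->
  2 * ln (gdens j11 j12 j22 e1 e2 a b) =
  ln (gdet j11 j12 j22) - 2 * ln (2 * pi) - gquad j11 j12 j22 e1 e2 a b.
Proof.
move=> D0; have sD0 : 0 < Num.sqrt (gdet j11 j12 j22) by rewrite sqrtr_gt0.
have pi2 : 0 < 2 * pi :> R by rewrite mulr_gt0 ?pi_gt0.
rewrite -[in RHS](sqr_sqrtr (ltW D0)) lnXn// /gdens.
rewrite [ln (_ * expR _)]lnM ?posrE ?expR_gt0 ?divr_gt0// expRK ln_div ?posrE//.
by rewrite mulr2n; field.
Qed.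

Lemma ln_detJ_ratio t w : ln (gdet p11 p12 p22 / detJ t (Hist t w)) =
  2 * ln (prior_post t w) + gquad p11 p12 p22 q1 q2 (A w) (B w)
  - quad t (Hist t w) (A w) (B w).
Proof.
rewrite !ln_div ?posrE// mulrBr !ln_gdens//.
by rewrite -[gquad (J11 _ _ _ _) _ _ _ _ _ _]/(quad t (Hist t w) (A w) (B w)); ring.
Qed.

Let integral_affine (f q : Omega -> R) k c x y : 0 <= k -> 0 <= c ->
  (forall w, 0 <= f w) -> (forall w, 0 <= q w) ->
  measurable_fun setT f -> measurable_fun setT q ->
  (\int[P]_w (f w)%:E = x%:E)%E -> (\int[P]_w (q w)%:E = y%:E)%E ->
  (\int[P]_w (k * (2 * f w + q w + c))%:E = (k * (2 * x + y + c))%:E)%E.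
Proof.
move=> k0 c0 f0 q0 mf mq fx qy.
have mf2 : measurable_fun setT (fun w => (2 * f w)%:E).
  by apply/measurable_EFinP; exact: measurable_funM.
have mq2 : measurable_fun setT (fun w => (q w)%:E) by exact/measurable_EFinP.
have f20 w : (0 <= (2 * f w)%:E)%E by rewrite lee_fin mulr_ge0.
have q20 w : (0 <= (q w)%:E)%E by rewrite lee_fin.
have c20 : (0 <= c%:E)%E by rewrite lee_fin.
transitivity (k%:E * \int[P]_w ((2 * f w)%:E + (q w)%:E + c%:E))%E.
  rewrite -ge0_integralZl//.
  - by apply: emeasurable_funD => //; exact: emeasurable_funD.
  - by move=> w _; rewrite !adde_ge0.
rewrite ge0_integralD//; last 2 first.
- by move=> w _; rewrite adde_ge0.
- exact: emeasurable_funD.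
rewrite ge0_integralD//.
under eq_integral do rewrite EFinM.
rewrite ge0_integralZl//; [|exact/measurable_EFinP|by move=> w _; rewrite lee_fin].
by rewrite integral_cst// [X in (c%:E * X)%E]probability_setT mule1 fx qy.
Qed.

(* Jensen's inequality for [exp], as its tangent line at [- 2 r]: the two
   quadratic forms have the same expectation and cancel. *)
Lemma expect_inv_detJ_ge t (r : R) : (t <= T)%N -> relent P (prior_post t) = r%:E ->
  (((gdet p11 p12 p22)^-1 * expR (- (2 * r)))%:E <=
   \int[P]_w ((detJ t (Hist t w))^-1)%:E)%E.
Proof.
move=> tT hr; set D0 := gdet p11 p12 p22; set k := D0^-1 * _.
pose l w := prior_post t w - 1 - ln (prior_post t w).
pose qT w := quad t (Hist t w) (A w) (B w).
pose q0 w := gquad p11 p12 p22 q1 q2 (A w) (B w).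
have k0 : 0 <= k by rewrite mulr_ge0 ?expR_ge0 ?invr_ge0 ?ltW.
have l0 w : 0 <= l w by apply: kl_loss_ge0; exact: prior_post_gt0.
have r0 : 0 <= r by rewrite -lee_fin -hr; apply: integral_ge0 => w _; rewrite lee_fin; exact: l0.
have mh := measurable_prior_post tT.
have ml : measurable_fun setT l.
  apply: measurable_funB; first exact: measurable_funB.
  exact: (measurableT_comp (@measurable_ln R)).
have q0E w : q0 w = quad 0 (Hist 0 w) (A w) (B w).
  by rewrite /q0 /postquad /J11 /J12 /J22 /E1 /E2 !big_ord0 !addr0.
have mq0 : measurable_fun setT q0.
  by rewrite (funext q0E); exact: mquad.
have q00 w : 0 <= q0 w by rewrite q0E.
have iq0 : (\int[P]_w (q0 w)%:E = 2%:E)%E.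
  by rewrite -(expect_postquad (leq0n T)); apply: eq_integral => w _; rewrite q0E.
have mi : measurable_fun setT (fun w => (detJ t (Hist t w))^-1).
  apply: (measurableT_comp (@measurable_inv R)).
  exact: (measurableT_comp (measurable_gdetJ Wv p11 p12 p22 q1 q2 hg tT) (mHist tT)).
(* The inequality [1 + u <= expR u] at [u = ln (D0 / detJ) + 2 * r], with [2 * ln (prior_post t w)]
   written as [2 * prior_post t w - 2 - 2 * l w] and every negative term moved across. Both sides
   are nonnegative; their explicit parts integrate to [k * (4 + 2 * r)] and [k * (3 + 2 * r)], whose
   difference is [k]. *)
have bound w : k * (2 * prior_post t w + q0 w + 2 * r) <=
    (detJ t (Hist t w))^-1 + k * (2 * l w + qT w + 1).
  have Dt := detJ_gt0 t (Hist t w).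
  have ratio : (detJ t (Hist t w))^-1 =
      k * expR (2 * ln (prior_post t w) + q0 w - qT w + 2 * r).
    rewrite -ln_detJ_ratio expRD lnK ?posrE ?divr_gt0// /k expRN -/D0.
    by field; rewrite !gt_eqF ?expR_gt0.
  rewrite ratio -mulrDr; apply: ler_wpM2l => //.
  have := expR_ge1Dx (2 * ln (prior_post t w) + q0 w - qT w + 2 * r).
  by rewrite /l; lra.
have := @ge0_le_integral _ _ _ P setT measurableT
  (fun w => (k * (2 * prior_post t w + q0 w + 2 * r))%:E)
  (fun w => ((detJ t (Hist t w))^-1 + k * (2 * l w + qT w + 1))%:E).
rewrite (integral_affine k0 _ _ q00 mh mq0 (integral_prior_post1 tT) iq0); last 2 first.
- by rewrite mulr_ge0.
- by move=> w; exact/ltW/prior_post_gt0.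
have mrhs : measurable_fun setT (fun w => k * (2 * l w + qT w + 1)).
  apply: measurable_funM => //; apply: measurable_funD => //.
  by apply: measurable_funD; [exact: measurable_funM|exact: mquad].
have rhs0 w : 0 <= k * (2 * l w + qT w + 1).
  apply: mulr_ge0 => //; apply: addr_ge0 => //; apply: addr_ge0; first exact: mulr_ge0.
  exact: quad_ge0.
have -> : (\int[P]_w ((detJ t (Hist t w))^-1 + k * (2 * l w + qT w + 1))%:E =
    \int[P]_w ((detJ t (Hist t w))^-1)%:E + (k * (2 * r + 2 + 1))%:E)%E.
  rewrite -(integral_affine k0 ler01 l0 _ ml (mquad tT) hr (expect_postquad tT)); last first.
    by move=> w; exact: quad_ge0.
  rewrite -ge0_integralD//.
  - by move=> w _; rewrite lee_fin invr_ge0 ltW.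
  - exact/measurable_EFinP.
  - by move=> w _; rewrite lee_fin.
  - exact/measurable_EFinP.
rewrite -leeBlDr// -EFinB.
have -> : k * (2 * 1 + 2 + 2 * r) - k * (2 * r + 2 + 1) = k by ring.
apply.
- move=> w _; rewrite lee_fin; apply: mulr_ge0 => //; apply: addr_ge0; last exact: mulr_ge0.
  by apply: addr_ge0 => //; apply: mulr_ge0 => //; exact/ltW/prior_post_gt0.
- apply/measurable_EFinP; apply: measurable_funM => //; apply: measurable_funD => //.
  by apply: measurable_funD => //; exact: measurable_funM.
- by apply/measurable_EFinP; exact: measurable_funD.
- by move=> w _; rewrite lee_fin.
Qed.

End Identification.

(** * Covariance matrices *)

Section TwoByTwo.
Context {R : realType}.
Local Notation o1 := (Ordinal (isT : (1 < 2)%N)).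

Let lift00 : lift ord0 ord0 = o1 :> 'I_2. Proof. exact: val_inj. Qed.
Let lift10 : lift o1 ord0 = ord0 :> 'I_2. Proof. exact: val_inj. Qed.

Let sum2 (F : 'I_2 -> R) : \sum_i F i = F ord0 + F o1.
Proof. by rewrite big_ord_recl big_ord1 lift00. Qed.

Lemma det2 (S : 'M[R]_2) : \det S = S ord0 ord0 * S o1 o1 - S ord0 o1 * S o1 ord0.
Proof.
rewrite (expand_det_row _ ord0) sum2 /cofactor !det_mx11 !mxE !lift00 !lift10 /=.
by rewrite expr0 expr1 mul1r mulN1r mulrN.
Qed.

Lemma quadform2 (S : 'M[R]_2) (v : 'cV[R]_2) : (v^T *m S *m v) ord0 ord0 =
  S ord0 ord0 * v ord0 ord0 ^+ 2 + (S ord0 o1 + S o1 ord0) * v ord0 ord0 * v o1 ord0 +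
  S o1 o1 * v o1 ord0 ^+ 2.
Proof. by rewrite !mxE sum2 !mxE !sum2 !mxE; ring. Qed.

Lemma posdef_det_gt0 (S : 'M[R]_2) : posdef S -> 0 < \det S.
Proof.
move=> [symS posS]; have S10 : S o1 ord0 = S ord0 o1 by rewrite -[in LHS]symS mxE.
have S00 : 0 < S ord0 ord0.
  have := posS (col2 1 0); rewrite quadform2 !mxE/=.
  rewrite expr1n expr0n/= !mulr0 !addr0 mulr1; apply.
  by apply/eqP => /colP/(_ ord0); rewrite !mxE/= => /eqP; rewrite oner_eq0.
(* At this vector, orthogonal to the first row of [S], the form takes the value
   [S ord0 ord0 * \det S]. *)
have := posS (col2 (- S ord0 o1) (S ord0 ord0)); rewrite quadform2 !mxE/= S10 det2 S10 => H.
have {}H := H ltac:(by apply/eqP => /colP/(_ o1); rewrite !mxE/= => /eqP; rewrite gt_eqF).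
move: H; rewrite [X in 0 < X](_ : _ =
  S ord0 ord0 * (S ord0 ord0 * S o1 o1 - S ord0 o1 * S ord0 o1)); last by ring.
by rewrite pmulr_rgt0.
Qed.

Lemma posdef_unitmx (S : 'M[R]_2) : posdef S -> S \in unitmx.
Proof. by move=> /posdef_det_gt0 d0; rewrite unitmxE unitfE gt_eqF. Qed.

Lemma posdef_invmx (S : 'M[R]_2) : posdef S -> posdef (invmx S).
Proof.
move=> pS; have [symS posS] := pS; have uS := posdef_unitmx pS.
have symV : (invmx S)^T = invmx S by rewrite trmx_inv symS.
split=> // v v0; have := posS (invmx S *m v).
rewrite trmx_mul symV -!mulmxA mulKVmx//; apply.
by apply: contra v0 => /eqP e; rewrite -(mulKVmx uS v) e mulmx0.
Qed.

Lemma posdef_diag_gt0 (S : 'M[R]_2) : posdef S -> 0 < S o1 o1.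
Proof.
move=> [_ posS]; have := posS (col2 0 1); rewrite quadform2 !mxE/=.
rewrite expr1n expr0n/= !mulr0 mul0r !add0r mulr1; apply.
by apply/eqP => /colP/(_ o1); rewrite !mxE/= => /eqP; rewrite oner_eq0.
Qed.

Lemma posdef_gdet (S : 'M[R]_2) : posdef S ->
  gdet (S ord0 ord0) (S ord0 o1) (S o1 o1) = \det S.
Proof.
by move=> [symS _]; rewrite det2 /gdet -[in S o1 ord0]symS mxE expr2.
Qed.

Lemma gauss2_gdens (m : 'cV[R]_2) (S : 'M[R]_2) (a b : R) : posdef S ->
  gauss2 m S (col2 a b) =
  gdens (invmx S ord0 ord0) (invmx S ord0 o1) (invmx S o1 o1)
    ((invmx S *m m) ord0 ord0) ((invmx S *m m) o1 ord0) a b.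
Proof.
move=> pS; have pV := posdef_invmx pS; have [symV _] := pV.
have V10 : invmx S o1 ord0 = invmx S ord0 o1 by rewrite -[in LHS]symV mxE.
have dS := posdef_det_gt0 pS; have dV := posdef_det_gt0 pV.
rewrite /gauss2 /gdens posdef_gdet// det_inv sqrtrV ?ltW// invfM mulrC.
rewrite [in LHS]mulrC; congr (_ * expR (- (_ / 2))); first by rewrite mulrC.
move: dV; rewrite -posdef_gdet// quadform2 !mxE !sum2 /= V10 /gquad /gdet => dV.
by field; rewrite gt_eqF.
Qed.

End TwoByTwo.

Lemma exp2m2E (R : realType) (r : R) :
  exp2m2 ((ln 2)^-1%:E * r%:E) = (expR (- (2 * r)))%:E.
Proof.
rewrite /exp2m2 /= /powR pnatr_eq0/=; congr (expR _)%:E.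
by field; rewrite gt_eqF// ln_gt0// ltr1n.
Qed.

Section Covariance.
Context (R : realType) (d : measure_display) (Omega : measurableType d).
Variables (g : forall t : nat, 'rV[R]_t.+1 -> R).
Variables (A B : Omega -> R) (W : nat -> Omega -> R).
Local Notation o1 := (Ordinal (isT : (1 < 2)%N)).

Lemma det_Pirv (Wv : R) (Pi0 : 'M[R]_2) t w : posdef Pi0 ->
  \det (Pirv g A B W Wv Pi0 t w) =
  (let h := history g A B W t w in
   gdet (J11 Wv (invmx Pi0 ord0 ord0) t h) (J12 g Wv (invmx Pi0 ord0 o1) t h)
        (J22 g Wv (invmx Pi0 o1 o1) t h))^-1.
Proof.
move=> pS; have [symV _] := posdef_invmx pS; rewrite /Pirv det_inv; congr (_^-1).
have entry i j : (invmx Pi0 + \sum_(k < t) Wv^-1 *: (Zrv g A B W k w *m (Zrv g A B W k w)^T)) i j =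
    invmx Pi0 i j + \sum_(k < t) Wv^-1 * (Zrv g A B W k w i ord0 * Zrv g A B W k w j ord0).
  rewrite mxE summxE; congr (_ + _); apply: eq_bigr => k _.
  by rewrite !mxE big_ord1 !mxE.
have XE (k : 'I_t) : history g A B W t w k = Xrv g A B W k w by rewrite history_le// ltnW.
have UE (k : 'I_t) : input g k (history g A B W t w) = Urv g A B W k w.
  by rewrite input_history// ltnW.
rewrite det2 !entry /gdet /J11 /J12 /J22 -[in invmx Pi0 o1 ord0]symV mxE expr2.
congr (_ * _ - _ * _); congr (_ + _); apply: eq_bigr => k _;
  by rewrite !mxE/= ?XE ?UE; ring.
Qed.

End Covariance.

Theorem theorem2 (R : realType) (d : measure_display) (Omega : measurableType d)
  (P : probability Omega R) (T : nat) (hT : (1 <= T)%N)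
  (Wv : R) (hW : 0 < Wv) (theta0 : 'cV[R]_2) (Pi0 : 'M[R]_2) (hPi0 : posdef Pi0)
  (A B : Omega -> R) (W : nat -> Omega -> R)
  (mA : measurable_fun setT A) (mB : measurable_fun setT B)
  (mW : forall t, measurable_fun setT (W t))
  (* Theta = [A B]^T ~ N(theta0, Pi0), W_0, ..., W_{T-1} i.i.d. N(0, W),
     all mutually independent (joint law given on measurable rectangles) *)
  (hlaw : forall (C1 C2 : set R) (D : 'I_T -> set R),
     measurable C1 -> measurable C2 -> (forall t, measurable (D t)) ->
     P [set w | C1 (A w) /\ C2 (B w) /\ forall t : 'I_T, D t (W t w)] =
     ((\int[lebesgue_measure]_(a in C1) \int[lebesgue_measure]_(b in C2)
          (gauss2 theta0 Pi0 (col2 a b))%:E) *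
      \prod_(t < T) \int[lebesgue_measure]_(x in D t)
          (normal_pdf 0 (Num.sqrt Wv) x)%:E)%E)
  (g : forall t : nat, 'rV[R]_t.+1 -> R)
  (hg : forall t : nat, (t < T)%N -> rV_measurable_fun (g t)) :
  let X := Xrv g A B W in
  let Y := Yrv g A B W in
  let DI := (\sum_(t < T)
      CMI P (sigmaRV (fun i : 'I_t.+1 => Y i.+1))
            (sigmaRV (fun _ : 'I_1 => X t.+1))
            (sigmaRV (fun i : 'I_t.+1 => X i)))%E in
  MI P (sigmaRV (fun i : 'I_2 => if i == ord0 then A else B))
       (sigmaRV (fun i : 'I_T.+1 => X i)) = DI /\
  ((\det Pi0)%:E * exp2m2 DI <= Expect P (fun w => \det (Pirv g A B W Wv Pi0 T w)))%E.
Proof.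
move=> X Y DI.
pose o1 := Ordinal (isT : (1 < 2)%N).
pose p11 := invmx Pi0 ord0 ord0; pose p12 := invmx Pi0 ord0 o1.
pose p22 := invmx Pi0 o1 o1.
pose q1 := (invmx Pi0 *m theta0) ord0 ord0; pose q2 := (invmx Pi0 *m theta0) o1 ord0.
have pV := posdef_invmx hPi0.
have p22_gt0 : 0 < p22 := posdef_diag_gt0 pV.
have gdetE : gdet p11 p12 p22 = \det (invmx Pi0) := posdef_gdet pV.
have det_gt0 : 0 < gdet p11 p12 p22 by rewrite gdetE; exact: posdef_det_gt0.
(* The density stands under the integration variables, so it is exchanged through an equality of
   functions of two arguments. *)
have law_of_density (f : R -> R -> R) : (fun a b => gauss2 theta0 Pi0 (col2 a b)) = f ->
    forall (C1 C2 : set R) (D : 'I_T -> set R),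
    measurable C1 -> measurable C2 -> (forall t, measurable (D t)) ->
    P [set w | C1 (A w) /\ C2 (B w) /\ forall t : 'I_T, D t (W t w)] =
    ((\int[lebesgue_measure]_(a in C1) \int[lebesgue_measure]_(b in C2) (f a b)%:E) *
     \prod_(t < T) \int[lebesgue_measure]_(x in D t)
       (normal_pdf 0 (Num.sqrt Wv) x)%:E)%E.
  by move=> <-; exact hlaw.
have densE : (fun a b => gauss2 theta0 Pi0 (col2 a b)) = gdens p11 p12 p22 q1 q2.
  by apply/funext => a; apply/funext => b; exact (gauss2_gdens theta0 a b hPi0).
have law := law_of_density _ densE.
have MI_DI := MI_directed_information hW p22_gt0 det_gt0 mA mB mW law hg.
split=> //; rewrite /DI -MI_DI (MI_prior_post hW p22_gt0 det_gt0 mA mB mW law hg (leqnn T)).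
have PiE w := det_Pirv g A B W Wv T w hPi0.
have Pi0E : \det Pi0 = (gdet p11 p12 p22)^-1 by rewrite gdetE det_inv invrK.
rewrite /Expect; under eq_integral do rewrite PiE.
set S := relent _ _; have S0 : (0 <= S)%E.
  apply: integral_ge0 => w _; rewrite lee_fin kl_loss_ge0//.
  exact: (prior_post_gt0 q1 q2 hW p22_gt0 det_gt0).
case SE : S S0 => [r||]; rewrite ?leNye_eq// => S0.
- rewrite exp2m2E -EFinM Pi0E.
  exact: (expect_inv_detJ_ge hW p22_gt0 det_gt0 mA mB mW law hg (leqnn T) SE).
(* Infinite information makes the left-hand side 0, and the determinant on the right is positive. *)
- rewrite gt0_muley ?lte_fin ?invr_gt0 ?ln_gt0 ?ltr1n//= mule0.
  apply: integral_ge0 => w _; rewrite lee_fin invr_ge0 ltW//.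
  by have [] := J_gt0 g hW p22_gt0 det_gt0 T (history g A B W T w).
Qed.
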